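(* Let $E$ be a real Banach space, $H$ a separable real Hilbert space and $W:H\to L^2(\Omega)$ an isonormal Gaussian process. For all $1\le p<\infty$, the Malliavin derivative $D$, defined on $\mathscr{S}(\Omega)\otimes E$, is closable as an operator from $L^p(\Omega;E)$ into $L^p(\Omega;\gamma(H,E))$.
   Context: $(\Omega,\mathscr{F},\mathbb{P})$ is a complete probability space. An isonormal Gaussian process is a bounded linear operator $W:H\to L^2(\Omega)$ such that the random variables $W(h)$ are centred Gaussian with $\mathbb{E}(W(h_1)W(h_2))=[h_1,h_2]_H$. $\gamma(H,E)$ is the Banach space of $\gamma$-radonifying operators: bounded linear $R:H\to E$ such that $\sum_n\gamma_nRh_n$ converges in $L^2(\Omega';E)$ for some (equivalently every) orthonormal basis $(h_n)$ of $H$, where $(\gamma_n)$ are independent standard Gaussians on a probability space $\Omega'$; the norm is $\|R\|_{\gamma(H,E)}=(\mathbb{E}\|\sum_n\gamma_nRh_n\|^2)^{1/2}$. For $h\in H,x\in E$, $h\otimes x$ denotes the operator $g\mapsto[g,h]_Hx$. $\mathscr{S}(\Omega)$ is the set of random variables $f(W(h_1),\dots,W(h_n))$ with $n\ge1$, $h_j\in H$, and $f\in C_b^\infty(\mathbb{R}^n)$ (bounded real-valued $C^\infty$ functions with bounded derivatives of all orders). For $F=f(W(h_1),\dots,W(h_n))\otimes x$, $x\in E$, the Malliavin derivative is $DF=\sum_{j=1}^n\partial_jf(W(h_1),\dots,W(h_n))\otimes(h_j\otimes x)$, a $\gamma(H,E)$-valued random variable; the definition extends to $\mathscr{S}(\Omega)\otimes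 E$ by linearity. *)

(* Defs.v *)
From HB Require Import structures.
From mathcomp Require Import all_boot all_order all_algebra.
From mathcomp Require Import all_classical all_reals all_analysis.

Set Implicit Arguments.
Unset Strict Implicit.
Unset Printing Implicit Defensive.

Import Order.TTheory GRing.Theory Num.Theory.
Import numFieldNormedType.Exports.

Local Open Scope classical_set_scope.
Local Open Scope ring_scope.

(** * Real Hilbert spaces *)

(* A real Hilbert space is a complete normed space whose norm is induced by
   [ip]; positive definiteness of [ip] follows from that of the norm. *)
Record is_inner_product {R : realType} {H : normedModType R}
    (ip : H -> H -> R) : Prop := IsInnerProduct {
  ip_sym : forall x y, ip x y = ip y x;
  ip_linear : forall z (a : R) x y, ip (a *: x + y) z = a * ip x z + ip y z;
  ip_norm : forall x, ip x x = `|x| ^+ 2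
}.

Definition separable (T : topologicalType) : Prop :=
  exists2 D : set T, countable D & closure D = setT.

(* The orthonormal basis is (e n)_(n \in I), where I is a finite or infinite
   set of indices: this covers finite-dimensional spaces.  The values of e
   outside I are irrelevant. *)
Record is_orthonormal_basis {R : realType} {H : normedModType R}
    (ip : H -> H -> R) (I : pred nat) (e : nat -> H) : Prop :=
  IsOrthonormalBasis {
  onb_orthonormal : forall m n, m \in I -> n \in I ->
    ip (e m) (e n) = (m == n)%:R;
  onb_total :
    closure [set v | exists (N : nat) (c : nat -> R),
                v = \sum_(n < N | (n : nat) \in I) c n *: e n] = setT
}.

(* h \otimes x *)
Definition rank_one {R : realType} {H : normedModType R} {E : lmodType R}
  (ip : H -> H -> R) (h : H) (x : E) : H -> E := fun g => ip g h *: x.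

(** * Lebesgue-Bochner spaces *)

(* A normed space presented as a set of vectors of an ambient vector space,
   with a norm that is meaningful on that set only. *)
Record normed_space (R : realType) (V : lmodType R) := NormedSpace {
  carrier : set V;
  norm : V -> R
}.

Definition whole_space {R : realType} (E : normedModType R) : normed_space E :=
  NormedSpace setT (fun x : E => `|x|).

Section bochner.
Context {R : realType} {d : measure_display} {T : measurableType d}.
Context {V : lmodType R}.
Implicit Types (P : {measure set T -> \bar R}) (B : normed_space V).
Implicit Types (F : T -> V) (p : R).

Definition is_simple B F : Prop :=
  [/\ forall w, carrier B (F w), finite_set (range F) &
      forall v, measurable (F @^-1` [set v])].

(* Every almost everywhere limit of simple functions is almost everywhere equal
   to a limit taken at every point: each class in L^p has a representative
   that is strongly measurable in this sense. *)
Definition strongly_measurable B F : Prop :=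
  exists2 s : nat -> T -> V, (forall n, is_simple B (s n)) &
    forall w, norm B (s n w - F w) @[n --> \oo] --> 0.

Definition Lp_norm P p B F : \bar R :=
  ('N[P]_(p%:E)[EFin \o (norm B \o F)])%E.

Definition in_Lp P p B F : Prop :=
  [/\ forall w, carrier B (F w), strongly_measurable B F &
      (Lp_norm P p B F < +oo)%E].

Definition cvg_Lp P p B (Fn : nat -> T -> V) F : Prop :=
  Lp_norm P p B (fun w => Fn n w - F w) @[n --> \oo] --> 0%E.

End bochner.

(* [A F G] reads: F belongs to the domain of the operator and G is its image.
   Functions represent classes modulo almost everywhere equality. *)
Section closability.
Context {R : realType} {d : measure_display} {T : measurableType d}.
Context {V1 V2 : lmodType R}.
Variables (P : {measure set T -> \bar R}) (p : R).
Variables (B1 : normed_space V1) (B2 : normed_space V2).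

Definition operator_into_Lp (A : (T -> V1) -> (T -> V2) -> Prop) : Prop :=
  forall F G, A F G -> in_Lp P p B1 F /\ in_Lp P p B2 G.

(* For a linear relation A this includes, by taking constant sequences, that A
   is single-valued modulo almost everywhere equality. *)
Definition closable_in_Lp (A : (T -> V1) -> (T -> V2) -> Prop) : Prop :=
  forall (Fn : nat -> T -> V1) (Gn : nat -> T -> V2) (G : T -> V2),
    (forall n, A (Fn n) (Gn n)) ->
    cvg_Lp P p B1 Fn (fun=> 0) ->
    in_Lp P p B2 G -> cvg_Lp P p B2 Gn G ->
    {ae P, forall w, G w = 0}.

End closability.

(** * Gaussian random variables *)

Section gaussian.
Context {R : realType} {d : measure_display} {T : measurableType d}.
Variable P : probability T R.

(* normal_prob takes the standard deviation, and is not the Dirac measure when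
   the latter is 0. *)
Definition centred_gaussian (X : T -> R) : Prop :=
  exists s : R, forall A : set R, measurable A ->
    P (X @^-1` A) = if s == 0 then \d_(0 : R) A else normal_prob 0 s A.

Definition standard_gaussian (X : T -> R) : Prop :=
  forall A : set R, measurable A -> P (X @^-1` A) = normal_prob 0 1 A.

Definition independent (X : nat -> T -> R) : Prop :=
  forall (s : seq nat) (A : nat -> set R), uniq s ->
    (forall n, measurable (A n)) ->
    P (\bigcap_(n in [set` s]) (X n @^-1` A n)) =
    (\prod_(n <- s) P (X n @^-1` A n))%E.

Record is_gaussian_sequence (X : nat -> {RV P >-> R}) : Prop :=
  IsGaussianSequence {
  gseq_standard : forall n, standard_gaussian (X n);
  gseq_independent : independent (fun n => X n)
}.

(* [W h] is a representative of the class in L^2, whence linearity almost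
   everywhere. *)
Record is_isonormal {H : normedModType R} (ip : H -> H -> R)
    (W : H -> {RV P >-> R}) : Prop := IsIsonormal {
  iso_linear : forall (a : R) h k,
    {ae P, forall w, W (a *: h + k) w = a * W h w + W k w};
  iso_bounded : exists C : R, forall h,
    ('N[P]_(2%:E)[EFin \o W h] <= (C * `|h|)%:E)%E;
  iso_gaussian : forall h, centred_gaussian (W h);
  iso_covariance : forall h k,
    ('E_P[W h \* W k] = (ip h k)%:E)%E
}.

End gaussian.

(** * Radonifying operators *)

Section radonifying.
Context {R : realType} {H : normedModType R} {E : normedModType R}.
Context {d : measure_display} {T : measurableType d}.
Variables (P : probability T R) (g : nat -> {RV P >-> R}).
Variables (I : pred nat) (e : nat -> H).

Definition gaussian_sum (S : H -> E) (N : nat) : T -> E :=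
  fun w => \sum_(n < N | (n : nat) \in I) g n w *: S (e n).

Definition gaussian_series (S : H -> E) (X : T -> E) : Prop :=
  in_Lp P 2 (whole_space E) X /\
  cvg_Lp P 2 (whole_space E) (gaussian_sum S) X.

Definition radonifying (S : H -> E) : Prop :=
  [/\ linear S, continuous S & exists X, gaussian_series S X].

(* The sum of the series is chosen with xget among the representatives of its
   class in L^2. *)
Definition gamma_norm (S : H -> E) : R :=
  fine (Lp_norm P 2 (whole_space E) (xget (fun=> 0) (gaussian_series S))).

Definition gamma_space : normed_space (H -> E : lmodType R) :=
  NormedSpace radonifying gamma_norm.

End radonifying.

(** * Malliavin derivative *)

Section malliavin.
Context {R : realType}.

Definition partial {n : nat} (j : 'I_n) (f : 'rV[R]_n -> R) : 'rV[R]_n -> R :=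
  fun x => 'D_(delta_mx 0 j) f x.

(* C_b^oo: all iterated partial derivatives exist, are differentiable (hence
   continuous) and are bounded. *)
Definition Cb_infty {n : nat} (f : 'rV[R]_n -> R) : Prop :=
  forall s : seq 'I_n, let fs := foldr partial f s in
    (forall x, differentiable fs x) /\
    (exists M : R, forall x, `|fs x| <= M).

Context {d : measure_display} {T : measurableType d} {P : probability T R}.
Context {H : normedModType R} {E : lmodType R}.
Variables (ip : H -> H -> R) (W : H -> {RV P >-> R}).

(* (W(h_1), ..., W(h_n)) *)
Definition isonormal_vector {n : nat} (h : 'I_n -> H) (w : T) : 'rV[R]_n :=
  \row_j W (h j) w.

(* The graph of D on the algebraic tensor product of smooth random variables
   with E. *)
Inductive malliavin : (T -> E) -> (T -> H -> E) -> Prop :=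
| malliavin_elementary (n : nat) (f : 'rV[R]_n.+1 -> R) (h : 'I_n.+1 -> H)
    (x : E) : Cb_infty f ->
    malliavin (fun w => f (isonormal_vector h w) *: x)
      (fun w => \sum_(j < n.+1)
          partial j f (isonormal_vector h w) *: rank_one ip (h j) x)
| malliavin_add F DF G DG : malliavin F DF -> malliavin G DG ->
    malliavin (fun w => F w + G w) (fun w => DF w + DG w).

End malliavin.

(* Main.v *)
Require Import Defs.
From HB Require Import structures.
From mathcomp Require Import all_boot all_order all_algebra.
From mathcomp Require Import all_classical all_reals all_analysis.
From mathcomp Require Import measurable_realfun ring lra.
Import Order.TTheory GRing.Theory Num.Theory.
Import numFieldNormedType.Exports.
Local Open Scope classical_set_scope.
Local Open Scope ring_scope.

(* Let h = e_i be a basis vector, phi a functional of norm at most 1 on E, and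
   Z = W(h).  Since |phi (S h)| <= ||S||_gamma, one has phi (F_n) -> 0 and
   X_n = phi (DF_n h) -> X = phi (G h) in L^1, so only scalar derivatives in the
   direction of h matter.  Gaussian integration by parts, applied to the product
   of phi (F_n) and of the test function theta (X_m) / (1 + Z^2), where
   theta (y) = y / (1 + y^2), bounds |E (X_n theta (X_m) / (1 + Z^2))| by
   C_m E |phi (F_n)|.  Letting n and then m tend to infinity yields
   E (X theta (X) / (1 + Z^2)) = 0, that is X = 0; it is the boundedness of the
   test function, of its derivative and of its product with Z that covers the
   case p = 1.  As G is a limit of simple functions, countably many functionals
   phi suffice to get G e_i = 0 for all i, hence G = 0 since (e_i) is total.

   For the integration by parts, W(k) = [k, h] Z + W(k - [k, h] h), where the
   second process is independent of Z; it is frozen, and Stein's identity is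
   applied to Z.  The independence, which comes from the characteristic functions,
   only concerns trigonometric polynomials at first; Bernstein polynomials in
   sin (s / L) extend it to bounded functions that are continuous along lines.

   The derivative takes its values in gamma(H, E) because the series
   sum g_n [e_n, h] converges in L^2(Omega') by Bessel's inequality. *)

Set Implicit Arguments.
Unset Strict Implicit.
Unset Printing Implicit Defensive.

(** * Integrals of real functions *)

(** The test variable is built from the sequence itself: as X_m tends to X, X ends up tested against
    its own truncation, and y theta (y) vanishes only at 0, so that separation of points is
    automatic. The price is that C_m contains a bound of the second derivative of the m-th variable,
    which is uncontrolled in m; hence n goes to infinity while m is fixed. The dual of E may be
    nonseparable. Functionals are therefore attached to the values of the simple approximations of G
    at the basis vectors, each functional norming its own value. W is linear only up to null sets
    that depend on the vectors. Random variables are thus kept as functions of the whole family (W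
    k)_k that depend on finitely many coordinates: the shift along h is an exact operation on such
    functions, and linearity is invoked for finitely many vectors at a time. Bernstein polynomials
    are taken in a sine because this stays bounded on the whole line: the approximations inherit the
    bound of the function, and pointwise convergence with domination is enough. *)

Section real_integrals.
Context {d : measure_display} {T : measurableType d} {R : realType}.

Implicit Types (f g : T -> R) (c C : R).

Section measure.
Variable mu : {measure set T -> \bar R}.

Definition rintegrable (f : T -> R) := mu.-integrable setT (EFin \o f).

Lemma rintegrable_measurable f : rintegrable f -> measurable_fun setT f.
Proof. by move=> /measurable_int/measurable_EFinP. Qed.

Lemma rintegrableD f g : rintegrable f -> rintegrable g ->
  rintegrable (fun w => f w + g w).
Proof.
move=> f_ g_; have := integrableD measurableT f_ g_.
by apply: eq_integrable => // x _ /=; rewrite EFinD.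
Qed.

Lemma rintegrableZ c f : rintegrable f -> rintegrable (fun w => c * f w).
Proof.
move=> f_; have := integrableZl measurableT c f_.
by apply: eq_integrable => // x _ /=; rewrite EFinM.
Qed.

Lemma rintegrableB f g : rintegrable f -> rintegrable g ->
  rintegrable (fun w => f w - g w).
Proof.
move=> f_ g_; have := integrableB measurableT f_ g_.
by apply: eq_integrable => // x _ /=; rewrite EFinB.
Qed.

Lemma le_rintegrable f g : measurable_fun setT f -> rintegrable g ->
  (forall w, `|f w| <= g w) -> rintegrable f.
Proof.
move=> mf g_ fg; apply: (le_integrable measurableT _ _ g_).
  exact/measurable_EFinP.
by move=> w _ /=; rewrite lee_fin (le_trans (fg w))// ler_norm.
Qed.

Lemma rintegrable_norm f : rintegrable f -> rintegrable (fun w => `|f w|).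
Proof. by move=> /integrable_norm. Qed.

Lemma rintegrableMr f g C : rintegrable f -> measurable_fun setT g ->
  (forall w, `|g w| <= C) -> rintegrable (fun w => f w * g w).
Proof.
move=> f_ mg gC; apply: (@le_rintegrable _ (fun w => C * `|f w|)).
- by apply: measurable_funM => //; exact: rintegrable_measurable.
- exact/rintegrableZ/rintegrable_norm.
- by move=> w; rewrite normrM mulrC ler_wpM2r.
Qed.

Lemma rintD f g : rintegrable f -> rintegrable g ->
  \int[mu]_w (f w + g w) = \int[mu]_w f w + \int[mu]_w g w.
Proof. exact: RintegralD. Qed.

Lemma rintB f g : rintegrable f -> rintegrable g ->
  \int[mu]_w (f w - g w) = \int[mu]_w f w - \int[mu]_w g w.
Proof. exact: RintegralB. Qed.

Lemma rintZ c f : rintegrable f ->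
  \int[mu]_w (c * f w) = c * \int[mu]_w f w.
Proof. exact: RintegralZl. Qed.

Lemma rint_norm_le f g : rintegrable f -> rintegrable g ->
  (forall w, `|f w| <= g w) -> `|\int[mu]_w f w| <= \int[mu]_w g w.
Proof.
move=> f_ g_ fg; apply: le_trans (le_normr_Rintegral measurableT f_) _.
by apply: le_Rintegral => //; exact: rintegrable_norm.
Qed.

Lemma ae_eq_rint f g : measurable_fun setT f -> measurable_fun setT g ->
  {ae mu, forall w, f w = g w} -> \int[mu]_w f w = \int[mu]_w g w.
Proof.
move=> mf mg fg; rewrite /Rintegral; congr fine; apply: ae_eq_integral => //.
- exact/measurable_EFinP.
- exact/measurable_EFinP.
- by apply: filterS fg => w -> _.
Qed.

Lemma ae_eq_rintegrable f g : measurable_fun setT f -> rintegrable g ->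
  {ae mu, forall w, f w = g w} -> rintegrable f.
Proof.
move=> mf ig fg; apply/integrableP; split; first exact/measurable_EFinP.
have mg := rintegrable_measurable ig; have [_] := integrableP _ _ _ ig.
apply: le_lt_trans; rewrite le_eqVlt; apply/orP; left; apply/eqP.
apply: ae_eq_integral => //.
- by apply: measurableT_comp => //; exact/measurable_EFinP.
- by apply: measurableT_comp => //; exact/measurable_EFinP.
- by apply: filterS fg => w /= -> _.
Qed.

Lemma EFin_rint f : rintegrable f ->
  (\int[mu]_w f w)%:E = (\int[mu]_w (f w)%:E)%E.
Proof. by move=> f_; rewrite fineK//; exact: integrable_fin_num f_. Qed.

Lemma cvg_rint (f_ : nat -> T -> R) f g :
  (forall n, measurable_fun setT (f_ n)) ->
  (forall w, f_ n w @[n --> \oo] --> f w) ->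
  rintegrable g -> (forall n w, `|f_ n w| <= g w) ->
  [/\ measurable_fun setT f, rintegrable f &
      \int[mu]_w f_ n w @[n --> \oo] --> \int[mu]_w f w].
Proof.
move=> mf ff ig fg.
have mlim : measurable_fun setT f.
  exact: (measurable_fun_cvg (h := f_)).
have ffE w : (f_ n w)%:E @[n --> \oo] --> (f w)%:E.
  by apply: cvg_EFin; [exact: nearW|exact: ff].
have [||||if_ _ cf] :=
  @dominated_convergence _ _ _ mu setT measurableT
    (fun n => EFin \o f_ n) (EFin \o f) (EFin \o g) _ _ _ ig _.
- by move=> n; exact/measurable_EFinP.
- exact/measurable_EFinP.
- by apply: aeW => w _; exact: ffE.
- by apply: aeW => w n _ /=; rewrite lee_fin.
split => //; apply: fine_cvg; rewrite EFin_rint//; exact: cf.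
Qed.

End measure.

Section probability.
Variable P : probability T R.

Lemma rintegrable_cst (c : R) : rintegrable P (fun=> c).
Proof. exact: finite_measure_integrable_cst. Qed.

Lemma rint_cst (c : R) : \int[P]_w c = c.
Proof. by have := Rintegral_cst P measurableT c; rewrite [X in fine X]probability_setT/= mulr1. Qed.

Lemma rintegrable_bounded f C : measurable_fun setT f ->
  (forall w, `|f w| <= C) -> rintegrable P f.
Proof. by move=> mf fC; apply: le_rintegrable mf (rintegrable_cst C) fC. Qed.

End probability.
End real_integrals.

(** * The Hahn-Banach theorem *)

Section hahn_banach.
Context {R : realType} {E : normedModType R}.

(** The bound by the norm, used at [- x], also bounds [q] from below, so that infima of such
    functions are finite. Homogeneity is stated as an inequality, which is easier to check on
    infima; the converse follows by scaling back. *)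
Definition sublinear (q : E -> R) : Prop :=
  [/\ forall x y, q (x + y) <= q x + q y,
      forall c x, 0 <= c -> q (c *: x) <= c * q x &
      forall x, q x <= `|x|].

Lemma sublinear_homogeneous q c x : sublinear q -> 0 <= c ->
  q (c *: x) = c * q x.
Proof.
move=> [qD qZ _]; rewrite le_eqVlt => /predU1P[<-|c0].
  rewrite scale0r mul0r; apply/eqP; rewrite eq_le; apply/andP; split.
    by have := qZ 0 x (lexx _); rewrite scale0r mul0r.
  by have := qD 0 0; rewrite addr0; lra.
apply/eqP; rewrite eq_le (qZ _ _ (ltW c0))/=.
have := qZ c^-1 (c *: x); rewrite scalerA mulVf ?gt_eqF// scale1r.
by rewrite invr_ge0 => /(_ (ltW c0)); rewrite ler_pdivlMl.
Qed.

Lemma sublinear_ge_opp q x : sublinear q -> - q (- x) <= q x.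
Proof.
move=> sq; have [qD _ _] := sq; have := qD x (- x).
have := sublinear_homogeneous x sq (lexx 0).
by rewrite subrr scale0r mul0r => ->; lra.
Qed.

Lemma sublinear_ge_norm q x : sublinear q -> - `|x| <= q x.
Proof.
move=> sq; apply: le_trans (sublinear_ge_opp x sq).
by have [_ _ /(_ (- x))] := sq; rewrite normrN lerN2.
Qed.

Let below (q : E -> R) (v x : E) : set R := [set q (x + t *: v) - t * q v | t in [set t | 0 <= t]].

Let below_lb q v x : sublinear q -> lbound (below q v x) (- q (- x)).
Proof.
move=> sq _ [t /= t0 <-]; have [qD _ _] := sq.
have := qD (x + t *: v) (- x); rewrite addrAC subrr add0r.
by rewrite (sublinear_homogeneous v sq t0); lra.
Qed.

Let inf_below q v x t : sublinear q -> 0 <= t ->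
  inf (below q v x) <= q (x + t *: v) - t * q v.
Proof.
move=> sq t0; apply: ge_inf; first by exists (- q (- x)); exact: below_lb.
by exists t.
Qed.

Let below0 q v x : below q v x !=set0.
Proof. by exists (q (x + 0 *: v) - 0 * q v), 0 => //=. Qed.

(** The witness is the infimum over t >= 0 of q (x + t v) - t q v. Taking t = 0 puts it below [q],
    and t = 1 at x = - v gives the last bound. A minimal [q] must therefore be odd at [v]. *)
Lemma sublinear_lower q v : sublinear q ->
  exists q', [/\ sublinear q', forall x, q' x <= q x & q' (- v) <= - q v].
Proof.
move=> sq; have [qD qZ qn] := sq; exists (fun x => inf (below q v x)).
have le x : inf (below q v x) <= q x.
  by apply: le_trans (inf_below v x sq (lexx 0)) _; rewrite scale0r addr0 mul0r subr0.
split => //; last first.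
  have := inf_below v (- v) sq ler01; rewrite scale1r mul1r addNr.
  by have := sublinear_homogeneous v sq (lexx 0); rewrite scale0r mul0r => ->; lra.
split => [x y|c x|x]; last exact: le_trans (le x) (qn x).
- rewrite -lerBlDr; apply: lb_le_inf => // _ [t /= t0 <-].
  rewrite lerBlDr -lerBlDl; apply: lb_le_inf => // _ [s /= s0 <-].
  rewrite lerBlDl; apply: le_trans (inf_below v _ sq (addr_ge0 t0 s0)) _.
  rewrite scalerDl addrACA; have := qD (x + t *: v) (y + s *: v); lra.
- rewrite le_eqVlt => /predU1P[<-|c0].
    rewrite scale0r mul0r; apply: le_trans (le 0) _.
    by have := sublinear_homogeneous 0 sq (lexx 0); rewrite scale0r mul0r => ->.
  rewrite -ler_pdivrMl//; apply: lb_le_inf => // _ [t /= t0 <-].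
  rewrite ler_pdivrMl// mulrBr mulrA -(sublinear_homogeneous _ sq (ltW c0)) scalerDr scalerA.
  by apply: inf_below => //; rewrite mulr_ge0// ltW.
Qed.

(** Minimality identifies [q] with its lowering along any v, so [q] is odd; an odd subadditive
    function is additive. *)
Lemma sublinear_minimal q : sublinear q ->
  (forall q', sublinear q' -> (forall x, q' x <= q x) -> q' = q) ->
  forall (a : R) x y, q (a *: x + y) = a * q x + q y.
Proof.
move=> sq min; have [qD qZ qn] := sq.
have qN v : q (- v) = - q v.
  have [q' [sq' le qv]] := sublinear_lower v sq.
  have e := min _ sq' le; apply/eqP; rewrite eq_le -{1}e qv/=.
  by have := sublinear_ge_opp v sq; lra.
have qA x y : q (x + y) = q x + q y.
  apply/eqP; rewrite eq_le qD/=; have := qD (x + y) (- y).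
  by rewrite addrK qN; lra.
move=> a x y; rewrite qA; congr (_ + _).
have [a0|a0] := leP 0 a; first exact: sublinear_homogeneous.
rewrite -[a in LHS]opprK scaleNr qN sublinear_homogeneous ?oppr_ge0 ?ltW//.
by rewrite mulNr opprK.
Qed.

(* Linear functionals are the minimal sublinear ones. *)
Lemma sublinear_linear_below q : sublinear q -> exists f : E -> R,
  [/\ forall (a : R) x y, f (a *: x + y) = a * f x + f y,
      forall x, f x <= `|x| & forall x, f x <= q x].
Proof.
move=> sq0.
pose sub := {q' : E -> R | sublinear q' /\ forall x, q' x <= q x}.
pose mk q' s l : sub := exist _ q' (conj s l).
(* The order is reversed: an element maximal for [low] is minimal pointwise. The bound of a chain is
   its pointwise infimum. *)
pose low (q q' : sub) : bool := `[< forall x, sval q' x <= sval q x >].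
have [||||[m [sm mq]] mmin] := @Zorn sub low.
- by move=> t; apply/asboolP => x.
- by move=> r s t /asboolP rs /asboolP st; apply/asboolP => x; exact: le_trans (st x) (rs x).
- move=> [s ?] [t ?] /asboolP/= st /asboolP/= ts; apply: eq_exist => //=.
  by apply/funext => x; apply/eqP; rewrite eq_le st ts.
- move=> A Atot; have [A0|/set0P[q0 Aq0]] := eqVneq A set0.
    by exists (mk q sq0 (fun x => lexx _)) => s; rewrite A0.
  pose V x := [set sval p x | p in A].
  have Vlb x : lbound (V x) (- `|x|).
    by move=> _ [p Ap <-]; apply: sublinear_ge_norm; exact: (svalP p).1.
  have Vne x : V x !=set0 by exists (sval q0 x), q0.
  have infV x p : A p -> inf (V x) <= sval p x.
    by move=> Ap; apply: ge_inf; [exists (- `|x|); exact: Vlb|exists p].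
  have sinf : sublinear (fun x => inf (V x)).
    split => [x y|c x|x].
    + rewrite -lerBlDr; apply: lb_le_inf => // _ [p Ap <-].
      rewrite lerBlDr -lerBlDl; apply: lb_le_inf => // _ [r Ar <-].
      rewrite lerBlDl.
      (* The infima at x and y are approached by different members of the chain; the smaller of the
         two serves at both points, which is where totality enters. *)
      have [/asboolP pr|/asboolP rp] := Atot p r Ap Ar.
        apply: le_trans (infV _ _ Ar) _; have [[+ _ _] _] := svalP r.
        by move=> /(_ x y) /le_trans; apply; rewrite lerD2r.
      apply: le_trans (infV _ _ Ap) _; have [[+ _ _] _] := svalP p.
      by move=> /(_ x y) /le_trans; apply; rewrite lerD2l.
    + rewrite le_eqVlt => /predU1P[<-|c0].
        rewrite scale0r mul0r; apply: le_trans (infV _ _ Aq0) _.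
        have [s _] := svalP q0.
        by have := sublinear_homogeneous 0 s (lexx 0); rewrite scale0r mul0r => ->.
      rewrite -ler_pdivrMl//; apply: lb_le_inf => // _ [p Ap <-].
      rewrite ler_pdivrMl// -(sublinear_homogeneous _ (svalP p).1 (ltW c0)).
      exact: infV.
    + by apply: le_trans (infV _ _ Aq0) _; have [[_ _ +] _] := svalP q0; exact.
  have linf x : inf (V x) <= q x.
    by apply: le_trans (infV _ _ Aq0) _; have [_] := svalP q0; exact.
  exists (mk _ sinf linf) => s As; apply/asboolP => x; exact: infV.
exists m; split => //; last by have [] := sm.
apply: sublinear_minimal => // q' sq' q'm.
have q'q x : q' x <= q x by apply: le_trans (q'm x) (mq x).
have e : mk q' sq' q'q = mk m sm mq by apply: mmin; apply/asboolP.
exact: (congr1 sval e).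
Qed.

(** The norm is first lowered along x, which brings its value at - x down to at most - |x|. A linear
    f below the result satisfies f (- x) <= - |x|, hence f x >= |x|. *)
Lemma norming_functional (x : E) : exists f : E -> R,
  [/\ forall (a : R) y z, f (a *: y + z) = a * f y + f z,
      forall y, `|f y| <= `|y| & f x = `|x|].
Proof.
have sn : sublinear (fun y : E => `|y|).
  split => // [|c y c0]; first exact: ler_normD.
  by rewrite normrZ ger0_norm.
have [q [sq _ qx]] := sublinear_lower x sn.
have [f [fl fn fq]] := sublinear_linear_below sq.
have fN y : f (- y) = - f y.
  have := fl (-1) y 0; have := fl 0 0 0.
  rewrite !scale0r !mul0r !addr0 add0r.
  have := fl 1 0 0; rewrite !scale1r mul1r addr0 => h _.
  have -> : f 0 = 0 by lra.
  by rewrite addr0 scaleN1r mulN1r.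
exists f; split => // [y|].
  rewrite ler_norml fn andbT; have := fn (- y); rewrite fN normrN; lra.
apply/eqP; rewrite eq_le fn/=; have := le_trans (fq (- x)) qx; rewrite fN; lra.
Qed.

End hahn_banach.

(** * Approximation by trigonometric polynomials *)

Section bernstein.
Context {R : realType}.
Implicit Types (f g : nat -> R) (x c M : R).

(* Expectation of [f] under the binomial distribution with parameters [n] and
   [x]; this is the Bernstein polynomial when [f m = u (m / n)]. *)
Fixpoint binomial_mean (n : nat) f x : R :=
  if n is n'.+1 then
    x * binomial_mean n' (f \o S) x + (1 - x) * binomial_mean n' f x
  else f 0%N.

Lemma binomial_mean_cst n c x : binomial_mean n (fun=> c) x = c.
Proof. by elim: n => //= n IH; rewrite -[_ \o S]/(fun=> c) IH; ring. Qed.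

Lemma binomial_meanD n f g x :
  binomial_mean n (fun m => f m + g m) x = binomial_mean n f x + binomial_mean n g x.
Proof.
elim: n f g => //= n IH f g.
by rewrite IH -[_ \o S]/(fun m => (f \o S) m + (g \o S) m) IH; ring.
Qed.

Lemma binomial_meanZ n c f x :
  binomial_mean n (fun m => c * f m) x = c * binomial_mean n f x.
Proof.
elim: n f => //= n IH f.
by rewrite IH -[_ \o S]/(fun m => c * (f \o S) m) IH; ring.
Qed.

Lemma le_binomial_mean n f g x : 0 <= x <= 1 -> (forall m, (m <= n)%N -> f m <= g m) ->
  binomial_mean n f x <= binomial_mean n g x.
Proof.
move=> /andP[x0 x1]; elim: n f g => [|n IH] f g fg /=; first exact: fg.
apply: lerD.
  by apply: ler_wpM2l => //; apply: IH => m mn; exact: fg.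
apply: ler_wpM2l; first by rewrite subr_ge0.
by apply: IH => m mn; apply: fg; exact: leqW.
Qed.

(** The centre [c] is arbitrary because the induction on the first trial replaces it by [c - 1]; the
    use is at [c = n x], where only the variance remains. *)
Lemma binomial_mean_variance n c x :
  binomial_mean n (fun m => (m%:R - c) ^+ 2) x =
  n%:R * x * (1 - x) + (n%:R * x - c) ^+ 2.
Proof.
elim: n c => [|n IH] c /=; first by rewrite !mul0r !add0r.
have -> : (fun m => (m%:R - c) ^+ 2) \o S = (fun m => (m%:R - (c - 1)) ^+ 2).
  by apply/funext => m /=; rewrite -natr1; ring.
by rewrite !IH -natr1; ring.
Qed.

Lemma norm_binomial_mean_le n f x M : 0 <= x <= 1 -> (forall m, `|f m| <= M) ->
  `|binomial_mean n f x| <= M.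
Proof.
move=> x01 fM; rewrite ler_norml; apply/andP; split.
  rewrite -{1}(binomial_mean_cst n (- M) x); apply: le_binomial_mean => // m _.
  by have := fM m; rewrite ler_norml => /andP[].
rewrite -[leRHS](binomial_mean_cst n M x); apply: le_binomial_mean => // m _.
by have := fM m; rewrite ler_norml => /andP[].
Qed.

(** Chebyshev's argument at a single point: a quadratic bound of |g y - g x| has a binomial mean
    that the variance makes of order 1 / n. *)
Lemma cvg_bernstein (g : R -> R) x M : 0 <= x <= 1 ->
  {for x, continuous g} -> (forall y, `|g y| <= M) ->
  binomial_mean n (fun m => g (m%:R / n%:R)) x @[n --> \oo] --> g x.
Proof.
move=> x01 cg gM; apply/cvgrPdist_lt => e e0.
have M0 : 0 <= M by exact: le_trans (gM 0).
have /cvgrPdist_lt/(_ _ (divr_gt0 e0 (ltr0n _ 2))) := cg.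
move=> /nbhs_ballP[r /= r0 rg].
have x0 : 0 <= x by case/andP: x01.
have x1 : 0 <= 1 - x by rewrite subr_ge0; case/andP: x01.
(* Chosen so that K (y - x)^2 exceeds the trivial bound 2 M as soon as y is at distance at least r
   from x. *)
pose K := 2 * M / r ^+ 2.
have K0 : 0 <= K by rewrite divr_ge0 ?mulr_ge0 ?exprn_ge0// ltW.
have gb y : `|g y - g x| <= e / 2 + K * (y - x) ^+ 2.
  have [yx|yx] := ltP `|x - y| r.
    apply: le_trans (_ : e / 2 <= _); last by rewrite lerDl mulr_ge0// sqr_ge0.
    by rewrite distrC ltW//; apply: rg.
  apply: le_trans (_ : 2 * M <= _).
    by rewrite (le_trans (ler_normB _ _))// mulr_natl mulr2n lerD.
  apply: le_trans (_ : K * (y - x) ^+ 2 <= _); last by rewrite lerDr ltW// divr_gt0.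
  rewrite /K -mulrA ler_peMr ?mulr_ge0//.
  rewrite mulrC ler_pdivlMr ?exprn_gt0// mul1r -[leRHS]real_normK ?num_real//.
  by rewrite -(distrC x) ler_pXn2r// nnegrE ?ltW// (lt_le_trans r0).
have bound n : (0 < n)%N -> `|g x - binomial_mean n (fun m => g (m%:R / n%:R)) x| <=
    e / 2 + K / n%:R.
  move=> n0; have n0' : n%:R != 0 :> R by rewrite pnatr_eq0 -lt0n.
  pose D (m : nat) := g (m%:R / n%:R) - g x.
  have -> : g x - binomial_mean n (fun m => g (m%:R / n%:R)) x = - binomial_mean n D x.
    by rewrite /D binomial_meanD binomial_mean_cst opprD opprK addrC.
  pose B (m : nat) := e / 2 + K / n%:R ^+ 2 * (m%:R - n%:R * x) ^+ 2.
  have DB m : `|D m| <= B m.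
    apply: le_trans (gb _) _; rewrite /B lerD2l -mulrA ler_wpM2l//.
    rewrite -exprVn -exprMn mulrBr [_^-1 * m%:R]mulrC mulrA mulVf// mul1r//.
  rewrite normrN; apply: (@le_trans _ _ (binomial_mean n B x)).
    rewrite ler_norml; apply/andP; split.
      rewrite -[leLHS]mulN1r -binomial_meanZ; apply: le_binomial_mean => // m _.
      by have := DB m; rewrite mulN1r ler_norml => /andP[].
    by apply: le_binomial_mean => // m _; exact: le_trans (ler_norm _) (DB m).
  rewrite /B binomial_meanD binomial_mean_cst binomial_meanZ binomial_mean_variance.
  have -> : K / n%:R ^+ 2 * (n%:R * x * (1 - x) + (n%:R * x - n%:R * x) ^+ 2) =
    K / n%:R * (x * (1 - x)) by field.
  have Kn : 0 <= K / n%:R by apply: divr_ge0.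
  rewrite lerD2l ler_piMr//.
  by case/andP: x01 => _ x1'; rewrite mulr_ile1//; lra.
near=> n.
have n0 : (0 < n)%N by near: n; exact: nbhs_infty_gt.
apply: le_lt_trans (bound n n0) _.
suff : K / n%:R < e / 2 by lra.
rewrite ltr_pdivrMr ?ltr0n// mulrC -ltr_pdivrMr ?divr_gt0//.
near: n; exact: nbhs_infty_gtr.
Unshelve. all: by end_near. Qed.

(* [sin] composed with its clipped inverse has period [2 pi], so the Bernstein
   polynomials of [u o (clipped inverse)] evaluated at [(1 + sin (s / l)) / 2]
   are trigonometric polynomials approximating [u]. *)
Definition clipped_asin (s : R) : R :=
  asin ((`|s + sin (1 / 2)| - `|s - sin (1 / 2)|) / 2).

Definition trig_node (L n m : nat) : R :=
  L.+1%:R * clipped_asin (2 * (m%:R / n%:R) - 1).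

Definition trig_variable (L : nat) (s : R) : R := (1 + sin (s / L.+1%:R)) / 2.

Definition trig_limit (L : nat) (s : R) : R :=
  L.+1%:R * clipped_asin (sin (s / L.+1%:R)).

Let half_pi : - (pi / 2) <= (1 / 2 : R) <= pi / 2.
Proof. by have := pi_ge2 R; lra. Qed.

Let half_pi' : - (pi / 2) <= (- (1 / 2) : R) <= pi / 2.
Proof. by have := pi_ge2 R; lra. Qed.

Let sin_half_lt1 : sin (1 / 2) < 1 :> R.
Proof.
rewrite -[ltRHS]sin_pihalf ltr_sin ?in_itv//=; have := pi_ge2 R; lra.
Qed.

Let sin_half_gt0 : 0 < sin (1 / 2) :> R.
Proof. by apply: sin_gt0_pihalf; have := pi_ge2 R; lra. Qed.

(** The half-difference of absolute values is the projection of s onto [- sin (1/2), sin (1/2)], an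
    interval that stays away from the endpoints -1 and 1 of the domain of [asin]. *)
Lemma continuous_clipped_asin : continuous clipped_asin.
Proof.
move=> s; apply: (continuous_comp (f := fun s : R =>
    (`|s + sin (1 / 2)| - `|s - sin (1 / 2)|) / 2)).
  apply: cvgMl; apply: cvgB; apply: cvg_norm.
    by apply: cvgD; [exact: cvg_id|exact: cvg_cst].
  by apply: cvgB; [exact: cvg_id|exact: cvg_cst].
apply: continuous_asin.
have h : `| `|s + sin (1 / 2)| - `|s - sin (1 / 2)| | <= 2 * sin (1 / 2).
  apply: le_trans (ler_dist_dist _ _) _.
  rewrite opprB addrC addrA subrK -mulr2n normrMn (ger0_norm (ltW sin_half_gt0)).
  by rewrite mulr_natl.
move: h; rewrite ler_norml => h; have := sin_half_lt1; lra.
Qed.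

Lemma clipped_asinK x : `|x| <= 1 / 2 -> clipped_asin (sin x) = x.
Proof.
rewrite ler_norml => xh; rewrite /clipped_asin.
have xp : x \in `[- (pi / 2), pi / 2] by rewrite in_itv/=; have := pi_ge2 R; lra.
have s1 : sin x <= sin (1 / 2).
  by rewrite leNgt ltr_sin ?in_itv//= -leNgt; lra.
have s2 : - sin (1 / 2) <= sin x.
  by rewrite -sinN leNgt ltr_sin ?in_itv//= -leNgt; lra.
rewrite ger0_norm; last lra.
rewrite ler0_norm; last lra.
rewrite -[RHS](sinK xp); congr asin; lra.
Qed.

Lemma trig_variable01 L s : 0 <= trig_variable L s <= 1.
Proof.
have := sin_geN1 (s / L.+1%:R); have := sin_le1 (s / L.+1%:R).
by rewrite /trig_variable; lra.
Qed.

(** For fixed [L] the limit is periodic in [s], so it is [u] at [trig_limit L s] and not at [s]; the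
    two points agree once the period is long enough. *)
Lemma cvg_trig_bernstein (u : R -> R) L s M : continuous u ->
  (forall y, `|u y| <= M) ->
  binomial_mean n (fun m => u (trig_node L n m)) (trig_variable L s)
    @[n --> \oo] --> u (trig_limit L s).
Proof.
move=> cu uM; pose g t := u (L.+1%:R * clipped_asin (2 * t - 1)).
have -> : u (trig_limit L s) = g (trig_variable L s).
  by rewrite /g /trig_limit /trig_variable; congr (u (_ * clipped_asin _)); lra.
apply: (@cvg_bernstein g _ M) => [||y]; [exact: trig_variable01| |exact: uM].
move=> t; rewrite /g; apply: (continuous_comp (f := fun t : R =>
  L.+1%:R * clipped_asin (2 * t - 1))); last exact: cu.
apply: cvgMr; apply: (continuous_comp (f := fun t : R => 2 * t - 1)).
  by apply: cvgB; [apply: cvgMr; exact: cvg_id|exact: cvg_cst].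
exact: continuous_clipped_asin.
Qed.

(** Once [L] exceeds 2 |s|, the argument of the sine lies in [-1/2, 1/2], where the clipping is
    inactive. The rank depends on s, hence a pointwise statement. *)
Lemma trig_limit_near s : \forall L \near \oo, trig_limit L s = s.
Proof.
near=> L; have l0 : 0 < L.+1%:R :> R by [].
rewrite /trig_limit clipped_asinK; last first.
  rewrite normrM normfV (ger0_norm (ltW l0)) ler_pdivrMr// mulrC -ler_pdivrMr//.
  apply: le_trans (_ : L%:R <= _); last by rewrite ler_nat.
  near: L; exact: nbhs_infty_ger.
by rewrite mulrC divfK// gt_eqF.
Unshelve. all: by end_near. Qed.

End bernstein.

(** * Gaussian random variables *)

Section line_integral.
Context {R : realType}.
Notation mu := (@lebesgue_measure R).

Lemma integral_derivative0 (F f : R -> R) :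
  (forall x : R, is_derive x 1 F (f x)) -> continuous f -> rintegrable mu f ->
  F n%:R @[n --> \oo] --> (0 : R) -> F (- n%:R) @[n --> \oo] --> (0 : R) ->
  \int[mu]_x f x = 0.
Proof.
move=> dF cf intf F1 F2.
have mf : measurable_fun setT f by exact: continuous_measurable_fun.
have cF : continuous F.
  by move=> x; apply/differentiable_continuous/derivable1_diffP; case: (dF x).
(* The bound is [n.+1] so that the interval is nondegenerate already for n = 0, as the fundamental
   theorem of calculus requires. *)
pose D n : set R := [set` `[(- n.+1%:R : R), n.+1%:R]].
pose fn n := f \_ (D n).
have fnE n : \int[mu]_x fn n x = F n.+1%:R - F (- n.+1%:R).
  rewrite /Rintegral -[X in _ = X]/(fine ((F n.+1%:R)%:E - (F (- n.+1%:R))%:E)%E).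
  rewrite -(@continuous_FTC2 _ f F).
  - rewrite [in RHS]integral_mkcond; congr fine; apply: eq_integral => x _.
    by rewrite restrict_EFin.
  - by rewrite gtrN.
  - by apply: continuous_subspaceT.
  - split.
    + by move=> x _; case: (dF x).
    + exact/cvg_at_right_filter/cF.
    + exact/cvg_at_left_filter/cF.
  - by move=> x _; rewrite derive1E; exact: derive_val.
have [||||_ _] := @cvg_rint _ _ _ mu fn f (fun x => `|f x|) _ _ _ _.
- move=> n; apply: (measurable_restrictT f (measurable_itv _)).1.
  exact: measurable_funTS.
- move=> x; apply: cvg_near_cst; near=> n.
  rewrite /fn /patch mem_set// /D/= in_itv/= -ler_norml.
  apply: le_trans (_ : n%:R <= _); last by rewrite ler_nat.
  by near: n; exact: nbhs_infty_ger.
- exact: rintegrable_norm.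
- by move=> n x; rewrite /fn /patch; case: ifPn => // _; rewrite normr0.
have F1' : F n.+1%:R @[n --> \oo] --> (0 : R).
  by rewrite (cvg_shiftS (fun n => F n%:R)).
have F2' : F (- n.+1%:R) @[n --> \oo] --> (0 : R).
  by rewrite (cvg_shiftS (fun n => F (- n%:R))).
move=> c1; have c2 : \int[mu]_x fn n x @[n --> \oo] --> (0 - 0 : R).
  by under eq_fun do rewrite fnE; exact: cvgB.
by rewrite -[RHS]subr0; apply: cvg_unique c1 c2.
Unshelve. all: by end_near. Qed.

End line_integral.

(** * Integrals against the Gaussian density and Stein's identity *)

Section gaussian_density.
Context {R : realType}.
Notation mu := (@lebesgue_measure R).
Variable s : R.
Hypothesis s0 : s != 0.
Let rho : R -> R := normal_pdf 0 s.

Lemma ge0_integral_normal_prob (f : R -> \bar R) :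
  measurable_fun setT f -> (forall x, (0 <= f x)%E) ->
  (\int[normal_prob 0 s]_x f x = \int[mu]_x (f x * (rho x)%:E))%E.
Proof.
move=> mf f0; have dom := normal_prob_dominates 0 s.
rewrite -(Radon_Nikodym_SigmaFinite.change_of_variables dom)//.
apply: ae_eq_integral => //.
- apply: emeasurable_funM => //; apply: measurable_int.
  exact: (Radon_Nikodym_SigmaFinite.f_integrable dom).
- by apply: emeasurable_funM => //; apply/measurable_EFinP; exact: measurable_normal_pdf.
- apply: ae_eqe_mul2l; apply: integral_ae_eq => //.
  + exact: (Radon_Nikodym_SigmaFinite.f_integrable dom).
  + by apply/measurable_EFinP; exact: measurable_normal_pdf.
  + by move=> A _ mA; rewrite -(Radon_Nikodym_SigmaFinite.f_integral dom mA).
Qed.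

Lemma is_derive_normal_pdf (x : R) : is_derive x 1 rho (- (x / s ^+ 2) * rho x).
Proof.
rewrite /rho normal_pdfE//.
pose g (x : R) := - (x - 0) ^+ 2 / (s ^+ 2 *+ 2).
have h : is_derive x 1 g (- (x / s ^+ 2)).
  apply: is_derive_eq; rewrite /GRing.scale/=; field.
  by rewrite s0.
have e := @is_derive1_comp _ expR g x _ _ (is_derive_expR (g x)) h.
have D := @is_deriveZ _ _ _ _ (normal_peak s) _ _ _ e.
apply: (is_derive_eq D).
by rewrite /normal_fun /GRing.scale/= /g; ring.
Qed.

(** Doubling the variance halves the exponent. With e the halved exponent, x^2 = - 4 s^2 e, and the
    spare factor exp e absorbs the polynomial because exp (- e) >= 1 - e. *)
Lemma normal_pdf_sqr_bound : exists C : R, forall x,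
  (1 + x ^+ 2) * rho x <= C * normal_pdf 0 (Num.sqrt 2 * s) x.
Proof.
have t0 : Num.sqrt 2 * s != 0 by rewrite mulf_neq0// gt_eqF// sqrtr_gt0.
exists ((1 + 4 * s ^+ 2) * (normal_peak s / normal_peak (Num.sqrt 2 * s))) => x.
rewrite /rho !normal_pdfE// -mulrA [normal_peak s / _]mulrC.
rewrite [leRHS](_ : _ = (1 + 4 * s ^+ 2) * normal_fun 0 (Num.sqrt 2 * s) x * normal_peak s); last first.
  by field; rewrite gt_eqF// normal_peak_gt0.
rewrite mulrCA mulrC ler_wpM2r ?normal_peak_ge0//.
rewrite /normal_fun subr0.
have s2 : 0 < s ^+ 2 by rewrite exprn_even_gt0.
have -> : - x ^+ 2 / (s ^+ 2 *+ 2) = (- x ^+ 2 / ((Num.sqrt 2 * s) ^+ 2 *+ 2)) *+ 2.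
  rewrite exprMn sqr_sqrtr//; field; by rewrite s0.
set e := - x ^+ 2 / ((Num.sqrt 2 * s) ^+ 2 *+ 2).
have eE : x ^+ 2 = - (4 * s ^+ 2 * e).
  by rewrite /e exprMn sqr_sqrtr//; field; rewrite s0.
rewrite mulr2n expRD mulrA ler_wpM2r ?expR_ge0//.
have := expR_ge1Dx (- e); rewrite expRN => h.
have e0 := expR_gt0 e.
rewrite -ler_pdivlMr//.
rewrite eE; have : 1 <= (expR e)^-1.
  rewrite -expRN -[leLHS]expR0 ler_expR.
  by rewrite /e mulNr opprK divr_ge0// ?sqr_ge0// mulrn_wge0// sqr_ge0.
nra.
Qed.

Lemma rintegrable_normal_pdf (f : R -> R) C : measurable_fun setT f ->
  (forall x, `|f x| <= C * (1 + x ^+ 2)) -> rintegrable mu (fun x => f x * rho x).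
Proof.
move=> mf fC; have [K hK] := normal_pdf_sqr_bound.
have C0 : 0 <= C.
  by have := le_trans (normr_ge0 _) (fC 0); rewrite expr0n addr0 mulr1.
apply: (@le_rintegrable _ _ _ mu _ (fun x : R => C * (K * normal_pdf 0 (Num.sqrt 2 * s) x))).
- by apply: measurable_funM => //; exact: measurable_normal_pdf.
- apply/rintegrableZ/rintegrableZ; exact: integrable_normal_pdf.
- move=> x; rewrite normrM (ger0_norm (normal_pdf_ge0 _ _ _)).
  apply: le_trans (_ : C * (1 + x ^+ 2) * rho x <= _).
    by rewrite ler_wpM2r// normal_pdf_ge0.
  by rewrite -mulrA ler_wpM2l.
Qed.

(** By the quadratic bound, (1 + |x|) |u x rho x| is bounded, so the product decays like 1 / (1 +
    n). The sequence [a] stands for n as well as for - n. *)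
Lemma cvg_normal_pdf (u : R -> R) C : (forall x, `|u x| <= C * (1 + `|x|)) ->
  forall (a : nat -> R), (forall n, `|a n| = n%:R) ->
  u (a n) * rho (a n) @[n --> \oo] --> (0 : R).
Proof.
move=> uC a an; have [K hK] := normal_pdf_sqr_bound.
have C0 : 0 <= C.
  by have := le_trans (normr_ge0 _) (uC 0); rewrite normr0 addr0 mulr1.
have r0 x : 0 <= rho x := normal_pdf_ge0 _ _ _.
set t := Num.sqrt 2 * s in hK.
have t0 : t != 0 by rewrite mulf_neq0// gt_eqF// sqrtr_gt0.
have Kp : 0 <= K.
  have := le_trans (mulr_ge0 (addr_ge0 ler01 (sqr_ge0 0)) (r0 0)) (hK 0).
  by rewrite pmulr_lge0// normal_pdfE// mulr_gt0 ?normal_peak_gt0// expR_gt0.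
pose M := C * (2 * (K * normal_peak t)).
have M0 : 0 <= M by rewrite !mulr_ge0 ?normal_peak_ge0.
have b x : (1 + `|x|) * `|u x * rho x| <= M.
  rewrite normrM (ger0_norm (r0 x)).
  apply: (@le_trans _ _ ((1 + `|x|) * (C * (1 + `|x|) * rho x))).
    by rewrite ler_wpM2l ?addr_ge0// ler_wpM2r.
  rewrite (_ : _ * _ = C * ((1 + `|x|) ^+ 2 * rho x)); last ring.
  rewrite ler_wpM2l//; apply: (@le_trans _ _ (2 * ((1 + x ^+ 2) * rho x))).
    rewrite mulrA ler_wpM2r// -[x ^+ 2]real_normK ?num_real//.
    by have := sqr_ge0 (1 - `|x|); nra.
  rewrite ler_wpM2l// (le_trans (hK x))// ler_wpM2l//.
  exact: normal_pdf_ub.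
apply/cvgrPdist_le => e e0; near=> n; rewrite sub0r normrN.
have := b (a n); rewrite an.
have n1 : 0 < 1 + n%:R :> R by rewrite ltr_wpDr.
rewrite -ler_pdivlMl// => /le_trans; apply.
rewrite mulrC ler_pdivrMr// -ler_pdivrMl// mulrC.
apply: le_trans (_ : n%:R <= _); last by rewrite lerDr.
near: n; exact: nbhs_infty_ger.
Unshelve. all: by end_near. Qed.

(** The integrand is s^2 times the derivative of [u * rho], which vanishes at both ends of the
    line. *)
Lemma normal_stein (u u' : R -> R) C :
  (forall x : R, is_derive x 1 u (u' x)) -> continuous u' ->
  (forall x, `|u x| <= C * (1 + `|x|)) -> (forall x, `|u' x| <= C * (1 + `|x|)) ->
  \int[mu]_x ((s ^+ 2 * u' x - x * u x) * rho x) = 0.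
Proof.
move=> du cu' uC u'C.
have cu : continuous u.
  by move=> x; apply/differentiable_continuous/derivable1_diffP; case: (du x).
have crho : continuous rho by apply: continuous_normal_pdf.
have C0 : 0 <= C.
  by have := le_trans (normr_ge0 _) (uC 0); rewrite normr0 addr0 mulr1.
pose f x := (u' x - x * u x / s ^+ 2) * rho x.
have s2 : 0 < s ^+ 2 by rewrite exprn_even_gt0.
have cg : continuous (fun x => u' x - x * u x / s ^+ 2).
  by move=> x; apply: cvgB; [exact: cu'|apply: cvgMl; apply: cvgM; [exact: cvg_id|exact: cu]].
have intf : rintegrable mu f.
  apply: (@rintegrable_normal_pdf _ (2 * C + 2 * C / s ^+ 2)).
    exact: continuous_measurable_fun.
  move=> x; have a1 : 1 + `|x| <= 2 * (1 + x ^+ 2).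
    rewrite -[x ^+ 2]real_normK ?num_real//.
    by have := sqr_ge0 (1 - `|x|); have := normr_ge0 x; nra.
  have a2 : `|x| * (1 + `|x|) <= 2 * (1 + x ^+ 2).
    rewrite -[x ^+ 2]real_normK ?num_real//.
    by have := sqr_ge0 (1 - `|x|); have := normr_ge0 x; nra.
  apply: le_trans (ler_normB _ _) _; rewrite mulrDl; apply: lerD.
    by apply: le_trans (u'C x) _; rewrite [2 * C]mulrC -mulrA ler_wpM2l.
  rewrite normrM normfV (gtr0_norm s2) ler_pdivrMr// mulrAC divfK ?gt_eqF//.
  rewrite normrM; apply: (@le_trans _ _ (`|x| * (C * (1 + `|x|)))).
    by rewrite ler_wpM2l.
  by rewrite mulrCA [2 * C]mulrC -mulrA ler_wpM2l.
have f0 : \int[mu]_x f x = 0.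
  apply: (@integral_derivative0 _ (fun x => u x * rho x)) => //.
  - move=> x; have D := is_deriveM (du x) (is_derive_normal_pdf x).
    by apply: (is_derive_eq D); rewrite /f /GRing.scale/=; ring.
  - by move=> x; apply: cvgM; [exact: cg|exact: crho].
  - by apply: (cvg_normal_pdf uC) => n; rewrite ger0_norm.
  - by apply: (cvg_normal_pdf uC) => n; rewrite normrN ger0_norm.
rewrite -(mulr0 (s ^+ 2)) -f0 -rintZ//; congr (fine _); apply: eq_integral => x _.
by congr EFin; rewrite /f; field; rewrite s0.
Qed.

End gaussian_density.

(** * Stein's identity and characteristic function of a Gaussian variable *)

Section gaussian_variable.
Context {d : measure_display} {T : measurableType d} {R : realType}.
Variables (P : probability T R) (X : {RV P >-> R}).
Notation mu := (@lebesgue_measure R).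

Let mX : measurable_fun setT (X : T -> R) := measurable_funPT X.

Let measurable_comp_RV (f : R -> R) : measurable_fun setT f ->
  measurable_fun setT (fun w => f (X w)).
Proof. by move=> mf; exact: measurableT_comp. Qed.

Section density.
Variable s : R.
Hypothesis s0 : s != 0.
Hypothesis Xs : forall A : set R, measurable A -> P (X @^-1` A) = normal_prob 0 s A.

Lemma ge0_integral_gaussian (f : R -> R) : measurable_fun setT f ->
  (forall x, 0 <= f x) ->
  (\int[P]_w (f (X w))%:E = \int[mu]_x (f x * normal_pdf 0 s x)%:E)%E.
Proof.
move=> mf f0.
have mF : measurable_fun setT (EFin \o f) by exact/measurable_EFinP.
have mX' : measurable_fun setT (X : T -> measurableTypeR R) := mX.
pose X' : {mfun T >-> measurableTypeR R} :=
  HB.pack (X : T -> measurableTypeR R) (isMeasurableFun.Build _ _ _ _ _ mX').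
transitivity (\int[distribution P X']_x (EFin \o f) x)%E.
  by rewrite ge0_integral_distribution// => x; rewrite lee_fin.
transitivity (\int[normal_prob 0 s]_x (EFin \o f) x)%E.
  by apply: (eq_measure_integral (normal_prob 0 s)) => A mA _; exact: Xs.
by rewrite ge0_integral_normal_prob// => x; rewrite lee_fin.
Qed.

(** The nonnegative case is applied to |f| and to |f| + f, whose difference gives f. *)
Lemma integral_gaussian_density (f : R -> R) C : measurable_fun setT f ->
  (forall x, `|f x| <= C * (1 + x ^+ 2)) ->
  rintegrable P (fun w => f (X w)) /\
  \int[P]_w f (X w) = \int[mu]_x (f x * normal_pdf 0 s x).
Proof.
move=> mf fC.
have main (g : R -> R) K : measurable_fun setT g -> (forall x, 0 <= g x) ->
    (forall x, `|g x| <= K * (1 + x ^+ 2)) -> rintegrable P (fun w => g (X w)) /\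
    \int[P]_w g (X w) = \int[mu]_x (g x * normal_pdf 0 s x).
  move=> mg g0 gK; have int := rintegrable_normal_pdf s0 mg gK.
  split; last by rewrite /Rintegral ge0_integral_gaussian.
  apply/integrableP; split; first exact/measurable_EFinP/measurable_comp_RV.
  rewrite (_ : (fun x => _) = (fun w => (g (X w))%:E)); last first.
    by apply/funext => w /=; rewrite ger0_norm.
  rewrite ge0_integral_gaussian// -EFin_rint//; exact: ltry.
have [ia ea] := main (fun x => `|f x|) C
  (measurableT_comp (@normr_measurable R setT) mf) (fun x => normr_ge0 _)
  (fun x => ltac:(rewrite normr_id; exact: fC)).
have [ib eb] : rintegrable P (fun w => `|f (X w)| + f (X w)) /\
    \int[P]_w (`|f (X w)| + f (X w)) = \int[mu]_x ((`|f x| + f x) * normal_pdf 0 s x).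
  apply: (main (fun x => `|f x| + f x) (2 * C)).
  - by apply: measurable_funD => //; exact: measurableT_comp.
  - by move=> x; have := ler_norm (- f x); rewrite normrN; lra.
  - move=> x; apply: le_trans (ler_normD _ _) _; rewrite normr_id -mulrA.
    by have := fC x; lra.
have int_f : rintegrable P (fun w => f (X w)).
  apply: (le_rintegrable (measurable_comp_RV mf) ia) => w //.
split => //.
have -> : \int[P]_w f (X w) = \int[P]_w (`|f (X w)| + f (X w)) - \int[P]_w `|f (X w)|.
  by rewrite rintD// addrAC subrr add0r.
have i1 := rintegrable_normal_pdf s0 mf fC.
have i2 : rintegrable mu (fun x => `|f x| * normal_pdf 0 s x).
  apply: (@rintegrable_normal_pdf _ _ s0 _ C) => [|x]; last by rewrite normr_id.
  exact: measurableT_comp.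
rewrite eb ea -[RHS](addrK (\int[mu]_x (`|f x| * normal_pdf 0 s x))) -rintD//.
congr (_ - _); congr fine; apply: eq_integral => x _; congr EFin; ring.
Qed.

End density.

(** Linear growth is allowed so that u = id is admissible, which identifies [v] as the second
    moment; u = 1 gives the mean. The value v = 0 accounts for the degenerate law. *)
Definition stein_identity (v : R) : Prop := forall (u u' : R -> R) (C : R),
  (forall x : R, is_derive x 1 u (u' x)) -> continuous u' ->
  (forall x, `|u x| <= C * (1 + `|x|)) -> (forall x, `|u' x| <= C * (1 + `|x|)) ->
  [/\ rintegrable P (fun w => u' (X w)), rintegrable P (fun w => X w * u (X w)) &
    \int[P]_w (X w * u (X w)) = v * \int[P]_w u' (X w)].

Let stein_variance v : stein_identity v ->
  rintegrable P (fun w => X w ^+ 2) /\ \int[P]_w (X w ^+ 2) = v.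
Proof.
move=> stein.
have [_ i e] : [/\ rintegrable P (fun w => 1 : R),
    rintegrable P (fun w => X w * X w) & \int[P]_w (X w * X w) = v * \int[P]_w 1].
  apply: (stein id (fun=> 1) 1) => [x|x|x].
  - exact: cvg_cst.
  - by rewrite mul1r lerDr.
  - by rewrite mul1r normr1 lerDl.
by split=> //; apply: etrans e _; rewrite rint_cst mulr1.
Qed.

Let stein_sd (s : R) : (forall A : set R, measurable A ->
    P (X @^-1` A) = if s == 0 then \d_(0 : R) A else normal_prob 0 s A) ->
  stein_identity (s ^+ 2).
Proof.
move=> Xs.
move=> u u' C du cu' uC u'C.
have cu : continuous u.
  by move=> x; apply/differentiable_continuous/derivable1_diffP; case: (du x).
have mu_ : measurable_fun setT u by exact: continuous_measurable_fun.
have mu' : measurable_fun setT u' by exact: continuous_measurable_fun.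
have C0 : 0 <= C.
  by have := le_trans (normr_ge0 _) (uC 0); rewrite normr0 addr0 mulr1.
have [s0|s0] := eqVneq s 0.
  have X0 : {ae P, forall w, X w = 0}.
    apply/negligibleP.
      rewrite (_ : ~` _ = X @^-1` ~` [set 0]); last by [].
      by rewrite -[X in measurable X]setTI; apply: mX => //; exact: measurableC.
    have m0 : measurable (~` [set (0 : R)]) by exact: measurableC.
    rewrite (_ : ~` _ = X @^-1` ~` [set 0]); last by [].
    apply: etrans (Xs _ m0) _.
    by rewrite s0 eqxx diracE memNset//= => /(_ erefl).
  have mXu : measurable_fun setT (fun w => X w * u (X w)).
    by apply: measurable_funM => //; exact: measurable_comp_RV.
  split.
  - apply: (@ae_eq_rintegrable _ _ _ _ _ (fun=> u' 0)); [exact: measurable_comp_RV|exact: rintegrable_cst|].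
    by apply: filterS X0 => w ->.
  - apply: (@ae_eq_rintegrable _ _ _ _ _ (fun=> 0)); [by []|exact: rintegrable_cst|].
    by apply: filterS X0 => w ->; rewrite mul0r.
  - rewrite s0 expr0n mul0r -[RHS](rint_cst P 0); apply: ae_eq_rint => //.
    by apply: filterS X0 => w ->; rewrite mul0r.
have Xs' A : measurable A -> P (X @^-1` A) = normal_prob 0 s A.
  by move=> mA; rewrite Xs// (negbTE s0).
have a1 x : 1 + `|x| <= 2 * (1 + x ^+ 2) :> R.
  rewrite -[x ^+ 2]real_normK ?num_real//.
  by have := sqr_ge0 (1 - `|x|); have := normr_ge0 x; nra.
have a2 x : `|x| * (1 + `|x|) <= 2 * (1 + x ^+ 2) :> R.
  rewrite -[x ^+ 2]real_normK ?num_real//.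
  by have := sqr_ge0 (1 - `|x|); have := normr_ge0 x; nra.
have b1 x : `|u' x| <= C * 2 * (1 + x ^+ 2).
  by apply: le_trans (u'C x) _; rewrite -mulrA ler_wpM2l.
have b2 x : `|x * u x| <= C * 2 * (1 + x ^+ 2).
  rewrite normrM; apply: (@le_trans _ _ (`|x| * (C * (1 + `|x|)))).
    by rewrite ler_wpM2l.
  by rewrite mulrCA -mulrA ler_wpM2l.
have mxu : measurable_fun setT (fun x : R => x * u x) by exact: measurable_funM.
have [i1 e1] := integral_gaussian_density s0 Xs' mu' b1.
have [i2 e2] := integral_gaussian_density s0 Xs' mxu b2.
split => //; rewrite e1 e2.
have j1 := rintegrable_normal_pdf s0 mu' b1.
have j2 := rintegrable_normal_pdf s0 mxu b2.
rewrite -rintZ//.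
apply/eqP; rewrite -subr_eq0 -opprB oppr_eq0 -rintB//; last exact: rintegrableZ.
apply/eqP; apply: etrans _ (normal_stein s0 du cu' uC u'C).
by congr fine; apply: eq_integral => x _; congr EFin; ring.
Qed.

Lemma gaussian_stein : centred_gaussian P X -> stein_identity (\int[P]_w (X w ^+ 2)).
Proof. by case=> s /stein_sd st; have [_ ->] := stein_variance st. Qed.

Lemma standard_gaussian_centred : standard_gaussian P X -> centred_gaussian P X.
Proof. by move=> Xg; exists 1 => A mA; rewrite Xg// oner_eq0. Qed.

Lemma standard_gaussian_variance : standard_gaussian P X ->
  \int[P]_w (X w ^+ 2) = 1.
Proof.
move=> Xg; have [|_ ->] := @stein_variance (1 ^+ 2); last by rewrite expr1n.
by apply: stein_sd => A mA; rewrite Xg// oner_eq0.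
Qed.

Lemma gaussian_mean0 : centred_gaussian P X -> \int[P]_w X w = 0.
Proof.
move=> /gaussian_stein st.
have [|||_ _] := st (fun=> 1) (fun=> 0) 1 (fun x => is_derive_cst _ _ _).
- by move=> x; exact: cvg_cst.
- by move=> x; rewrite mul1r normr1 lerDl.
- by move=> x; rewrite mul1r normr0 addr_ge0.
by under eq_Rintegral do rewrite mulr1; rewrite rint_cst mulr0.
Qed.

Lemma gaussian_sqr_integrable : centred_gaussian P X ->
  rintegrable P (fun w => X w ^+ 2).
Proof. by move=> /gaussian_stein/stein_variance[]. Qed.

Lemma gaussian_abs_integrable : centred_gaussian P X ->
  rintegrable P (fun w => `|X w|).
Proof.
move=> /gaussian_sqr_integrable X2.
apply: (@le_rintegrable _ _ _ _ _ (fun w => 1 + X w ^+ 2)).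
- exact: measurableT_comp.
- by apply: rintegrableD => //; exact: rintegrable_cst.
- move=> w; rewrite normr_id -[X w ^+ 2]real_normK ?num_real//.
  by have := sqr_ge0 (1 - `|X w|); have := normr_ge0 (X w); nra.
Qed.

(* [E cos (t X + a)] solves [phi' t = - Var(X) t phi t]. *)
Lemma gaussian_characteristic (t a : R) : centred_gaussian P X ->
  \int[P]_w cos (t * X w + a) =
  cos a * expR (- t ^+ 2 / 2 * \int[P]_w (X w ^+ 2)).
Proof.
move: t => t0 gX; have stein := gaussian_stein gX.
set v := \int[P]_w (X w ^+ 2) in stein *.
pose phi (t : R) := \int[P]_w cos (t * X w + a).
have aX := gaussian_abs_integrable gX.
have cosd (t x : R) : is_derive t 1 (fun t : R => cos (t * x + a)) (- (x * sin (t * x + a))).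
  have h : is_derive t 1 (fun t : R => t * x + a) x.
    by apply: is_derive_eq; rewrite /GRing.scale/= mulr1 addr0 ?scaler0 ?mulr0 ?add0r.
  have e := @is_derive1_comp _ cos (fun t => t * x + a) t _ _ (is_derive_cos _) h.
  by apply: (is_derive_eq e); ring.
have sind (t x : R) : is_derive x 1 (fun x : R => sin (t * x + a)) (t * cos (t * x + a)).
  have h : is_derive x 1 (fun x : R => t * x + a) t.
    by apply: is_derive_eq; rewrite /GRing.scale/= mulr1 addr0 ?scaler0 ?mulr0 ?add0r.
  have e := @is_derive1_comp _ sin (fun x => t * x + a) x _ _ (is_derive_sin _) h.
  by apply: (is_derive_eq e); ring.
have mtX (f : R -> R) (t : R) : continuous f -> measurable_fun setT (fun w => f (t * X w + a)).
  move=> cf; apply: (measurableT_comp (continuous_measurable_fun cf)).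
  by apply: measurable_funD => //; exact: measurable_funM.
have dphi (t : R) : is_derive t 1 phi (- (v * t * phi t)).
  have It : `]t - 1, t + 1[%classic t by rewrite /= in_itv/=; lra.
  have intc x : `]t - 1, t + 1[%classic x ->
      P.-integrable setT (EFin \o (fun w => cos (x * X w + a))).
    move=> _; apply: (@rintegrable_bounded _ _ _ _ _ 1).
      by apply: mtX; exact: continuous_cos.
    by move=> w; rewrite ler_norml cos_geN1 cos_le1.
  have der x y : `]t - 1, t + 1[%classic x -> setT y ->
      derivable ((fun t w => cos (t * X w + a)) ^~ y) x 1.
    by move=> _ _; case: (cosd x (X y)).
  have pE x y : partial1of2 (fun t w => cos (t * X w + a)) x y =
      - (X y * sin (x * X y + a)).
    by rewrite partial1of2E; exact: derive_val.
  have ub x y : `]t - 1, t + 1[%classic x -> setT y ->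
      `|partial1of2 (fun t w => cos (t * X w + a)) x y| <= `|X y|.
    move=> _ _; rewrite pE normrN normrM ler_piMr//.
    by rewrite ler_norml sin_geN1 sin_le1.
  have D := derivable_under_integral measurableT It intc der (fun y => normr_ge0 (X y)) aX ub.
  apply: DeriveDef => //.
  rewrite -derive1E (differentiation_under_integral measurableT It intc der (fun y => normr_ge0 (X y)) aX ub).
  (* Stein's identity for x |-> sin (t x + a) turns the differentiated integral back into a multiple
     of phi t. *)
  have [i1 i2 e] : [/\ rintegrable P (fun w => t * cos (t * X w + a)),
      rintegrable P (fun w => X w * sin (t * X w + a)) &
      \int[P]_w (X w * sin (t * X w + a)) = v * \int[P]_w (t * cos (t * X w + a))].
    apply: (stein _ _ (1 + `|t|) (sind t)).
    - move=> x; apply: cvgMr; apply: (continuous_comp (f := fun x => t * x + a)).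
        by apply: cvgD; [apply: cvgMr; exact: cvg_id|exact: cvg_cst].
      exact: continuous_cos.
    - move=> x; apply: (@le_trans _ _ 1); first by rewrite ler_norml sin_geN1 sin_le1.
      by have := normr_ge0 x; have := normr_ge0 t; nra.
    - move=> x; rewrite normrM; apply: (@le_trans _ _ `|t|).
        by rewrite ler_piMr// ler_norml cos_geN1 cos_le1.
      by have := normr_ge0 x; have := normr_ge0 t; nra.
  under eq_Rintegral do rewrite pE -mulN1r.
  rewrite rintZ// e rintZ//; last exact: intc It.
  by rewrite /phi; ring.
(* Integrating factor of the differential equation: psi has zero derivative, hence equals its value
   at 0. *)
pose psi t := phi t * expR (v * t ^+ 2 / 2).
have dpsi (t' : R) : is_derive t' 1 psi 0.
  have h : is_derive t' 1 (fun t : R => v * t ^+ 2 / 2) (v * t').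
    by apply: is_derive_eq; rewrite /GRing.scale/=; field.
  have e := @is_derive1_comp _ expR (fun t : R => v * t ^+ 2 / 2) t' _ _ (is_derive_expR _) h.
  have D := is_deriveM (dphi t') e.
  by apply: (is_derive_eq D); rewrite /GRing.scale/=; ring.
have := @is_derive_0_is_cst _ psi t0 0 dpsi.
rewrite /psi expr0n mulr0 mul0r expR0 mulr1 /phi.
have -> : \int[P]_w cos (0 * X w + a) = cos a.
  by rewrite -[RHS](rint_cst P); congr fine; apply: eq_integral => w _; rewrite mul0r add0r.
have e1 : expR (v * t0 ^+ 2 / 2) * expR (- t0 ^+ 2 / 2 * v) = 1.
  by rewrite -expRD (_ : _ + _ = 0) ?expR0//; field.
by move=> <-; rewrite -[RHS]mulrA e1 mulr1.
Qed.

End gaussian_variable.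

(** * Freezing and cylinder functions *)

Section freezing.
Context {d : measure_display} {T : measurableType d} {R : realType}.
Variables (P : probability T R) (J : eqType) (X : J -> T -> R).
(** The class is abstract because the principle serves twice: for measurable functions, and for
    functions orthogonal to trigonometric polynomials of W. *)
Variable G : (T -> R) -> Prop.
Hypothesis G_mean : forall j L n (U : nat -> T -> R), (forall m, G (U m)) ->
  G (fun w => binomial_mean n (fun m => U m w) (trig_variable L (X j w))).
Hypothesis G_lim : forall (U_ : nat -> T -> R) U M, (forall n, G (U_ n)) ->
  (forall w, U_ n w @[n --> \oo] --> U w) -> rintegrable P M ->
  (forall n w, `|U_ n w| <= M w) -> G U.

Definition upd (y : J -> R) j t : J -> R := fun i => if i == j then t else y i.

Let continuous_binomial_mean n (f : nat -> R -> R) x : (forall m, continuous (f m)) ->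
  continuous (fun t => binomial_mean n (f^~ t) x).
Proof.
elim: n f => [|n IH] f cf t /=; first exact: cf.
apply: cvgD; apply: cvgMr; last exact: IH.
by apply: (IH (fun m => f m.+1)) => m; exact: cf.
Qed.

(* The variables are substituted one at a time, [Psi w] being approximated in
   the current one by trigonometric polynomials. *)
Lemma freezing (K : seq J) (Psi : T -> (J -> R) -> R) M :
  rintegrable P M -> (forall w y, `|Psi w y| <= M w) ->
  (forall w y j, continuous (fun t => Psi w (upd y j t))) ->
  (forall w y y', (forall j, j \in K -> y j = y' j) -> Psi w y = Psi w y') ->
  (forall y, G (Psi^~ y)) ->
  G (fun w => Psi w (X^~ w)).
Proof.
move=> iM; elim: K Psi => [|j K IH] Psi PM Pc PK GP.
  rewrite (_ : (fun w => _) = Psi^~ (fun=> 0)); first exact: GP.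
  by apply/funext => w; exact: PK.
have mean01 L w := trig_variable01 L (X j w).
(* Coordinate j receives deterministic nodes, so the function handed to the induction hypothesis
   depends on y only through [K]; the true value of [X j] enters only through the parameter of the
   binomial mean, which is part of w. Next n, then L, go to infinity. *)
have step L n : G (fun w => binomial_mean n
    (fun m => Psi w (upd (X^~ w) j (trig_node L n m))) (trig_variable L (X j w))).
  apply: (IH (fun w y => binomial_mean n
    (fun m => Psi w (upd y j (trig_node L n m))) (trig_variable L (X j w)))).
  - by move=> w y; apply: norm_binomial_mean_le.
  - move=> w y i; apply: (@continuous_binomial_mean n (fun m t =>
      Psi w (upd (upd y i t) j (trig_node L n m)))) => m.
    have [ij|ij] := eqVneq i j.
      rewrite (_ : (fun t => _) = fun=> Psi w (upd y j (trig_node L n m))).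
        by move=> t; exact: cvg_cst.
      apply/funext => t; congr (Psi w _); apply/funext => k.
      by rewrite /upd -ij; case: (k == i).
    rewrite (_ : (fun t => _) = fun t => Psi w (upd (upd y j (trig_node L n m)) i t)).
      exact: Pc.
    apply/funext => t; congr (Psi w _); apply/funext => k.
    rewrite /upd; case: eqVneq => // ->; by rewrite eq_sym (negbTE ij).
  - move=> w y y' yy'; congr (binomial_mean _ _ _); apply/funext => m.
    apply: PK => k; rewrite inE /upd; case: eqVneq => //= _; exact: yy'.
  - by move=> y; apply: (@G_mean _ _ _ (fun m w => _)) => m; exact: GP.
have stepL L : G (fun w => Psi w (upd (X^~ w) j (trig_limit L (X j w)))).
  apply: (@G_lim _ _ M (step L)) => [w||n w] //.
  - by apply: (cvg_trig_bernstein (u := fun t => Psi w (upd (X^~ w) j t)) (M := M w)).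
  - by apply: norm_binomial_mean_le.
apply: (@G_lim _ _ M stepL) => // w.
apply: cvg_near_cst; near=> L.
rewrite (near (trig_limit_near (X j w)) L)//; congr (Psi w _); apply/funext => k.
by rewrite /upd; case: eqVneq => // ->.
Unshelve. all: by end_near. Qed.

End freezing.

(** * Bounded functions of finitely many coordinates *)

Section cylinder.
Context {R : realType} {J : eqType}.
Implicit Types (u v : (J -> R) -> R).

(** Continuity is asked along all lines: coordinate lines are those of the freezing argument, and
    the other lines are the shifts along h. *)
Record cylinder u : Prop := Cylinder {
  cylinder_bounded : exists M, forall y, `|u y| <= M;
  cylinder_finite : exists K : seq J, forall y y',
    (forall j, j \in K -> y j = y' j) -> u y = u y';
  cylinder_continuous : forall y b, continuous (fun t : R => u (fun j => y j + t * b j))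
}.

Lemma cylinder_upd u y j : cylinder u -> continuous (fun t => u (upd y j t)).
Proof.
move=> [_ _ cu]; have := cu (upd y j 0) (fun i => (i == j)%:R).
rewrite (_ : (fun t => _) = fun t => u (upd y j t))//.
apply/funext => t; congr u; apply/funext => i; rewrite /upd.
by case: eqP => _; rewrite ?mulr1 ?mulr0 ?add0r ?addr0.
Qed.

Lemma cylinder_cst c : cylinder (fun=> c).
Proof.
split.
- by exists `|c|.
- by exists [::].
- by move=> y b t; exact: cvg_cst.
Qed.

Lemma cylinderD u v : cylinder u -> cylinder v -> cylinder (fun y => u y + v y).
Proof.
move=> [[M uM] [K uK] cu] [[N vN] [L vL] cv]; split.
- by exists (M + N) => y; rewrite (le_trans (ler_normD _ _))// lerD.
- exists (K ++ L) => y y' yy'; congr (_ + _); [apply: uK|apply: vL] => j jK;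
    by apply: yy'; rewrite mem_cat jK ?orbT.
- by move=> y b t; apply: cvgD; [exact: cu|exact: cv].
Qed.

Lemma cylinderM u v : cylinder u -> cylinder v -> cylinder (fun y => u y * v y).
Proof.
move=> [[M uM] [K uK] cu] [[N vN] [L vL] cv]; split.
- by exists (M * N) => y; rewrite normrM ler_pM.
- exists (K ++ L) => y y' yy'; congr (_ * _); [apply: uK|apply: vL] => j jK;
    by apply: yy'; rewrite mem_cat jK ?orbT.
- by move=> y b t; apply: cvgM; [exact: cu|exact: cv].
Qed.

Lemma cylinder_comp (g : R -> R) u M : continuous g -> (forall x, `|g x| <= M) ->
  cylinder u -> cylinder (g \o u).
Proof.
move=> cg gM [_ [K uK] cu]; split.
- by exists M => y; exact: gM.
- by exists K => y y' yy' /=; rewrite (uK _ _ yy').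
- by move=> y b t; apply: continuous_comp; [exact: cu|exact: cg].
Qed.

(** Continuity along lines says nothing directly about joint measurability; freezing presents the
    function as an iterated pointwise limit of polynomials in sines of the coordinates. *)
Lemma cylinder_measurable {d : measure_display} {T : measurableType d}
    (P : probability T R) (X : J -> T -> R) u :
  (forall j, measurable_fun setT (X j)) -> cylinder u ->
  measurable_fun setT (fun w => u (X^~ w)).
Proof.
move=> mX cu; have [[M uM] [K uK] _] := cu.
apply: (@freezing _ _ _ P J X (measurable_fun setT) _ _ K (fun=> u) (fun=> M)).
- move=> j L n U mU; elim: n U mU => [|n IH] U mU /=; first exact: mU.
  have mx : measurable_fun setT (fun w => trig_variable L (X j w)).
    apply: (measurableT_comp _ (mX j)); apply: continuous_measurable_fun => s.
    rewrite /trig_variable; apply: cvgMl; apply: cvgD; first exact: cvg_cst.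
    apply: (continuous_comp (f := fun s : R => s / L.+1%:R)); last exact: continuous_sin.
    by apply: cvgMl; exact: cvg_id.
  apply: measurable_funD; apply: measurable_funM => //.
  + by apply: (IH (fun m => U m.+1)) => m; exact: mU.
  + exact: measurable_funB.
  + exact: IH.
- by move=> U_ U N mU cU _ _; apply: (measurable_fun_cvg (h := U_)).
- exact: rintegrable_cst.
- by move=> _.
- by move=> _ y j; exact: cylinder_upd.
- by move=> _.
- by move=> y; exact: measurable_cst.
Qed.

End cylinder.

(** * Independence in isonormal processes *)

Section inner_product.
Context {R : realType} {H : normedModType R} {ip : H -> H -> R}.
Hypothesis Hip : is_inner_product ip.

Lemma ipDl x y z : ip (x + y) z = ip x z + ip y z.
Proof. by have := ip_linear Hip z 1 x y; rewrite scale1r mul1r. Qed.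

Lemma ip0l z : ip 0 z = 0.
Proof. by have := ipDl 0 0 z; rewrite addr0; lra. Qed.

Lemma ipZl a x z : ip (a *: x) z = a * ip x z.
Proof. by have := ip_linear Hip z a x 0; rewrite addr0 ip0l addr0. Qed.

Lemma ipBl x y z : ip (x - y) z = ip x z - ip y z.
Proof. by rewrite ipDl -scaleN1r ipZl mulN1r. Qed.

Lemma ipDr x y z : ip z (x + y) = ip z x + ip z y.
Proof. by rewrite !(ip_sym Hip z) ipDl. Qed.

Lemma ipZr a x z : ip z (a *: x) = a * ip z x.
Proof. by rewrite !(ip_sym Hip z) ipZl. Qed.

Lemma ipBr x y z : ip z (x - y) = ip z x - ip z y.
Proof. by rewrite !(ip_sym Hip z) ipBl. Qed.

(** Expands the squared norm of |y|^2 x - [x, y] y, which is |y|^2 times the required difference. *)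
Lemma cauchy_schwarz x y : `|ip x y| <= `|x| * `|y|.
Proof.
have [->|y0] := eqVneq y 0; first by rewrite (ip_sym Hip) ip0l !normr0 mulr0.
rewrite -(@ler_pXn2r _ 2)// ?nnegrE ?mulr_ge0// real_normK ?num_real// exprMn.
have := sqr_ge0 (`|(`|y| ^+ 2) *: x - ip x y *: y|).
rewrite -[X in 0 <= X -> _](ip_norm Hip) !ipBl !ipBr !ipZl !ipZr.
rewrite !(ip_norm Hip) (ip_sym Hip y x).
set n := `|y| ^+ 2; have n0 : 0 < n by rewrite exprn_gt0// normr_gt0.
set c := ip x y; set m := `|x| ^+ 2 => h.
have : 0 <= n * (m * n - c ^+ 2) by nra.
by rewrite pmulr_rge0// subr_ge0.
Qed.

End inner_product.

Section isonormal.
Context {d : measure_display} {T : measurableType d} {R : realType}.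
Context {P : probability T R} {H : normedModType R} {ip : H -> H -> R}.
Hypothesis Hip : is_inner_product ip.
Context {W : H -> {RV P >-> R}}.
Hypothesis HW : is_isonormal ip W.

Let mW h : measurable_fun setT (W h : T -> R) := measurable_funPT (W h).

Let mcos (a : R) k : measurable_fun setT (fun w => cos (W k w + a)).
Proof.
apply: (measurableT_comp (continuous_measurable_fun (@continuous_cos R))).
exact: measurable_funD.
Qed.

Let cos_le x : `|cos x| <= 1 :> R.
Proof. by rewrite ler_norml cos_geN1 cos_le1. Qed.

Let icos (a : R) k : rintegrable P (fun w => cos (W k w + a)).
Proof. by apply: (rintegrable_bounded P (C := 1) (mcos a k)) => w; exact: cos_le. Qed.

Lemma isonormal_variance h : \int[P]_w (W h w ^+ 2) = `|h| ^+ 2.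
Proof.
have := iso_covariance HW h h; rewrite unlock (ip_norm Hip) => /(congr1 fine)/= <-.
by congr fine; apply: eq_integral => w _; rewrite /= expr2.
Qed.

Lemma isonormal_characteristic h a :
  \int[P]_w cos (W h w + a) = cos a * expR (- `|h| ^+ 2 / 2).
Proof.
have := gaussian_characteristic 1 a (iso_gaussian HW h).
have -> : - 1 ^+ 2 / 2 * \int[P]_w (W h w ^+ 2) = - `|h| ^+ 2 / 2.
  by rewrite isonormal_variance; field.
by move=> <-; congr fine; apply: eq_integral => w _; rewrite mul1r.
Qed.

Lemma isonormal0 : {ae P, forall w, W 0 w = 0}.
Proof.
have := iso_linear HW 1 0 0; apply: filterS => w.
by rewrite scale1r addr0 mul1r; lra.
Qed.

Lemma isonormalZ s h : {ae P, forall w, W (s *: h) w = s * W h w}.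
Proof.
have := iso_linear HW s h 0; have := isonormal0; apply: filterS2 => w ->.
by rewrite !addr0.
Qed.

(** The phase [a] covers sines as well as cosines, so that U is orthogonal to all characters of W on
    V. When V contains 0, this includes having mean zero. *)
Definition trig_orthogonal (V : set H) (U : T -> R) : Prop :=
  rintegrable P U /\
  forall k, V k -> forall a, \int[P]_w (U w * cos (W k w + a)) = 0.

Lemma trig_orthogonal_lim V (U_ : nat -> T -> R) U M :
  (forall n, trig_orthogonal V (U_ n)) ->
  (forall w, U_ n w @[n --> \oo] --> U w) -> rintegrable P M ->
  (forall n w, `|U_ n w| <= M w) -> trig_orthogonal V U.
Proof.
move=> oU cU iM UM; have mU n := rintegrable_measurable (oU n).1.
have [_ iU _] := cvg_rint mU cU iM UM.
split=> // k Vk a.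
have [||//|n w|_ _] := @cvg_rint _ _ _ P (fun n w => U_ n w * cos (W k w + a))
    (fun w => U w * cos (W k w + a)) M.
- by move=> n; apply: measurable_funM.
- by move=> w; apply: cvgMl; exact: cU.
- by rewrite normrM (le_trans _ (UM n w))// ler_piMr.
under eq_fun do rewrite (oU _).2//.
by move=> /(cvg_unique _ (cvg_cst _)) <-.
Qed.

Lemma trig_orthogonal_linear V c U1 U2 : trig_orthogonal V U1 ->
  trig_orthogonal V U2 -> trig_orthogonal V (fun w => c * U1 w + U2 w).
Proof.
move=> [i1 o1] [i2 o2]; split; first by apply: rintegrableD => //; exact: rintegrableZ.
move=> k Vk a.
have ic Y : rintegrable P Y -> rintegrable P (fun w => Y w * cos (W k w + a)).
  by move=> iY; apply: (rintegrableMr iY (mcos a k)) => w; exact: cos_le.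
have -> : (fun w => (c * U1 w + U2 w) * cos (W k w + a)) =
    (fun w => c * (U1 w * cos (W k w + a)) + U2 w * cos (W k w + a)).
  by apply/funext => w; ring.
rewrite rintD; [|by apply: rintegrableZ; exact: ic|exact: ic].
by rewrite rintZ ?o1// ?o2// ?mulr0 ?addr0//; exact: ic.
Qed.

(** A binomial mean is a polynomial in its parameter, so it suffices to multiply once by
    [trig_variable]; this only shifts frequencies by multiples of v, which stay in V. *)
Lemma trig_orthogonal_mean (V : set H) L n (U : nat -> T -> R) v :
  (forall c x y, V x -> V y -> V (c *: x + y)) -> V v ->
  (forall m, trig_orthogonal V (U m)) ->
  trig_orthogonal V (fun w => binomial_mean n (fun m => U m w) (trig_variable L (W v w))).
Proof.
move=> VL Vv.
pose x w := trig_variable L (W v w).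
have mx : measurable_fun setT x.
  apply: (measurableT_comp _ (mW v)); apply: continuous_measurable_fun => s.
  rewrite /trig_variable; apply: cvgMl; apply: cvgD; first exact: cvg_cst.
  apply: (continuous_comp (f := fun s : R => s / L.+1%:R)); last exact: continuous_sin.
  by apply: cvgMl; exact: cvg_id.
have x1 w : `|x w| <= 1.
  by rewrite ler_norml; have := trig_variable01 L (W v w); rewrite /x; lra.
have mul Y : trig_orthogonal V Y -> trig_orthogonal V (fun w => x w * Y w).
  move=> [iY oY]; split.
    by under eq_fun do rewrite mulrC; exact: rintegrableMr x1.
  move=> k Vk a; pose l : R := L.+1%:R^-1.
  have mY := rintegrable_measurable iY.
  have i1 c k' : rintegrable P (fun w => Y w * cos (W k' w + c)).
    by apply: (rintegrableMr iY (mcos c k')) => w; exact: cos_le.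
  (* Product formula for sin A cos B, with sines written as cosines of phase - pi / 2; the
     frequencies k + l v and k - l v merge by the linearity of W almost everywhere. *)
  transitivity (\int[P]_w (2^-1 * (Y w * cos (W k w + a)) +
     (4^-1 * (Y w * cos (W (l *: v + k) w + (a - pi / 2))) +
      (- 4^-1) * (Y w * cos (W (- l *: v + k) w + (a - pi / 2)))))).
    apply: ae_eq_rint.
    - by apply: measurable_funM => //; apply: measurable_funM.
    - by do ?apply: measurable_funD => //; do 2 apply: measurable_funM => //.
    - have := iso_linear HW l v k; have := iso_linear HW (- l) v k.
      apply: filterS2 => w -> ->.
      rewrite /x /trig_variable -/l.
      set p := W k w; set q := W v w.
      have -> : l * q + p + (a - pi / 2) = (p + a) + q * l - pi / 2 by ring.
      have -> : - l * q + p + (a - pi / 2) = (p + a) - q * l - pi / 2 by ring.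
      by rewrite !cosBpihalf sinD sinB; field.
  rewrite rintD; [|exact: rintegrableZ|by apply: rintegrableD; exact: rintegrableZ].
  rewrite rintD; [|exact: rintegrableZ|exact: rintegrableZ].
  by rewrite !rintZ// !oY ?mulr0 ?addr0//; exact: VL.
elim: n U => [|n IH] U oU; first exact: oU.
have o1 := mul _ (IH (fun m => U m.+1) (fun m => oU m.+1)).
have o2 := mul _ (IH U oU).
have := trig_orthogonal_linear 1 o1 (trig_orthogonal_linear (-1) o2 (IH U oU)).
congr (trig_orthogonal V _); apply/funext => w /=.
by rewrite /x /comp; ring.
Qed.

(** If Psi is orthogonal to the characters on V for every frozen y, it remains so after substituting
    variables W (v j) with v j in V; testing with k = 0 gives the mean. *)
Lemma trig_orthogonal_freezing (J : eqType) (v : J -> H) (V : set H) (K : seq J)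
    (Psi : T -> (J -> R) -> R) M :
  (forall c x y, V x -> V y -> V (c *: x + y)) -> (forall j, V (v j)) -> V 0 ->
  (forall w y, `|Psi w y| <= M) ->
  (forall w y j, continuous (fun t => Psi w (upd y j t))) ->
  (forall w y y', (forall j, j \in K -> y j = y' j) -> Psi w y = Psi w y') ->
  (forall y, trig_orthogonal V (Psi^~ y)) ->
  rintegrable P (fun w => Psi w (fun j => W (v j) w)) /\
  \int[P]_w Psi w (fun j => W (v j) w) = 0.
Proof.
move=> VL Vv V0 PM Pc PK oP.
have [iP oP0] : trig_orthogonal V (fun w => Psi w (fun j => W (v j) w)).
  apply: (@freezing _ _ _ P J (fun j w => W (v j) w) (trig_orthogonal V) _ _ K Psi (fun=> M)) => //.
  - by move=> j L n U oU; exact: trig_orthogonal_mean.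
  - exact: trig_orthogonal_lim.
  - exact: rintegrable_cst.
split=> //; rewrite -[RHS](oP0 0 V0 0); apply: ae_eq_rint.
- exact: rintegrable_measurable iP.
- by apply: measurable_funM => //; exact: rintegrable_measurable iP.
- by apply: filterS isonormal0 => w ->; rewrite addr0 cos0 mulr1.
Qed.

(** Half of the independence: the side of [W h] passes from cosines to bounded continuous functions,
    the side of [W k] stays trigonometric. For two cosines, the product formula leads to
    characteristic functions at k + s h and k - s h, which agree because [h, k] = 0. *)
Lemma isonormal_independence h k (b : R -> R) M a : ip h k = 0 -> continuous b ->
  (forall x, `|b x| <= M) ->
  \int[P]_w (b (W h w) * cos (W k w + a)) =
  \int[P]_w b (W h w) * \int[P]_w cos (W k w + a).
Proof.
move=> hk cb bM; set c := \int[P]_w cos (W k w + a).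
have M0 : 0 <= M by exact: le_trans (bM 0).
have mb : measurable_fun setT (fun w => b (W h w)).
  exact: (measurableT_comp (continuous_measurable_fun cb)).
have ib : rintegrable P (fun w => b (W h w)).
  by apply: (rintegrable_bounded P mb) => w; exact: bM.
have ibc : rintegrable P (fun w => b (W h w) * cos (W k w + a)).
  by apply: (rintegrableMr ib (mcos a k)) => w; exact: cos_le.
have [|||||||_] := @trig_orthogonal_freezing unit (fun=> h)
  [set v | exists s, v = s *: h] [:: tt]
  (fun w y => (cos (W k w + a) - c) * b (y tt)) ((1 + `|c|) * M).
- move=> t _ _ [s ->] [s' ->]; exists (t * s + s').
  by rewrite scalerA scalerDl.
- by move=> _; exists 1; rewrite scale1r.
- by exists 0; rewrite scale0r.
- move=> w y; rewrite normrM ler_pM//.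
  by rewrite (le_trans (ler_normB _ _))// lerD2r.
- move=> w y [] t; apply: cvgMr; exact: cb.
- by move=> w y y' yy'; rewrite yy'// inE.
- move=> y; split.
    apply: (rintegrableMr _ (C := M)) => //.
    by apply: rintegrableB => //; exact: rintegrable_cst.
  move=> _ [s ->] a'.
  have -> : (fun w => (cos (W k w + a) - c) * b (y tt) * cos (W (s *: h) w + a')) =
      (fun w => b (y tt) * (cos (W k w + a) * cos (W (s *: h) w + a') -
        c * cos (W (s *: h) w + a'))).
    by apply/funext => w; ring.
  have ii : rintegrable P (fun w => cos (W k w + a) * cos (W (s *: h) w + a')).
    by apply: (rintegrableMr (icos a k) (mcos a' _)) => w; exact: cos_le.
  have ic : rintegrable P (fun w => c * cos (W (s *: h) w + a')).
    exact/rintegrableZ/icos.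
  rewrite rintZ; last exact: rintegrableB.
  rewrite rintB// rintZ; last exact: icos.
  have -> : \int[P]_w (cos (W k w + a) * cos (W (s *: h) w + a')) =
     \int[P]_w (2^-1 * (cos (W (s *: h + k) w + (a + a')) +
       cos (W (- s *: h + k) w + (a - a')))).
    apply: ae_eq_rint.
    + by apply: measurable_funM.
    + by apply: measurable_funM => //; apply: measurable_funD.
    + have := iso_linear HW s h k; have := iso_linear HW (- s) h k.
      have := isonormalZ s h; apply: filterS3 => w -> -> ->.
      set p := W k w; set q := W h w.
      have -> : s * q + p + (a + a') = (p + a) + (s * q + a') by ring.
      have -> : - s * q + p + (a - a') = (p + a) - (s * q + a') by ring.
      by rewrite (cosD (p + a)) (cosB (p + a)); field.
  rewrite rintZ; last by apply: rintegrableD; exact: icos.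
  rewrite rintD; [|exact: icos|exact: icos].
  rewrite /c !isonormal_characteristic -!(ip_norm Hip).
  rewrite !(ipDl Hip, ipDr Hip, ipZl Hip, ipZr Hip) (ip_sym Hip k h) hk !(mulr0, addr0, add0r).
  have -> : - s * (- s * ip h h) = s * (s * ip h h) by ring.
  have -> : - (s * (s * ip h h) + ip k k) / 2 = - (s * (s * ip h h)) / 2 + - ip k k / 2 by ring.
  by rewrite expRD (cosD a) (cosB a); field.
have -> : (fun w => (cos (W k w + a) - c) * b (W h w)) =
   (fun w => b (W h w) * cos (W k w + a) - c * b (W h w)).
  by apply/funext => w; ring.
rewrite rintB//; last exact: rintegrableZ.
by rewrite rintZ// => /eqP; rewrite subr_eq0 mulrC => /eqP.
Qed.

End isonormal.

(** * Integration by parts *)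

Section cylinder_derivative.
Context {R : realType} {H : normedModType R}.
Variables (ip : H -> H -> R) (h : H).
Implicit Types (u v : (H -> R) -> R).

(** The Cameron-Martin shift by t h, read on the family of all coordinates W(k). *)
Definition perturb (y : H -> R) (t : R) : H -> R := fun k => y k + t * ip k h.

(* [u' (W)] is the derivative of the random variable [u (W)] in the direction
   of [h]. *)
Record cylinder_derivative u u' : Prop := CylinderDerivative {
  cylinder_derivative_fun : cylinder u;
  cylinder_derivative_der : cylinder u';
  cylinder_derivativeP : forall y, is_derive (0 : R) 1 (fun t => u (perturb y t)) (u' y)
}.

Lemma perturb0 y : perturb y 0 = y.
Proof. by apply/funext => k; rewrite /perturb mul0r addr0. Qed.

Lemma cylinder_derivative_line u u' y (t : R) : cylinder_derivative u u' ->
  is_derive t 1 (fun t => u (perturb y t)) (u' (perturb y t)).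
Proof.
move=> [_ _ /(_ (perturb y t)) du].
have h1 : is_derive t 1 (fun s : R => s - t) 1.
  by apply: is_derive_eq; rewrite subr0.
have -> : (fun s => u (perturb y s)) = (fun s => u (perturb (perturb y t) s)) \o (fun s => s - t).
  apply/funext => s /=; congr u; apply/funext => k; rewrite /perturb; ring.
rewrite -[X in is_derive _ _ _ X]mulr1; apply: is_derive1_comp => //.
by rewrite subrr.
Qed.

Lemma cylinder_derivative0 : cylinder_derivative (fun=> 0) (fun=> 0).
Proof. by split; [exact: cylinder_cst|exact: cylinder_cst|move=> y; exact: is_derive_cst]. Qed.

Lemma cylinder_derivativeD u u' v v' : cylinder_derivative u u' ->
  cylinder_derivative v v' ->
  cylinder_derivative (fun y => u y + v y) (fun y => u' y + v' y).
Proof.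
move=> [cu cu' du] [cv cv' dv]; split; [exact: cylinderD|exact: cylinderD|].
by move=> y; exact: is_deriveD (du y) (dv y).
Qed.

Lemma cylinder_derivativeM u u' v v' : cylinder_derivative u u' ->
  cylinder_derivative v v' ->
  cylinder_derivative (fun y => u y * v y) (fun y => u y * v' y + v y * u' y).
Proof.
move=> [cu cu' du] [cv cv' dv]; split; [exact: cylinderM| |].
  by apply: cylinderD; exact: cylinderM.
move=> y; have D := is_deriveM (du y) (dv y).
by apply: (is_derive_eq D); rewrite perturb0.
Qed.

Lemma cylinder_derivative_comp (f f' : R -> R) M u u' :
  (forall x : R, is_derive x 1 f (f' x)) -> continuous f' ->
  (forall x, `|f x| <= M) -> (forall x, `|f' x| <= M) ->
  cylinder_derivative u u' ->
  cylinder_derivative (fun y => f (u y)) (fun y => f' (u y) * u' y).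
Proof.
move=> df cf' fM f'M [cu cu' du].
have cf : continuous f.
  by move=> x; apply/differentiable_continuous/derivable1_diffP; case: (df x).
split.
- exact: cylinder_comp cf fM cu.
- by apply: cylinderM => //; exact: cylinder_comp cf' f'M cu.
- move=> y; rewrite -{2}(perturb0 y).
  by apply: (@is_derive1_comp _ f (fun t => u (perturb y t))).
Qed.

End cylinder_derivative.

Section integration_by_parts.
Context {d : measure_display} {T : measurableType d} {R : realType}.
Context {P : probability T R} {H : normedModType R} {ip : H -> H -> R}.
Hypothesis Hip : is_inner_product ip.
Context {W : H -> {RV P >-> R}}.
Hypothesis HW : is_isonormal ip W.
Variable h : H.
Hypothesis h1 : ip h h = 1.
Implicit Types (u v : (H -> R) -> R).

Let mW k : measurable_fun setT (W k : T -> R) := measurable_funPT (W k).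

Lemma cylinder_isonormal_measurable u : cylinder u ->
  measurable_fun setT (fun w => u (fun k => W k w)).
Proof. exact: (@cylinder_measurable _ _ _ _ P (fun k w => W k w)). Qed.

Lemma cylinder_isonormal_integrable u : cylinder u ->
  rintegrable P (fun w => u (fun k => W k w)).
Proof.
move=> cu; have [M uM] := cylinder_bounded cu.
by apply: (rintegrable_bounded P (cylinder_isonormal_measurable cu)) => w; exact: uM.
Qed.

Lemma isonormal_integration_by_parts u u' (chi chi' : R -> R) C :
  cylinder_derivative ip h u u' ->
  (forall x : R, is_derive x 1 chi (chi' x)) -> continuous chi' ->
  (forall x, `|chi x| <= C) -> (forall x, `|chi' x| <= C) ->
  (forall x, `|x * chi x| <= C) ->
  \int[P]_w (u' (fun k => W k w) * chi (W h w) +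
    u (fun k => W k w) * (chi' (W h w) - W h w * chi (W h w))) = 0.
Proof.
move=> du dchi cchi' chiC chi'C xchiC.
have [cu cu' _] := du.
have [M uM] := cylinder_bounded cu; have [M' u'M] := cylinder_bounded cu'.
have [K uK] := cylinder_finite cu; have [K' u'K] := cylinder_finite cu'.
have cchi : continuous chi.
  by move=> x; apply/differentiable_continuous/derivable1_diffP; case: (dchi x).
have C0 : 0 <= C by exact: le_trans (chiC 0).
have M0 : 0 <= M by exact: le_trans (normr_ge0 _) (uM (fun=> 0)).
have M'0 : 0 <= M' by exact: le_trans (normr_ge0 _) (u'M (fun=> 0)).
(* The integrand when W(h) takes the value z and the components orthogonal to h take the values y.
   The bound on x chi (x) is what makes it bounded in z. *)
pose psi z y := u' (perturb ip h y z) * chi z +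
  u (perturb ip h y z) * (chi' z - z * chi z).
have psiB z y : `|psi z y| <= M' * C + M * (C + C).
  rewrite (le_trans (ler_normD _ _))// lerD// normrM ler_pM//.
  by rewrite (le_trans (ler_normB _ _))// lerD.
have cline v y : cylinder v -> continuous (fun z => v (perturb ip h y z)).
  by move=> cv; exact: (cylinder_continuous cv).
have cpsi y : continuous (psi^~ y).
  move=> z; apply: cvgD; apply: cvgM; [exact: cline|exact: cchi|exact: cline|].
  by apply: cvgB; [exact: cchi'|apply: cvgM; [exact: cvg_id|exact: cchi]].
have psi0 y : \int[P]_w psi (W h w) y = 0.
  pose q z := u (perturb ip h y z) * chi z.
  pose q' z := u' (perturb ip h y z) * chi z + u (perturb ip h y z) * chi' z.
  have b1 (x : R) : 1 <= 1 + `|x| by rewrite lerDl.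
  pose B := M * C + M' * C.
  have B0 : 0 <= B by rewrite addr_ge0 ?mulr_ge0.
  have [||||i1 i2] := gaussian_stein (iso_gaussian HW h) (u := q) (u' := q') (C := B).
  - move=> z; have D := is_deriveM (cylinder_derivative_line y z du) (dchi z).
    by apply: (is_derive_eq D); rewrite /q' /GRing.scale/=; ring.
  - by move=> z; apply: cvgD; apply: cvgM; [exact: cline|exact: cchi|exact: cline|exact: cchi'].
  - move=> z; apply: le_trans (_ : B <= _); last by rewrite ler_peMr.
    by rewrite /q normrM (@le_trans _ _ (M * C))// ?ler_pM// lerDl mulr_ge0.
  - move=> z; apply: le_trans (_ : B <= _); last by rewrite ler_peMr.
    by rewrite (le_trans (ler_normD _ _))// addrC lerD// normrM ler_pM.
  rewrite (isonormal_variance Hip HW) -(ip_norm Hip) h1 mul1r => e.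
  have -> : (fun w => psi (W h w) y) = (fun w => q' (W h w) - W h w * q (W h w)).
    by apply/funext => w; rewrite /psi /q /q'; ring.
  by rewrite rintB// e subrr.
pose v k := k - ip k h *: h.
have vh k : ip h (v k) = 0.
  by rewrite /v (ipBr Hip) (ipZr Hip) h1 mulr1 (ip_sym Hip h k) subrr.
have [|||||||iP P0] := trig_orthogonal_freezing HW (v := v)
  (V := [set k | ip h k = 0]) (K := K ++ K') (Psi := fun w y => psi (W h w) y)
  (M := M' * C + M * (C + C)).
- by move=> c x y /= hx hy; rewrite (ipDr Hip) (ipZr Hip) hx hy mulr0 addr0.
- by [].
- by rewrite /= (ip_sym Hip) (ip0l Hip).
- by move=> w y.
- move=> w y j; have cs v' : cylinder v' -> continuous
      (fun t => v' (perturb ip h (upd y j t) (W h w))).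
    move=> cv; have cc := @cylinder_upd _ _ v' (perturb ip h y (W h w)) j cv => t.
    have -> : (fun t => v' (perturb ip h (upd y j t) (W h w))) =
        (fun t => v' (upd (perturb ip h y (W h w)) j t)) \o
        (fun t => t + W h w * ip j h).
      apply/funext => s /=; congr v'; apply/funext => i; rewrite /upd /perturb.
      by case: eqVneq => // ->.
    apply: continuous_comp; last exact: cc.
    by apply: cvgD; [exact: cvg_id|exact: cvg_cst].
  by move=> t; apply: cvgD; apply: cvgMl; exact: cs.
- move=> w y y' yy'; rewrite /psi; congr (_ * _ + _ * _).
    by apply: u'K => k kK; rewrite /perturb yy'// mem_cat kK orbT.
  by apply: uK => k kK; rewrite /perturb yy'// mem_cat kK.
- move=> y; split.
    apply: (rintegrable_bounded P (C := M' * C + M * (C + C))) => //.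
    exact: (measurableT_comp (continuous_measurable_fun (cpsi y))).
  (* For frozen y, independence factors the integral, and Stein's identity makes the first factor
     zero. *)
  move=> k hk a; rewrite (isonormal_independence Hip HW a hk (cpsi y) (psiB^~ y)).
  by rewrite psi0 mul0r.
rewrite -[RHS]P0; apply: ae_eq_rint; last 1 first.
(* The decomposition of W(k) holds off a null set depending on k; finitely many k suffice, since u
   and u' only look at [K] and [K']. *)
- have ae_seq (s : seq H) : {ae P, forall w, forall k, k \in s ->
      W k w = W (v k) w + W h w * ip k h}.
    elim: s => [|k s IH]; first exact: aeW.
    have e : {ae P, forall w, W k w = ip k h * W h w + W (v k) w}.
      by have := iso_linear HW (ip k h) h (v k); rewrite /v (addrC _ (k - _)) subrK.
    move: e IH; apply: filterS2 => w e1 e2 k'.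
    by rewrite inE => /predU1P[->|]; [rewrite e1 addrC mulrC|exact: e2].
  have := ae_seq (K ++ K'); apply: filterS => w e.
  rewrite /psi; congr (_ * _ + _ * _).
    by apply: u'K => k kK; rewrite /perturb e// mem_cat kK orbT.
  by apply: uK => k kK; rewrite /perturb e// mem_cat kK.
- have mchi (f : R -> R) : continuous f -> measurable_fun setT (fun w => f (W h w)).
    by move=> cf; exact: (measurableT_comp (continuous_measurable_fun cf)).
  apply: measurable_funD; apply: measurable_funM.
  + exact: cylinder_isonormal_measurable.
  + exact: mchi.
  + exact: cylinder_isonormal_measurable.
  + by apply: measurable_funB; [exact: mchi|apply: measurable_funM => //; exact: mchi].
- exact: rintegrable_measurable iP.
Qed.

End integration_by_parts.

(** * The Malliavin derivative of cylinder functions *)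

Section cylinder_of_Cb_infty.
Context {R : realType} {H : normedModType R}.
Variables (ip : H -> H -> R) (h : H).
Hypothesis Hip : is_inner_product ip.

Lemma Cb_infty_partial n (j : 'I_n) (f : 'rV[R]_n -> R) :
  Cb_infty f -> Cb_infty (partial j f).
Proof. by move=> Cf s; have := Cf (rcons s j); rewrite foldr_rcons. Qed.

Let row_line n (y b : 'I_n -> R) t :
  \row_j (y j + t * b j) = \row_j y j + t *: \row_j b j.
Proof. by apply/rowP => j; rewrite !mxE. Qed.

Lemma cylinder_Cb_infty n (f : 'rV[R]_n -> R) (k : 'I_n -> H) : Cb_infty f ->
  cylinder (fun y => f (\row_j y (k j))).
Proof.
move=> /(_ [::])/= [df [M fM]]; split.
- by exists M => y; exact: fM.
- exists [seq k j | j <- enum 'I_n] => y y' yy'; congr f; apply/rowP => j.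
  by rewrite !mxE yy'//; apply/mapP; exists j => //; rewrite mem_enum.
- move=> y b t.
  rewrite (_ : (fun t => _) = f \o (fun t => \row_j y (k j) + t *: \row_j b (k j))).
    apply: continuous_comp; last exact: differentiable_continuous.
    apply: cvgD; first exact: cvg_cst.
    by apply: cvgZl; exact: cvg_id.
  by apply/funext => s /=; rewrite -row_line.
Qed.

Lemma is_derive_line n (f : 'rV[R]_n -> R) (x b : 'rV[R]_n) : differentiable f x ->
  is_derive (0 : R) 1 (fun t => f (x + t *: b)) (\sum_j b 0 j * partial j f x).
Proof.
move=> df; have db := diff_derivable (v := b) df.
have e : (fun t : R => t^-1 *: (((fun s => f (x + s *: b)) \o shift 0) (t *: 1) - f (x + 0 *: b)))
   = (fun t : R => t^-1 *: ((f \o shift x) (t *: b) - f x)).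
  apply/funext => t; congr (_ *: (_ - _)); last by rewrite scale0r addr0.
  by rewrite /= addr0 addrC [_ *: 1]mulr1.
have dE : 'D_b f x = \sum_j b 0 j * partial j f x.
  rewrite deriveE// [in LHS](row_sum_delta b) linear_sum; apply: eq_bigr => j _.
  by rewrite linearZ /partial deriveE.
split; first by rewrite /derivable e; exact: db.
by rewrite -dE /derive e.
Qed.

Lemma cylinder_derivativeZ c u u' : cylinder_derivative ip h u u' ->
  cylinder_derivative ip h (fun y => c * u y) (fun y => c * u' y).
Proof.
move=> [cu cu' du]; split.
- by apply: cylinderM => //; exact: cylinder_cst.
- by apply: cylinderM => //; exact: cylinder_cst.
- by move=> y; exact: is_deriveZ (du y).
Qed.

Lemma cylinder_derivative_sum (I : Type) (r : seq I) (u u' : I -> (H -> R) -> R) :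
  (forall i, cylinder_derivative ip h (u i) (u' i)) ->
  cylinder_derivative ip h (fun y => \sum_(i <- r) u i y) (fun y => \sum_(i <- r) u' i y).
Proof.
move=> du; elim: r => [|i r IH].
  under eq_fun do rewrite big_nil; under [X in cylinder_derivative _ _ _ X]eq_fun do rewrite big_nil.
  exact: cylinder_derivative0.
under eq_fun do rewrite big_cons; under [X in cylinder_derivative _ _ _ X]eq_fun do rewrite big_cons.
exact: cylinder_derivativeD.
Qed.

Lemma cylinder_derivative_Cb_infty n (f : 'rV[R]_n -> R) (k : 'I_n -> H) : Cb_infty f ->
  cylinder_derivative ip h (fun y => f (\row_j y (k j)))
    (fun y => \sum_j ip h (k j) * partial j f (\row_i y (k i))).
Proof.
move=> Cf; split; first exact: cylinder_Cb_infty.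
  elim: (index_enum _) => [|j r IH].
    by under eq_fun do rewrite big_nil; exact: cylinder_cst.
  under eq_fun do rewrite big_cons; apply: cylinderD => //.
  apply: cylinderM; first exact: cylinder_cst.
  exact/cylinder_Cb_infty/Cb_infty_partial.
move=> y; have [df _] := Cf [::].
have D := is_derive_line (\row_j ip (k j) h) (df (\row_j y (k j))).
rewrite (_ : (fun t => _) = fun t => f (\row_j y (k j) + t *: \row_j ip (k j) h)).
  by apply: (is_derive_eq D); apply: eq_bigr => j _; rewrite mxE (ip_sym Hip).
by apply/funext => t; rewrite -row_line.
Qed.

(* Integrating by parts against a truncation of [u' (W)] involves [u''] as well. *)
Lemma malliavin_cylinder {d : measure_display} {T : measurableType d}
    {P : probability T R} (W : H -> {RV P >-> R}) (E : lmodType R) (phi : E -> R)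
    (F : T -> E) (DF : T -> H -> E) :
  (forall (a : R) x y, phi (a *: x + y) = a * phi x + phi y) ->
  malliavin ip W F DF ->
  exists u u' u'', [/\ cylinder_derivative ip h u u', cylinder_derivative ip h u' u'',
    forall w, phi (F w) = u (fun k => W k w) &
    forall w, phi (DF w h) = u' (fun k => W k w)].
Proof.
move=> phiL.
have phiD x y : phi (x + y) = phi x + phi y by have := phiL 1 x y; rewrite scale1r mul1r.
have phi0 : phi 0 = 0 by have := phiD 0 0; rewrite addr0; lra.
have phiZ a x : phi (a *: x) = a * phi x by have := phiL a x 0; rewrite addr0 phi0 addr0.
have phi_sum n (z : 'I_n -> E) : phi (\sum_j z j) = \sum_j phi (z j).
  elim: (index_enum _) => [|j r IH]; first by rewrite !big_nil.
  by rewrite !big_cons phiD IH.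
elim=> {F DF} [n f k x Cf|F DF G DG _ [u [u' [u'' [du du' uE u'E]]]] _ [v [v' [v'' [dv dv' vE v'E]]]]].
  eexists; eexists; eexists; split.
  - exact: (cylinder_derivativeZ (phi x) (cylinder_derivative_Cb_infty k Cf)).
  - apply: cylinder_derivativeZ; apply: cylinder_derivative_sum => j.
    apply: cylinder_derivativeZ; apply: cylinder_derivative_Cb_infty.
    exact: Cb_infty_partial.
  - by move=> w; rewrite phiZ mulrC.
  - move=> w; rewrite fct_sumE phi_sum mulr_sumr; apply: eq_bigr => j _.
    by rewrite /rank_one !phiZ; ring.
exists (fun y => u y + v y), (fun y => u' y + v' y), (fun y => u'' y + v'' y); split.
- exact: cylinder_derivativeD.
- exact: cylinder_derivativeD.
- by move=> w; rewrite phiD uE vE.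
- by move=> w; rewrite phiD u'E v'E.
Qed.

End cylinder_of_Cb_infty.

(** * Closability of scalar derivatives *)

Section bounded_test_functions.
Context {R : realType}.
Implicit Types x y : R.

Definition cauchy_kernel x : R := (1 + x ^+ 2)^-1.

Definition cauchy_kernel' x : R := - (2 * x) * cauchy_kernel x ^+ 2.

(** Plays two roles: the truncation theta of X_m, and the product of Z with its damping factor, both
    bounded by 1. *)
Definition truncation x : R := x * cauchy_kernel x.

Definition truncation' x : R := (1 - x ^+ 2) * cauchy_kernel x ^+ 2.

Let den_gt0 x : 0 < 1 + x ^+ 2.
Proof. by rewrite ltr_pwDl// sqr_ge0. Qed.

Lemma cauchy_kernel_gt0 x : 0 < cauchy_kernel x.
Proof. by rewrite invr_gt0. Qed.

Lemma is_derive_cauchy_kernel x : is_derive x 1 cauchy_kernel (cauchy_kernel' x).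
Proof.
have h : is_derive x 1 (fun x : R => 1 + x ^+ 2) (2 * x).
  by apply: is_derive_eq; rewrite add0r /GRing.scale/=; ring.
have x0 : 1 + x ^+ 2 != 0 by rewrite gt_eqF.
apply: (is_derive_eq (is_deriveV (f := fun x : R => 1 + x ^+ 2) x0 h)).
by rewrite /cauchy_kernel' /cauchy_kernel /GRing.scale/= exprVn; ring.
Qed.

Lemma is_derive_truncation x : is_derive x 1 truncation (truncation' x).
Proof.
apply: (is_derive_eq (is_deriveM (is_derive_id x 1) (is_derive_cauchy_kernel x))).
rewrite /GRing.scale/= /truncation' /cauchy_kernel' /cauchy_kernel; field.
by rewrite gt_eqF.
Qed.

Lemma continuous_cauchy_kernel : continuous cauchy_kernel.
Proof.
move=> x; apply/differentiable_continuous/derivable1_diffP.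
by case: (is_derive_cauchy_kernel x).
Qed.

Lemma continuous_cauchy_kernel' : continuous cauchy_kernel'.
Proof.
move=> x; apply: cvgM.
  by apply: cvgN; apply: cvgMr; exact: cvg_id.
by apply: cvgM; exact: continuous_cauchy_kernel.
Qed.

Lemma continuous_truncation' : continuous truncation'.
Proof.
move=> x; apply: cvgM.
  by apply: cvgB; [exact: cvg_cst|apply: cvgM; exact: cvg_id].
by apply: cvgM; exact: continuous_cauchy_kernel.
Qed.

Lemma norm_cauchy_kernel_le1 x : `|cauchy_kernel x| <= 1.
Proof.
rewrite gtr0_norm ?cauchy_kernel_gt0// invf_le1//.
by rewrite lerDl sqr_ge0.
Qed.

Let norm_frac_le1 y x : `|y| <= (1 + x ^+ 2) ^+ 2 -> `|y * cauchy_kernel x ^+ 2| <= 1.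
Proof.
move=> h; rewrite normrM normrX (gtr0_norm (cauchy_kernel_gt0 x)).
by rewrite /cauchy_kernel exprVn ler_pdivrMr ?exprn_gt0// mul1r.
Qed.

Lemma norm_cauchy_kernel'_le1 x : `|cauchy_kernel' x| <= 1.
Proof.
apply: norm_frac_le1; rewrite ler_norml; have := sqr_ge0 x.
have := sqr_ge0 (1 - x); have := sqr_ge0 (1 + x); nra.
Qed.

Lemma norm_truncation_le1 x : `|truncation x| <= 1.
Proof.
rewrite normrM (gtr0_norm (cauchy_kernel_gt0 _)) ler_pdivrMr// mul1r ler_norml.
have := sqr_ge0 (1 - x); have := sqr_ge0 (1 + x); nra.
Qed.

Lemma norm_truncation'_le1 x : `|truncation' x| <= 1.
Proof. by apply: norm_frac_le1; rewrite ler_norml; have := sqr_ge0 x; nra. Qed.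

(** The difference factors as y - x times y (1 - x y) / ((1 + x^2) (1 + y^2)), and the second factor
    is at most 1 in absolute value. The constant is thus uniform in spite of the unbounded factor
    y. *)
Lemma truncation_lipschitz x y :
  `|y * truncation y - y * truncation x| <= `|y - x|.
Proof.
rewrite (_ : _ - _ = (y - x) * (y * (1 - x * y) * (cauchy_kernel x * cauchy_kernel y))); last first.
  by rewrite /truncation /cauchy_kernel; field; rewrite !gt_eqF.
rewrite normrM ler_piMr// normrM.
rewrite (gtr0_norm (mulr_gt0 (cauchy_kernel_gt0 x) (cauchy_kernel_gt0 y))).
rewrite /cauchy_kernel -invfM ler_pdivrMr ?mulr_gt0// mul1r normrM.
apply: (@le_trans _ _ (`|y| * (1 + `|x| * `|y|))).
  rewrite ler_wpM2l// (le_trans (ler_normB _ _))// normr1 lerD2l normrM//.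
rewrite -[x ^+ 2]real_normK ?num_real// -[y ^+ 2]real_normK ?num_real//.
have := normr_ge0 x; have := normr_ge0 y.
set a := `|x|; set b := `|y| => b0 a0.
have := sqr_ge0 (1 - b); have := sqr_ge0 (1 - a); have := sqr_ge0 (a * b).
have := mulr_ge0 (sqr_ge0 b) (sqr_ge0 (1 - a)).
nra.
Qed.

End bounded_test_functions.

Section scalar_closability.
Context {d : measure_display} {T : measurableType d} {R : realType}.
Context {P : probability T R} {H : normedModType R} {ip : H -> H -> R}.
Hypothesis Hip : is_inner_product ip.
Context {W : H -> {RV P >-> R}}.
Hypothesis HW : is_isonormal ip W.
Variable h : H.
Hypothesis h1 : ip h h = 1.

Let ev (u : (H -> R) -> R) (w : T) : R := u (fun k => W k w).

Variables (u u' u'' : nat -> (H -> R) -> R) (X : T -> R).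
Hypothesis du : forall n, cylinder_derivative ip h (u n) (u' n).
Hypothesis du' : forall n, cylinder_derivative ip h (u' n) (u'' n).
Hypothesis u0 : \int[P]_w `|ev (u n) w| @[n --> \oo] --> (0 : R).
Hypothesis iX : rintegrable P X.
Hypothesis u'X : \int[P]_w `|ev (u' n) w - X w| @[n --> \oo] --> (0 : R).

Let test m w := truncation (ev (u' m) w) * cauchy_kernel (W h w).

Let mW k : measurable_fun setT (W k : T -> R) := measurable_funPT (W k).

Let cu n : cylinder (u n). Proof. by case: (du n). Qed.
Let cu' n : cylinder (u' n). Proof. by case: (du n). Qed.
Let cu'' n : cylinder (u'' n). Proof. by case: (du' n). Qed.

Let iev v : cylinder v -> rintegrable P (ev v).
Proof. exact: cylinder_isonormal_integrable. Qed.

Let mcont (f : R -> R) (Y : T -> R) : continuous f -> measurable_fun setT Y ->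
  measurable_fun setT (fun w => f (Y w)).
Proof. by move=> cf mY; exact: (measurableT_comp (continuous_measurable_fun cf)). Qed.

Let ctrunc : continuous (@truncation R).
Proof. by move=> x; apply: cvgM; [exact: cvg_id|exact: continuous_cauchy_kernel]. Qed.

Let mev v : cylinder v -> measurable_fun setT (ev v).
Proof. by move=> /iev/rintegrable_measurable. Qed.

Let mtest m : measurable_fun setT (test m).
Proof.
apply: measurable_funM; first by apply: mcont => //; exact: mev.
by apply: mcont => //; exact: continuous_cauchy_kernel.
Qed.

Let test_le1 m w : `|test m w| <= 1.
Proof. by rewrite normrM mulr_ile1// ?norm_truncation_le1// norm_cauchy_kernel_le1. Qed.

Let integral_test_bound m : exists C, forall n,
  `|\int[P]_w (ev (u' n) w * test m w)| <= C * \int[P]_w `|ev (u n) w|.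
Proof.
have [M u''M] := cylinder_bounded (cu'' m).
have M0 : 0 <= M by exact: le_trans (normr_ge0 _) (u''M (fun=> 0)).
(* [M] bounds the second derivative, coming from the derivative of theta (X_m); the 2 bounds chi'
   and Z chi, one each. Nothing depends on n. *)
exists (M + 2) => n.
have dt := cylinder_derivative_comp (fun x => is_derive_truncation x)
  continuous_truncation' norm_truncation_le1 norm_truncation'_le1 (du' m).
have dU := cylinder_derivativeM (du n) dt.
have := isonormal_integration_by_parts Hip HW h1 (C := 1) dU
  (fun x => is_derive_cauchy_kernel x) continuous_cauchy_kernel'
  norm_cauchy_kernel_le1 norm_cauchy_kernel'_le1 norm_truncation_le1.
pose A w := truncation' (ev (u' m) w) * ev (u'' m) w * cauchy_kernel (W h w) +
  truncation (ev (u' m) w) * (cauchy_kernel' (W h w) - truncation (W h w)).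
have mA : measurable_fun setT A.
  apply: measurable_funD; apply: measurable_funM.
  - apply: measurable_funM; last exact: mev.
    by apply: mcont; [exact: continuous_truncation'|exact: mev].
  - by apply: mcont => //; exact: continuous_cauchy_kernel.
  - by apply: mcont => //; exact: mev.
  - apply: measurable_funB; apply: mcont => //; exact: continuous_cauchy_kernel'.
have AM w : `|A w| <= M + 2.
  rewrite (le_trans (ler_normD _ _))// lerD//.
    rewrite normrM -[leRHS]mulr1 ler_pM ?norm_cauchy_kernel_le1//.
    by rewrite normrM -[leRHS]mul1r ler_pM ?norm_truncation'_le1//; exact: u''M.
  rewrite normrM -[leRHS]mul1r ler_pM ?norm_truncation_le1//.
  rewrite (le_trans (ler_normB _ _))// -[2]/(1 + 1) lerD//.
    exact: norm_cauchy_kernel'_le1.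
  exact: norm_truncation_le1.
have iA : rintegrable P (fun w => ev (u n) w * A w).
  exact: (rintegrableMr (iev (cu n)) mA AM).
have iT : rintegrable P (fun w => ev (u' n) w * test m w).
  exact: (rintegrableMr (iev (cu' n)) (mtest m) (test_le1 m)).
have -> : (fun w => (u n (fun k => W k w) * (truncation' (u' m (fun k => W k w)) *
    u'' m (fun k => W k w)) + truncation (u' m (fun k => W k w)) * u' n (fun k => W k w)) *
    cauchy_kernel (W h w) + u n (fun k => W k w) * truncation (u' m (fun k => W k w)) *
    (cauchy_kernel' (W h w) - W h w * cauchy_kernel (W h w))) =
    (fun w => ev (u' n) w * test m w + ev (u n) w * A w).
  by apply/funext => w; rewrite /test /A /ev /truncation; ring.
rewrite rintD// => /eqP; rewrite addr_eq0 => /eqP ->.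
rewrite normrN -rintZ; last exact/rintegrable_norm/iev.
apply: rint_norm_le => //; first exact/rintegrableZ/rintegrable_norm/iev.
by move=> w; rewrite normrM mulrC ler_wpM2r.
Qed.

Let integral_test0 m : \int[P]_w (X w * test m w) = 0.
Proof.
have [C Cn] := integral_test_bound m.
apply/eqP; rewrite -normr_eq0; apply/eqP; apply/eqP; rewrite eq_le normr_ge0 andbT.
have c : \int[P]_w `|ev (u' n) w - X w| + C * \int[P]_w `|ev (u n) w|
    @[n --> \oo] --> (0 + C * 0 : R).
  by apply: cvgD => //; exact: cvgMr.
rewrite mulr0 addr0 in c; rewrite -(cvg_lim _ c)//.
apply: limr_ge; first by apply/cvg_ex; exists 0.
apply: nearW => n.
have iT : rintegrable P (fun w => ev (u' n) w * test m w).
  exact: (rintegrableMr (iev (cu' n)) (mtest m) (test_le1 m)).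
have iXT : rintegrable P (fun w => X w * test m w).
  exact: (rintegrableMr iX (mtest m) (test_le1 m)).
have -> : \int[P]_w (X w * test m w) = \int[P]_w (ev (u' n) w * test m w) -
    \int[P]_w (ev (u' n) w * test m w - X w * test m w).
  by rewrite rintB// opprB addrC subrK.
rewrite (le_trans (ler_normB _ _))// addrC lerD//.
apply: rint_norm_le; first exact: rintegrableB.
  by apply: rintegrable_norm; apply: rintegrableB => //; exact: iev.
by move=> w; rewrite -mulrBl normrM ler_piMr.
Qed.

(** [Y] is nonnegative and vanishes only where [X] does. Subtracting the zero integral of
    [X * test m] bounds its mean by E |X_m - X|, for every m. *)
Lemma cylinder_derivative_closable : {ae P, forall w, X w = 0}.
Proof.
have mX := rintegrable_measurable iX.
pose Y w := X w * (truncation (X w) * cauchy_kernel (W h w)).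
have mtX : measurable_fun setT (fun w => truncation (X w) * cauchy_kernel (W h w)).
  apply: measurable_funM; first exact: mcont.
  by apply: mcont => //; exact: continuous_cauchy_kernel.
have iY : rintegrable P Y.
  apply: (rintegrableMr iX mtX (C := 1)) => w.
  by rewrite normrM mulr_ile1// ?norm_truncation_le1// norm_cauchy_kernel_le1.
have Y0 w : 0 <= Y w.
  rewrite /Y /truncation !mulrA -expr2.
  by rewrite mulr_ge0 ?(ltW (cauchy_kernel_gt0 _))// mulr_ge0 ?sqr_ge0 ?(ltW (cauchy_kernel_gt0 _)).
have intY : \int[P]_w Y w = 0.
  apply/eqP; rewrite eq_le Rintegral_ge0// andbT.
  rewrite -(cvg_lim _ u'X)//; apply: limr_ge; first by apply/cvg_ex; exists 0.
  apply: nearW => m.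
  have iXT : rintegrable P (fun w => X w * test m w).
    exact: (rintegrableMr iX (mtest m) (test_le1 m)).
  rewrite -[leLHS]subr0 -(integral_test0 m) -rintB//.
  apply: le_trans (ler_norm _) _; apply: rint_norm_le; first exact: rintegrableB.
    by apply: rintegrable_norm; apply: rintegrableB => //; exact: iev.
  move=> w; rewrite /Y /test !mulrA -mulrBl normrM.
  rewrite -[leRHS]mulr1 ler_pM// ?norm_cauchy_kernel_le1//.
  by rewrite -!mulrA [leRHS]distrC; exact: truncation_lipschitz.
have : (\int[P]_w `|(Y w)%:E| = 0)%E.
  under eq_integral do rewrite gee0_abs ?lee_fin//.
  by rewrite -EFin_rint// intY.
have mYE : measurable_fun setT (EFin \o Y).
  exact/measurable_EFinP/(rintegrable_measurable iY).
move/(ae_eq_integral_abs P measurableT mYE); apply: filterS => w /(_ I)/= [].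
rewrite /Y /truncation => /eqP; rewrite !mulf_eq0 !(gt_eqF (cauchy_kernel_gt0 _)) !orbF.
by rewrite orbb => /eqP.
Qed.

End scalar_closability.

(** * Lebesgue-Bochner spaces *)

Import HBSimple.

Section finitely_valued.
Context {d : measure_display} {T : measurableType d}.

(** The values lie in a bare type: every subset has a measurable preimage, so the notion is stable
    under composition with arbitrary maps, such as evaluation at a vector. *)
Definition finitely_valued (U : Type) (F : T -> U) : Prop :=
  finite_set (range F) /\ forall v, measurable (F @^-1` [set v]).

Lemma finitely_valued_preimage (U : Type) (F : T -> U) (A : set U) :
  finitely_valued F -> measurable (F @^-1` A).
Proof.
move=> [fF mF].
rewrite (_ : F @^-1` A = \bigcup_(a in range F `&` A) F @^-1` [set a]).
  by apply: fin_bigcup_measurable => //; exact: finite_setIl.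
apply/seteqP; split => [w Aw|w [a [_ Aa] /= ->]//].
by exists (F w) => //; split => //; exists w.
Qed.

Lemma finitely_valued_comp (U V : Type) (phi : U -> V) (F : T -> U) :
  finitely_valued F -> finitely_valued (phi \o F).
Proof.
move=> fF; split; last first.
  by move=> v; rewrite comp_preimage; exact: finitely_valued_preimage.
by have [fin _] := fF; rewrite -(image_comp F phi); exact: finite_image.
Qed.

Lemma finitely_valued_pair (U V : Type) (F : T -> U) (G : T -> V) :
  finitely_valued F -> finitely_valued G -> finitely_valued (fun w => (F w, G w)).
Proof.
move=> fF fG; split.
  apply: (@sub_finite_set _ _ (range F `*` range G)).
    by move=> _ [w _ <-]; split; exists w.
  by apply: finite_setX; [case: fF|case: fG].
move=> [u v]; rewrite (_ : _ @^-1` _ = F @^-1` [set u] `&` G @^-1` [set v]).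
  by apply: measurableI; exact: finitely_valued_preimage.
by apply/seteqP; split => [w [<- <-]|w [/= -> ->]].
Qed.

Lemma finitely_valued_measurable (R : realType) (F : T -> R) :
  finitely_valued F -> measurable_fun setT F.
Proof. by move=> fF _ A _; rewrite setTI; exact: finitely_valued_preimage. Qed.

Lemma sfun_finitely_valued (R : realType) (f : {sfun T >-> R}) : finitely_valued f.
Proof. by split; [exact: fimfunP|move=> v; exact: measurable_sfunP]. Qed.

End finitely_valued.

(** * Seminormed spaces and strong measurability *)

Section seminormed_space.
Context {R : realType} {V : lmodType R}.

(** A [normed_space] is bare data; these are the properties common to [whole_space] and
    [gamma_space] on which the Bochner estimates rest. *)
Record is_seminormed (B : normed_space V) : Prop := IsSeminormed {
  seminormed_carrier0 : carrier B 0;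
  seminormed_carrier : forall (a : R) x y,
    carrier B x -> carrier B y -> carrier B (a *: x + y);
  seminormed0 : norm B 0 = 0;
  seminormed_ge0 : forall x, carrier B x -> 0 <= norm B x;
  seminormed_le : forall (a : R) x y, carrier B x -> carrier B y ->
    norm B (a *: x + y) <= `|a| * norm B x + norm B y
}.

Section theory.
Variable B : normed_space V.
Hypothesis sB : is_seminormed B.

Lemma carrierD x y : carrier B x -> carrier B y -> carrier B (x + y).
Proof. by move=> cx cy; rewrite -[x]scale1r; exact: seminormed_carrier. Qed.

Lemma carrierZ (a : R) x : carrier B x -> carrier B (a *: x).
Proof.
move=> cx; rewrite -[_ *: _]addr0.
by apply: seminormed_carrier => //; exact: seminormed_carrier0.
Qed.

Lemma carrierB x y : carrier B x -> carrier B y -> carrier B (x - y).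
Proof. by move=> cx cy; rewrite -scaleN1r; apply: carrierD => //; exact: carrierZ. Qed.

Lemma normD_le x y : carrier B x -> carrier B y -> norm B (x + y) <= norm B x + norm B y.
Proof.
move=> cx cy; have := seminormed_le sB 1 cx cy.
by rewrite scale1r normr1 mul1r.
Qed.

Lemma normZ_le (a : R) x : carrier B x -> norm B (a *: x) <= `|a| * norm B x.
Proof.
move=> cx; have := seminormed_le sB a cx (seminormed_carrier0 sB).
by rewrite (seminormed0 sB) !addr0.
Qed.

Lemma norm_dist_le x y : carrier B x -> carrier B y ->
  `|norm B x - norm B y| <= norm B (x - y).
Proof.
move=> cx cy; have cxy := carrierB cx cy; have cyx := carrierB cy cx.
have h1 : norm B x <= norm B (x - y) + norm B y.
  by have := normD_le cxy cy; rewrite subrK.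
have h2 : norm B y <= norm B (y - x) + norm B x.
  by have := normD_le cyx cx; rewrite subrK.
have h3 : norm B (y - x) <= norm B (x - y).
  have := normZ_le (-1) cxy; rewrite scaleN1r opprB normrN normr1 mul1r//.
rewrite ler_norml; lra.
Qed.

Context {d : measure_display} {T : measurableType d}.
Implicit Types F G : T -> V.

Lemma strongly_measurable_lin F G (a : R) : (forall w, carrier B (F w)) ->
  (forall w, carrier B (G w)) -> strongly_measurable B F -> strongly_measurable B G ->
  strongly_measurable B (fun w => a *: F w + G w).
Proof.
move=> cF cG [s ss sF] [t st tG]; exists (fun n w => a *: s n w + t n w).
  move=> n; have [cs fs ms] := ss n; have [ct ft mt] := st n; split.
  - by move=> w; exact: seminormed_carrier.
  - have := finitely_valued_comp (fun xy => a *: xy.1 + xy.2)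
      (finitely_valued_pair (conj fs ms) (conj ft mt)).
    by case.
  - have := finitely_valued_comp (fun xy => a *: xy.1 + xy.2)
      (finitely_valued_pair (conj fs ms) (conj ft mt)).
    by case.
move=> w.
have c : `|a| * norm B (s n w - F w) + norm B (t n w - G w) @[n --> \oo] --> (0 : R).
  by rewrite -[0]addr0 -{1}(mulr0 `|a|); apply: cvgD => //; exact: cvgMr.
apply: (squeeze_cvgr _ (cvg_cst 0) c); apply: nearW => n.
have [cs _ _] := ss n; have [ct _ _] := st n.
have -> : a *: s n w + t n w - (a *: F w + G w) = a *: (s n w - F w) + (t n w - G w).
  by rewrite scalerBr opprD addrACA.
have c1 := carrierB (cs w) (cF w); have c2 := carrierB (ct w) (cG w).
rewrite (seminormed_le sB)// andbT.
by apply: (seminormed_ge0 sB); exact: seminormed_carrier.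
Qed.

Lemma strongly_measurable_scale (c : T -> R) v : carrier B v ->
  measurable_fun setT c -> strongly_measurable B (fun w => c w *: v).
Proof.
move=> cv mc.
have mc' : measurable_fun setT (EFin \o c) by exact/measurable_EFinP.
have [s sc] := approximation_sfun measurableT mc'.
exists (fun n w => s n w *: v).
  move=> n; have [] := finitely_valued_comp (fun x : R => x *: v) (sfun_finitely_valued (s n)).
  by split => // w; exact: carrierZ.
move=> w.
have sw : s n w @[n --> \oo] --> c w by apply: (fine_cvg (sc w I)).
have dw : s n w - c w @[n --> \oo] --> (0 : R).
  by rewrite -(subrr (c w)); apply: cvgB => //; exact: cvg_cst.
have c0 : `|s n w - c w| * norm B v @[n --> \oo] --> (0 : R).
  by rewrite -(mul0r (norm B v)); apply: cvgMl; rewrite -(normr0 R); apply: cvg_norm.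
apply: (squeeze_cvgr _ (cvg_cst 0) c0); apply: nearW => n.
rewrite -scalerBl normZ_le// andbT.
by apply: (seminormed_ge0 sB); exact: carrierZ.
Qed.

Lemma strongly_measurable_norm F : (forall w, carrier B (F w)) ->
  strongly_measurable B F -> measurable_fun setT (fun w => norm B (F w)).
Proof.
move=> cF [s ss sF]; apply: (measurable_fun_cvg (h := fun n w => norm B (s n w))).
  move=> n; have [cs fs ms] := ss n; apply: finitely_valued_measurable.
  exact: (finitely_valued_comp (norm B) (conj fs ms)).
move=> w _; apply/cvgrPdist_le => e e0; near=> n.
have [cs _ _] := ss n.
rewrite distrC; apply: le_trans (norm_dist_le (cs w) (cF w)) _.
apply: le_trans (ler_norm _) _; rewrite -[X in `|X|]subr0 distrC.
by near: n; move: e e0; apply/cvgrPdist_le; exact: sF.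
Unshelve. all: by end_near. Qed.

Definition bounded_strongly_measurable F : Prop :=
  [/\ forall w, carrier B (F w), strongly_measurable B F &
      exists M, forall w, norm B (F w) <= M].

Lemma bounded_strongly_measurableD F G : bounded_strongly_measurable F ->
  bounded_strongly_measurable G -> bounded_strongly_measurable (fun w => F w + G w).
Proof.
move=> [cF mF [M FM]] [cG mG [N GN]]; split.
- by move=> w; exact: carrierD.
- have := strongly_measurable_lin 1 cF cG mF mG.
  by under eq_fun do rewrite scale1r.
- by exists (M + N) => w; rewrite (le_trans (normD_le _ _))// lerD.
Qed.

Lemma bounded_strongly_measurable_scale (c : T -> R) M v : carrier B v ->
  measurable_fun setT c -> (forall w, `|c w| <= M) ->
  bounded_strongly_measurable (fun w => c w *: v).
Proof.
move=> cv mc cM; split.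
- by move=> w; exact: carrierZ.
- exact: strongly_measurable_scale.
- exists (M * norm B v) => w; rewrite (le_trans (normZ_le _ _))//.
  by rewrite ler_wpM2r// (seminormed_ge0 sB).
Qed.

Lemma bounded_strongly_measurable_sum (I : Type) (r : seq I) (F : I -> T -> V) :
  (forall i, bounded_strongly_measurable (F i)) ->
  bounded_strongly_measurable (fun w => \sum_(i <- r) F i w).
Proof.
move=> bF; elim: r => [|i r IH].
  under eq_fun do rewrite big_nil.
  have := bounded_strongly_measurable_scale (c := fun=> 0) (M := 0)
    (seminormed_carrier0 sB) (measurable_cst _).
  under eq_fun do rewrite scaler0; apply => w; by rewrite normr0.
under eq_fun do rewrite big_cons; exact: bounded_strongly_measurableD.
Qed.

End theory.
End seminormed_space.

Lemma whole_space_seminormed {R : realType} (E : normedModType R) :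
  is_seminormed (whole_space E).
Proof.
split => //= [|a x y _ _]; first by rewrite normr0.
by rewrite (le_trans (ler_normD _ _))// normrZ.
Qed.

Section Lp.
Context {d : measure_display} {T : measurableType d} {R : realType}.
Variable P : probability T R.
Implicit Types (f g : T -> R) (p c : R).

(* No measurability is needed, as the integral of a nonnegative function is
   defined as a supremum of integrals of simple functions. *)
Lemma ge0_integral_mono (mu : {measure set T -> \bar R}) (f g : T -> \bar R) :
  (forall w, 0 <= f w)%E -> (forall w, f w <= g w)%E ->
  (\int[mu]_w f w <= \int[mu]_w g w)%E.
Proof.
move=> f0 fg; have g0 w : (0 <= g w)%E by exact: le_trans (fg w).
rewrite !ge0_integralTE//; apply: le_ereal_sup => _ [h hf <-].
by exists h => // w; exact: le_trans (hf w) (fg w).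
Qed.

Lemma Lnorm_mono p f g : 0 < p -> (forall w, 0 <= f w) -> (forall w, f w <= g w) ->
  ('N[P]_(p%:E)[EFin \o f] <= 'N[P]_(p%:E)[EFin \o g])%E.
Proof.
move=> p0 f0 fg; rewrite unlock /Lnorm.
have g0 w : 0 <= g w by exact: le_trans (fg w).
apply: gt0_ler_poweR.
- by rewrite invr_ge0 ltW.
- by rewrite in_itv/= leey andbT; apply: integral_ge0 => w _ /=; rewrite lee_fin powR_ge0.
- by rewrite in_itv/= leey andbT; apply: integral_ge0 => w _ /=; rewrite lee_fin powR_ge0.
apply: ge0_integral_mono => w /=; first by rewrite lee_fin powR_ge0.
by rewrite !ger0_norm// lee_fin ge0_ler_powR// ?nnegrE// ltW.
Qed.

Lemma in_Lp_bounded p (V : lmodType R) (B : normed_space V) (F : T -> V) :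
  1 <= p -> is_seminormed B -> bounded_strongly_measurable B F -> in_Lp P p B F.
Proof.
move=> p1 sB [cF mF [M FM]]; split=> //; rewrite /Lp_norm.
have p0 : 0 < p by exact: lt_le_trans p1.
apply: (@le_lt_trans _ _ 'N[P]_(p%:E)[EFin \o cst M]%E).
  by apply: Lnorm_mono => // w; exact: (seminormed_ge0 sB).
have := @Lfun_cst _ T R P M p; rewrite inE => /andP[_]; rewrite inE; exact.
Qed.

Lemma Lnorm1_le p f : 1 <= p -> measurable_fun setT f ->
  ('N[P]_1[EFin \o f] <= 'N[P]_(p%:E)[EFin \o f])%E.
Proof.
rewrite le_eqVlt => /predU1P[<-//|p1] mf.
have p0 : 0 < p by exact: lt_trans p1.
have q0 : 0 < 1 - p^-1 by rewrite subr_gt0 invf_lt1.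
have := @hoelder _ T R P f (cst 1) p (1 - p^-1)^-1 mf (measurable_cst _) p0.
rewrite invr_gt0 invrK subrKC => /(_ q0 erefl).
rewrite Lnorm_cst1 [X in (X `^ _)%E]probability_setT poweR1r mule1.
by under eq_Lnorm do rewrite /= mulr1.
Qed.

(** The passage from Bochner norms to scalars: L^1 convergence follows for every p >= 1, by
    Hoelder's inequality on a probability space. *)
Lemma cvg_Lp_rint p (V : lmodType R) (B : normed_space V) (F_ : nat -> T -> V) F
    (f_ : nat -> T -> R) f : 1 <= p ->
  cvg_Lp P p B F_ F ->
  (forall n, rintegrable P (f_ n)) -> rintegrable P f ->
  (forall n w, `|f_ n w - f w| <= norm B (F_ n w - F w)) ->
  \int[P]_w `|f_ n w - f w| @[n --> \oo] --> (0 : R).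
Proof.
move=> p1 cF if_ if0 fF; have p0 : 0 < p by exact: lt_le_trans p1.
have ib n : rintegrable P (fun w => `|f_ n w - f w|).
  exact/rintegrable_norm/rintegrableB.
suff : (\int[P]_w `|f_ n w - f w|)%:E @[n --> \oo] --> (0%:E : \bar R).
  by move/fine_cvg.
apply: (squeeze_cvge _ (cvg_cst 0%E) cF); apply: nearW => n.
rewrite lee_fin Rintegral_ge0//= EFin_rint//.
have := Lnorm1_le p1 (rintegrable_measurable (rintegrableB (if_ n) if0)).
rewrite Lnorm1 => /le_trans; apply.
rewrite -Lnorm_abse; apply: (@Lnorm_mono p (fun w => `|f_ n w - f w|)) => // w.
Qed.

End Lp.

(** * Completeness of L^2 *)

Section independence.
Context {d : measure_display} {T : measurableType d} {R : realType}.
Variable P : probability T R.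

(** The law of the pair agrees with the product of the laws on rectangles, hence everywhere, and
    Fubini's theorem applies. *)
Lemma independent_expectation (X : nat -> {RV P >-> R}) m n : m != n ->
  independent P (fun n => X n : T -> R) ->
  rintegrable P (X m) -> rintegrable P (X n) ->
  rintegrable P (fun w => X m w * X n w) ->
  \int[P]_w (X m w * X n w) = \int[P]_w X m w * \int[P]_w X n w.
Proof.
move=> mn indep im in_ imn.
have mX k : measurable_fun setT (X k : T -> R) := measurable_funPT (X k).
have mEF : measurable_fun setT (EFin \o @id R) by exact/measurable_EFinP.
have mZ : measurable_fun setT (fun w => (X m w, X n w)) by exact: measurable_fun_pair.
pose Z : {RV P >-> (R * R)%type} :=
  HB.pack (fun w => (X m w, X n w)) (isMeasurableFun.Build _ _ _ _ _ mZ).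
pose f (z : R * R) : \bar R := (z.1 * z.2)%:E.
have mf : measurable_fun setT f.
  apply/measurable_EFinP; apply: measurable_funM.
    exact: measurable_fst.
  exact: measurable_snd.
have rect (A B : set R) : measurable A -> measurable B ->
    distribution P Z (A `*` B) = (distribution P (X m) A * distribution P (X n) B)%E.
  move=> mA mB; have := indep [:: m; n] (fun k => if k == m then A else B).
  rewrite /= inE mn /= => /(_ isT) h.
  have {h} := h (fun k => ltac:(by case: ifP)).
  rewrite big_cons big_seq1 eqxx eq_sym (negbTE mn) => <-.
  congr (P _); apply/seteqP; split => [w [/= Aw Bw] k|w h].
    by rewrite /= !inE => /orP[|] /eqP ->; rewrite ?eqxx// eq_sym (negbTE mn).
  split; first by have := h m; rewrite /= inE !eqxx; exact.
  by have := h n; rewrite /= !inE eqxx orbT eq_sym (negbTE mn); exact.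
have iZ : (distribution P (X m) \x distribution P (X n))%E.-integrable setT f.
  apply/integrableP; split => //.
  rewrite (eq_measure_integral (distribution P Z)); last first.
    by move=> A mA _; exact: product_measure_unique.
  rewrite ge0_integral_distribution//; last exact: measurableT_comp.
  by have [] := integrableP _ _ _ imn.
have e1 : (\int[P]_w (X m w * X n w)%:E = \int[distribution P Z]_z f z)%E.
  by rewrite integral_distribution.
rewrite [in LHS]/Rintegral e1.
rewrite (eq_measure_integral (distribution P (X m) \x distribution P (X n))%E); last first.
  by move=> A mA _; apply/esym; exact: product_measure_unique.
rewrite -integral12_prod_meas1// /fubini_F.
have in' : (distribution P (X n)).-integrable setT EFin.
  apply/integrableP; split; first exact: mEF.
  rewrite ge0_integral_distribution//; last by apply: measurableT_comp => //; exact: mEF.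
  by have [] := integrableP _ _ _ in_.
have e2 x : (\int[distribution P (X n)]_y f (x, y) = x%:E * (\int[P]_w X n w)%:E)%E.
  under eq_integral do rewrite /f /= EFinM.
  rewrite integralZl//; congr (_ * _)%E.
  by rewrite (integral_distribution mEF in_) EFin_rint.
under eq_integral do rewrite e2.
rewrite integral_distribution; last 2 first.
- by apply: emeasurable_funM => //; exact: mEF.
- by have := rintegrableZ (\int[P]_w X n w) im; apply: eq_integrable => // w _; rewrite /= EFinM muleC.
rewrite [X in fine X](_ : _ = (\int[P]_w (\int[P]_w X n w * X m w))%:E).
  by rewrite rintZ//= mulrC.
rewrite (EFin_rint (rintegrableZ (\int[P]_w X n w) im)).
by apply: eq_integral => w _; rewrite /= EFinM muleC.
Qed.

Lemma gaussian_sequence_orthonormal (g : nat -> {RV P >-> R}) m n :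
  is_gaussian_sequence g ->
  rintegrable P (fun w => g m w * g n w) /\ \int[P]_w (g m w * g n w) = (m == n)%:R.
Proof.
move=> [gst gind].
have cg k := standard_gaussian_centred (gst k).
have mg k : measurable_fun setT (g k : T -> R) := measurable_funPT (g k).
have ig k : rintegrable P (g k).
  by apply: (le_rintegrable (mg k) (gaussian_abs_integrable (cg k))).
have igg : rintegrable P (fun w => g m w * g n w).
  apply: (@le_rintegrable _ _ _ _ _ (fun w => g m w ^+ 2 + g n w ^+ 2)).
  - exact: measurable_funM.
  - by apply: rintegrableD; exact: gaussian_sqr_integrable.
  - move=> w; rewrite ler_norml; have := sqr_ge0 (g m w - g n w).
    by have := sqr_ge0 (g m w + g n w); nra.
split=> //; have [<-|mn] := eqVneq m n.
  by rewrite -[RHS](standard_gaussian_variance (gst m)).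
by rewrite independent_expectation// !gaussian_mean0// mulr0.
Qed.

End independence.

Section L2.
Context {d : measure_display} {T : measurableType d} {R : realType}.
Variable P : probability T R.
Implicit Types f : T -> R.

Lemma Lnorm2E f : rintegrable P (fun w => f w ^+ 2) ->
  ('N[P]_2[EFin \o f] = (Num.sqrt (\int[P]_w (f w ^+ 2)))%:E)%E.
Proof.
move=> i2; rewrite unlock /Lnorm.
have -> : (\int[P]_x `|(EFin \o f) x| `^ 2 = (\int[P]_w (f w ^+ 2))%:E)%E.
  rewrite EFin_rint//; apply: eq_integral => w _ /=.
  by rewrite powR_mulrn// real_normK ?num_real.
by rewrite poweR_EFin powR12_sqrt// Rintegral_ge0// => w _; exact: sqr_ge0.
Qed.

(* A fast subsequence converges almost everywhere, to a limit which is also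
   the limit in quadratic mean by Fatou's lemma. *)
Lemma L2_complete (S : nat -> T -> R) (r : nat -> R) :
  (forall n, measurable_fun setT (S n)) ->
  (forall n m, (n <= m)%N -> rintegrable P (fun w => (S m w - S n w) ^+ 2) /\
    \int[P]_w (S m w - S n w) ^+ 2 <= r n) ->
  r n @[n --> \oo] --> (0 : R) ->
  exists Y : T -> R, measurable_fun setT Y /\ forall n,
    rintegrable P (fun w => (Y w - S n w) ^+ 2) /\ \int[P]_w (Y w - S n w) ^+ 2 <= r n.
Proof.
move=> mS Sr r0.
(* Mean squares of order 4^-k yield increments of mean at most 2^-k, which are summable. *)
have [N0 hN0] : {N0 : nat -> nat & forall k n, (N0 k <= n)%N -> r n <= (4^-1) ^+ k}.
  apply: (@choice nat nat (fun k N => forall n, (N <= n)%N -> r n <= (4^-1) ^+ k)) => k.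
  have e0 : 0 < (4^-1 : R) ^+ k by rewrite exprn_gt0// invr_gt0.
  move/cvgrPdist_le : r0 => /(_ _ e0)[N _ hN]; exists N => n Nn.
  by have := hN n Nn; rewrite sub0r normrN; apply: le_trans; exact: ler_norm.
(* Summing the ranks makes them nondecreasing, and the term k makes them unbounded. *)
pose N k := (k + \sum_(i < k.+1) N0 i)%N.
have Nk k : (k <= N k)%N by rewrite leq_addr.
have N0N k : (N0 k <= N k)%N by rewrite /N big_ord_recr/= addnA leq_addl.
have Nmono k l : (k <= l)%N -> (N k <= N l)%N.
  move=> /subnK <-; elim: (l - k)%N => [|m IH]; first by rewrite add0n.
  apply: leq_trans IH _; rewrite addSn /N (big_ord_recr (m + k).+1)/= addSn.
  by rewrite ltnW// ltnS leq_add2l leq_addr.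
pose Tk k := S (N k).
pose D k w := `|Tk k.+1 w - Tk k w|.
have mT k : measurable_fun setT (Tk k) by exact: mS.
have mD k : measurable_fun setT (D k).
  by apply: measurableT_comp => //; exact: measurable_funB.
have D0 k w : 0 <= D k w by exact: normr_ge0.
have intD k : (\int[P]_w (D k w)%:E <= ((2^-1) ^+ k)%:E)%E.
  have [i2 l2] := Sr (N k) (N k.+1) (Nmono _ _ (leqnSn k)).
  have iD : rintegrable P (D k).
    apply: (@le_rintegrable _ _ _ _ _ (fun w => 1 + (S (N k.+1) w - S (N k) w) ^+ 2)) => //.
      by apply: rintegrableD => //; exact: rintegrable_cst.
    move=> w; rewrite normr_id -[_ ^+ 2]real_normK ?num_real//.
    by have := sqr_ge0 (1 - D k w); have := D0 k w; rewrite /D /Tk; nra.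
  rewrite -EFin_rint// lee_fin.
  pose a : R := (2^-1) ^+ k; have a0 : 0 < a by rewrite exprn_gt0// invr_gt0.
  have e4 : (4^-1 : R) ^+ k = a * a by rewrite -exprMn; congr (_ ^+ _); field.
  (* With a = 2^-k, D <= a / 2 + D^2 / (2 a); since E D^2 <= a^2, this gives E D <= a. *)
  have le : \int[P]_w D k w <= \int[P]_w (2^-1 * a + (2 * a)^-1 * (S (N k.+1) w - S (N k) w) ^+ 2).
    apply: le_Rintegral => //.
      by apply: rintegrableD; [exact: rintegrable_cst|exact: rintegrableZ].
    move=> w _; rewrite -[_ ^+ 2]real_normK ?num_real// -/(D k w).
    rewrite -subr_ge0 (_ : _ - _ = (2 * a)^-1 * (a - D k w) ^+ 2); last first.
      by field; rewrite gt_eqF.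
    by rewrite mulr_ge0 ?sqr_ge0// invr_ge0 mulr_ge0// ltW.
  apply: le_trans le _; rewrite rintD//; [|exact: rintegrable_cst|exact: rintegrableZ].
  rewrite rint_cst rintZ//.
  apply: (@le_trans _ _ (2^-1 * a + (2 * a)^-1 * (a * a))).
    rewrite lerD2l ler_wpM2l//; first by rewrite invr_ge0 mulr_ge0// (ltW a0).
    by rewrite -e4; apply: le_trans l2 _; apply: hN0.
  by rewrite (_ : _ + _ = a)//; field; rewrite gt_eqF.
pose DD w := (\sum_(0 <= k <oo) (D k w)%:E)%E.
have DD0 w : (0 <= DD w)%E by apply: nneseries_ge0 => n _ _; rewrite lee_fin.
have mDE k : measurable_fun setT (EFin \o D k) by exact/measurable_EFinP.
have mDD : measurable_fun setT DD.
  by apply: ge0_emeasurable_sum => [k w *|k _]; [rewrite lee_fin|exact: mDE].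
have iDD : P.-integrable setT DD.
  apply/integrableP; split => //.
  under eq_integral do rewrite gee0_abs//.
  rewrite integral_nneseries//; last by move=> k w _; rewrite lee_fin.
  apply: (@le_lt_trans _ _ 2%:E); last exact: ltry.
  apply: lime_le.
    by apply: is_cvg_nneseries => k _ _; apply: integral_ge0 => w _; rewrite lee_fin.
  apply: nearW => n; apply: (@le_trans _ _ (\sum_(0 <= k < n) ((2^-1 : R) ^+ k)%:E)%E).
    by apply: lee_sum => k _.
  rewrite sumEFin lee_fin.
  have := @geometric_le_lim R n 1 2^-1 ler01; rewrite invr_gt0 ger0_norm ?invr_ge0//.
  rewrite invf_lt1// ltr1n => /(_ (ltr0Sn _ _) isT).
  rewrite (_ : 1 / (1 - 2^-1) = 2); last by field.
  by apply: le_trans; rewrite /series/= /geometric/=; under [leRHS]eq_bigr do rewrite mul1r.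
(* The upper limit is measurable everywhere; it is finite almost everywhere, and [fine] replaces
   infinite values by 0. *)
pose Y w := fine (limn_esup (fun k => (Tk k w)%:E)).
have mTE k : measurable_fun setT (EFin \o Tk k) by exact/measurable_EFinP.
have mY : measurable_fun setT Y.
  by apply: measurableT_comp => //; exact: measurable_fun_limn_esup.
have TY : {ae P, forall w, Tk k w @[k --> \oo] --> Y w}.
  have := integrable_ae measurableT iDD; apply: filterS => w /(_ I) fD.
  have cT : cvgn (fun k => Tk k w).
    have : cvgn (series (telescope (fun k => Tk k w))).
      apply: normed_cvg; apply: nondecreasing_is_cvgn.
        by apply: nondecreasing_series => k _ _; exact: normr_ge0.
      exists (fine (DD w)) => _ [n _ <-].
      rewrite -lee_fin fineK// /series/= -sumEFin.
      by apply: (nneseries_lim_ge n) => k _ _; rewrite lee_fin normr_ge0.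
    move=> ct; rewrite (_ : (fun k => Tk k w) =
        (fun k => Tk 0 w + series (telescope (fun k => Tk k w)) k)); last first.
      by apply/funext => k; exact: (eq_sum_telescope (fun k => Tk k w)).
    by apply: is_cvgD => //; exact: is_cvg_cst.
  rewrite /Y; have cE : (Tk k w)%:E @[k --> \oo] --> (limn (fun k => Tk k w))%:E.
    by apply: cvg_EFin; [exact: nearW|exact: cT].
  by rewrite (cvg_limn_einf_sup cE).2.
exists Y; split=> // n.
have mYS : measurable_fun setT (fun w => (Y w - S n w) ^+ 2).
  by apply: measurable_funX; exact: measurable_funB.
(* The shift by n keeps the rank [N (k + n)] above n, where the hypothesis on [S] applies. *)
have mTS k : measurable_fun setT (fun w => (Tk (k + n) w - S n w) ^+ 2).
  by apply: measurable_funX; exact: measurable_funB.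
have Nn k : (n <= N (k + n))%N by apply: leq_trans (leq_addl k n) _; exact: Nk.
have rn0 : 0 <= r n.
  by have [_] := Sr n n (leqnn n); apply: le_trans; apply: Rintegral_ge0 => w _; exact: sqr_ge0.
have cvY : {ae P, forall w, (((Tk (k + n) w - S n w) ^+ 2)%:E @[k --> \oo] --> ((Y w - S n w) ^+ 2)%:E)%E}.
  apply: filterS TY => w c; apply: cvg_EFin; first exact: nearW.
  have c' : Tk (k + n) w @[k --> \oo] --> Y w by exact: (cvg_comp (addn^~ n) (fun k => Tk k w) (cvg_addnr n) c).
  by apply: cvgM; apply: cvgB => //; exact: cvg_cst.
have le : (\int[P]_w ((Y w - S n w) ^+ 2)%:E <= (r n)%:E)%E.
  have me k : measurable_fun setT (fun w => ((Tk (k + n) w - S n w) ^+ 2)%:E) by exact/measurable_EFinP.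
  have -> : (\int[P]_w ((Y w - S n w) ^+ 2)%:E =
      \int[P]_w limn_einf (fun k => ((Tk (k + n) w - S n w) ^+ 2)%:E))%E.
    apply: ae_eq_integral => //.
    - exact/measurable_EFinP.
    - under eq_fun do rewrite -[limn_einf _]oppeK -limn_esupN.
      apply: measurableT_comp => //; apply: measurable_fun_limn_esup => k.
      by apply: measurableT_comp => //; exact: me.
    - by apply: filterS cvY => w c _; rewrite (cvg_limn_einf_sup c).1.
  apply: le_trans (fatou _ _ _ _) _ => //; first by move=> k w _; rewrite lee_fin sqr_ge0.
  rewrite limn_einf_lim; apply: lime_le; first exact: is_cvg_einfs.
  apply: nearW => k; rewrite /einfs; apply: le_trans (ereal_inf_lbound _) _; first by exists k => //=.
  have [i2 l2] := Sr n (N (k + n)) (Nn k).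
  by rewrite -EFin_rint// lee_fin.
have iY : rintegrable P (fun w => (Y w - S n w) ^+ 2).
  apply/integrableP; split; first exact/measurable_EFinP.
  under eq_integral do rewrite /= ger0_norm ?sqr_ge0//.
  exact: le_lt_trans le (ltry _).
by split=> //; rewrite -lee_fin EFin_rint.
Qed.

End L2.

(** * Linear operations and limits in Bochner spaces *)

Section Lp_linear.
Context {d : measure_display} {T : measurableType d} {R : realType}.
Variable P : probability T R.
Implicit Types (f : T -> R) (p a : R).

Lemma LnormZ_le p a f : 1 <= p -> measurable_fun setT f ->
  ('N[P]_(p%:E)[EFin \o (fun w => a * f w)%R] <= `|a|%:E * 'N[P]_(p%:E)[EFin \o f])%E.
Proof.
move=> p1 mf; have p0 : 0 < p by exact: lt_le_trans p1.
rewrite unlock /Lnorm.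
have m0 : measurable_fun setT (fun w => ((`|f w| `^ p)%:E : \bar R)).
  apply/measurable_EFinP; apply: (measurableT_comp (measurable_powR p)).
  exact: measurableT_comp.
under eq_integral do rewrite /= normrM powRM// EFinM.
rewrite ge0_integralZl//.
rewrite poweRM; [|by rewrite lee_fin powR_ge0|by apply: integral_ge0 => w _; rewrite lee_fin powR_ge0].
by rewrite poweR_EFin -powRrM divff ?gt_eqF// powRr1.
Qed.

Context {V : lmodType R} (B : normed_space V).
Hypothesis sB : is_seminormed B.
Variable p : R.
Hypothesis p1 : 1 <= p.
Implicit Types F G : T -> V.

Let p0 : 0 < p. Proof. exact: lt_le_trans p1. Qed.

Lemma Lp_norm_ge0 F : (0 <= Lp_norm P p B F)%E.
Proof. exact: Lnorm_ge0. Qed.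

Lemma Lp_norm_lin a F G : in_Lp P p B F -> in_Lp P p B G ->
  (Lp_norm P p B (fun w => a *: F w + G w)%R <=
   `|a|%:E * Lp_norm P p B F + Lp_norm P p B G)%E.
Proof.
move=> [cF mF _] [cG mG _].
have nF := strongly_measurable_norm sB cF mF.
have nG := strongly_measurable_norm sB cG mG.
have h : (Lp_norm P p B (fun w => a *: F w + G w)%R <=
    'N[P]_(p%:E)[EFin \o ((fun w => `|a| * norm B (F w)) \+ (fun w => norm B (G w)))%R])%E.
  apply: Lnorm_mono => // w /=; last exact: (seminormed_le sB).
  by apply: (seminormed_ge0 sB); exact: (seminormed_carrier sB).
apply: le_trans h _; apply: le_trans (minkowski_EFin _ _ _ _) _ => //.
  exact: measurable_funM.
by rewrite leeD2r//; have := LnormZ_le `|a| p1 nF; rewrite normr_id.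
Qed.

Lemma in_Lp_lin a F G : in_Lp P p B F -> in_Lp P p B G ->
  in_Lp P p B (fun w => a *: F w + G w).
Proof.
move=> iF iG; have [cF mF fF] := iF; have [cG mG fG] := iG; split.
- by move=> w; exact: (seminormed_carrier sB).
- exact: strongly_measurable_lin.
- apply: le_lt_trans (Lp_norm_lin a iF iG) _.
  by rewrite lte_add_pinfty// lte_mul_pinfty ?lee_fin.
Qed.

Lemma in_LpB F G : in_Lp P p B F -> in_Lp P p B G -> in_Lp P p B (fun w => F w - G w).
Proof.
move=> iF iG; have := in_Lp_lin (-1) iG iF.
by under eq_fun do rewrite scaleN1r addrC.
Qed.

Lemma in_Lp0 : in_Lp P p B (fun=> 0).
Proof.
apply: in_Lp_bounded => //.
have := bounded_strongly_measurable_scale sB (T := T) (c := fun=> 0) (M := 0)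
  (seminormed_carrier0 sB) (measurable_cst _).
by rewrite scaler0; apply => w; rewrite normr0.
Qed.

Lemma in_Lp_sum (J : Type) (r : seq J) (F : J -> T -> V) :
  (forall i, in_Lp P p B (F i)) -> in_Lp P p B (fun w => \sum_(i <- r) F i w).
Proof.
move=> iF; elim: r => [|i r IH].
  by under eq_fun do rewrite big_nil; exact: in_Lp0.
under eq_fun do rewrite big_cons -[F i _]scale1r; exact: in_Lp_lin.
Qed.

Lemma Lp_norm_scale (c : T -> R) x : carrier B x -> measurable_fun setT c ->
  (Lp_norm P p B (fun w => c w *: x)%R <= (norm B x)%:E * 'N[P]_(p%:E)[EFin \o c])%E.
Proof.
move=> cx mc; have nx := ger0_norm (seminormed_ge0 sB cx).
rewrite -nx; apply: le_trans (LnormZ_le (norm B x) p1 mc).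
apply: (@le_trans _ _ 'N[P]_(p%:E)[abse \o (EFin \o (fun w => norm B x * c w)%R)]%E); last first.
  by rewrite Lnorm_abse.
apply: (@Lnorm_mono _ _ _ P p _ (fun w => `|norm B x * c w|)) => // w /=.
  by apply: (seminormed_ge0 sB); exact: carrierZ.
by rewrite normrM nx mulrC; exact: normZ_le.
Qed.

Lemma in_Lp_scale (c : T -> R) x : carrier B x -> measurable_fun setT c ->
  ('N[P]_(p%:E)[EFin \o c] < +oo)%E -> in_Lp P p B (fun w => c w *: x).
Proof.
move=> cx mc fc; split.
- by move=> w; exact: carrierZ.
- exact: strongly_measurable_scale.
- apply: le_lt_trans (Lp_norm_scale cx mc) _.
  by rewrite lte_mul_pinfty// ?lee_fin// (seminormed_ge0 sB).
Qed.

Lemma cvg_Lp_lin a (F_ G_ : nat -> T -> V) F G :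
  (forall n, in_Lp P p B (F_ n)) -> (forall n, in_Lp P p B (G_ n)) ->
  in_Lp P p B F -> in_Lp P p B G ->
  cvg_Lp P p B F_ F -> cvg_Lp P p B G_ G ->
  cvg_Lp P p B (fun n w => a *: F_ n w + G_ n w) (fun w => a *: F w + G w).
Proof.
move=> iF_ iG_ iF iG cF cG.
have c : (`|a|%:E * Lp_norm P p B (fun w => F_ n w - F w)%R +
    Lp_norm P p B (fun w => G_ n w - G w)%R @[n --> \oo] --> 0)%E.
  rewrite -[0%E]adde0 -[X in (X + _)%E](mule0 `|a|%:E).
  apply: cvgeD => //.
  by apply: cvgeZl.
apply: (squeeze_cvge _ (cvg_cst 0%E) c); apply: nearW => n.
rewrite Lp_norm_ge0/=.
apply: le_trans (Lp_norm_lin a (in_LpB (iF_ n) iF) (in_LpB (iG_ n) iG)).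
rewrite le_eqVlt; apply/orP; left; apply/eqP; congr Lp_norm; apply/funext => w.
by rewrite scalerBr opprD addrACA.
Qed.

(** The triangle inequality through [F_ n] shows that F - G has norm zero. Used in both directions,
    this makes [gamma_norm] independent of the representative picked by [xget]. *)
Lemma cvg_Lp_norm_le (F_ : nat -> T -> V) F G :
  (forall n, in_Lp P p B (F_ n)) -> in_Lp P p B F -> in_Lp P p B G ->
  cvg_Lp P p B F_ F -> cvg_Lp P p B F_ G ->
  (Lp_norm P p B F <= Lp_norm P p B G)%E.
Proof.
move=> iF_ iF iG cF cG.
have D0 : (Lp_norm P p B (fun w => F w - G w)%R <= 0)%E.
  have c : (`|-1|%:E * Lp_norm P p B (fun w => F_ n w - F w)%R +
      Lp_norm P p B (fun w => F_ n w - G w)%R @[n --> \oo] --> 0)%E.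
    rewrite -[0%E]adde0 -[X in (X + _)%E](mule0 `|-1|%:E).
    apply: cvgeD => //.
    by apply: cvgeZl.
  rewrite -(cvg_lim _ c)//; apply: lime_ge; first by apply/cvg_ex; exists 0%E.
  apply: nearW => n.
  apply: le_trans (Lp_norm_lin (-1) (in_LpB (iF_ n) iF) (in_LpB (iF_ n) iG)).
  rewrite le_eqVlt; apply/orP; left; apply/eqP; congr Lp_norm; apply/funext => w.
  by rewrite scaleN1r opprB addrA subrK.
have := Lp_norm_lin 1 (in_LpB iF iG) iG.
under eq_fun do rewrite scale1r subrK.
move/le_trans; apply; rewrite normr1 mul1e -[leRHS]add0e leeD2r//.
Qed.

End Lp_linear.

(** * Radonifying operators *)

Section gamma_space.
Context {R : realType} {H E : normedModType R}.
Context {d : measure_display} {T : measurableType d}.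
Variables (P : probability T R) (g : nat -> {RV P >-> R}).
Hypothesis gG : is_gaussian_sequence g.
Variables (I : pred nat) (e : nat -> H).

Let sE := whole_space_seminormed E.
Let le12 : (1 : R) <= 2. Proof. by rewrite ler1n. Qed.

(** Pythagoras: each partial sum is orthogonal to all later variables. The index set is absorbed
    later by taking [b] zero outside it. *)
Lemma gaussian_square_sum (b : nat -> R) n :
  rintegrable P (fun w => (\sum_(k < n) g k w * b k) ^+ 2) /\
  \int[P]_w ((\sum_(k < n) g k w * b k) ^+ 2) = \sum_(k < n) b k ^+ 2.
Proof.
pose f n w := \sum_(k < n) g k w * b k; rewrite -/(f n).
have fS k : f k.+1 = (fun w => f k w + b k * g k w).
  by apply/funext => w; rewrite /f big_ord_recr/= [g k w * _]mulrC.
have cross k m : (k <= m)%N ->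
    rintegrable P (fun w => f k w * g m w) /\ \int[P]_w (f k w * g m w) = 0.
  elim: k => [_|k IH km].
    rewrite (_ : (fun w => f 0 w * g m w) = (fun=> 0)).
      by split; [exact: rintegrable_cst|exact: rint_cst].
    by apply/funext => w; rewrite /f big_ord0 mul0r.
  have [i1 e1] := IH (ltnW km).
  have [i2 e2] := gaussian_sequence_orthonormal k m gG.
  have i3 := rintegrableZ (b k) i2.
  rewrite (_ : (fun w => f k.+1 w * g m w) =
      (fun w => f k w * g m w + b k * (g k w * g m w))); last first.
    by apply/funext => w; rewrite fS mulrDl mulrA.
  split; first exact: rintegrableD.
  by rewrite rintD// rintZ// e1 e2 (ltn_eqF km) mulr0 addr0.
elim: n => [|n [i1 e1]].
  rewrite (_ : (fun w => f 0 w ^+ 2) = (fun=> 0)).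
    by rewrite big_ord0; split; [exact: rintegrable_cst|exact: rint_cst].
  by apply/funext => w; rewrite /f big_ord0 expr0n.
have [i2 e2] := cross n n (leqnn n).
have [i3 e3] := gaussian_sequence_orthonormal n n gG.
have i4 := rintegrableZ (2 * b n) i2; have i5 := rintegrableZ (b n ^+ 2) i3.
rewrite (_ : (fun w => f n.+1 w ^+ 2) = (fun w => f n w ^+ 2 +
    (2 * b n * (f n w * g n w) + b n ^+ 2 * (g n w * g n w)))); last first.
  by apply/funext => w; rewrite fS; ring.
have i6 := rintegrableD i4 i5.
split; first exact: rintegrableD.
rewrite rintD// rintD// !rintZ// e1 e2 e3 eqxx mulr0 mulr1 add0r.
by rewrite big_ord_recr.
Qed.

Lemma gaussian_sum_in_Lp (S : H -> E) N : in_Lp P 2 (whole_space E) (gaussian_sum g I e S N).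
Proof.
rewrite /gaussian_sum.
under eq_fun do rewrite big_mkcond/=.
apply: (in_Lp_sum sE le12 _
  (F := fun (n : 'I_N) w => if (n : nat) \in I then g n w *: S (e n) else 0)) => n.
case: ((n : nat) \in I); last exact: in_Lp0.
apply: in_Lp_scale => //.
have [i2 _] := gaussian_sequence_orthonormal n n gG.
rewrite Lnorm2E ?ltry//.
Qed.

Lemma gaussian_series_lin (a : R) (S S' : H -> E) (X X' : T -> E) :
  gaussian_series g I e S X -> gaussian_series g I e S' X' ->
  gaussian_series g I e (a *: S + S') (fun w => a *: X w + X' w).
Proof.
move=> [iX cX] [iX' cX']; split; first exact: in_Lp_lin.
have -> : gaussian_sum g I e (a *: S + S') =
    (fun n w => a *: gaussian_sum g I e S n w + gaussian_sum g I e S' n w).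
  apply/funext => N; apply/funext => w; rewrite /gaussian_sum scaler_sumr -big_split/=.
  by apply: eq_bigr => n _; rewrite scalerDr scalerA mulrC -scalerA.
by apply: (cvg_Lp_lin sE le12) => // n; exact: gaussian_sum_in_Lp.
Qed.

Lemma gamma_normE (S : H -> E) (X : T -> E) : gaussian_series g I e S X ->
  (gamma_norm g I e S)%:E = Lp_norm P 2 (whole_space E) X.
Proof.
move=> sX; rewrite /gamma_norm; set Y := xget _ _.
have sY : gaussian_series g I e S Y by exact: (xgetI _ sX).
have [iX cX] := sX; have [iY cY] := sY.
rewrite fineK; last by rewrite ge0_fin_numE ?Lp_norm_ge0//; case: iY.
apply/eqP; rewrite eq_le; apply/andP.
have iS := gaussian_sum_in_Lp S.
by split; [exact: (cvg_Lp_norm_le sE le12 iS iY iX)|exact: (cvg_Lp_norm_le sE le12 iS iX iY)].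
Qed.

Lemma gamma_norm_ge0 (S : H -> E) : 0 <= gamma_norm g I e S.
Proof. by apply: fine_ge0; exact: Lp_norm_ge0. Qed.

Lemma gamma_space_seminormed : is_seminormed (gamma_space g I e : normed_space (H -> E : lmodType R)).
Proof.
have gs0 : gaussian_series g I e (0 : H -> E) (fun=> 0).
  split; first exact: (in_Lp0 P sE le12).
  rewrite /cvg_Lp (_ : (fun n : nat => _) = (fun=> 0%E)); first exact: cvg_cst.
  apply/funext => n; rewrite /gaussian_sum.
  rewrite (_ : (fun w => _ - _) = (fun=> 0)); last first.
    by apply/funext => w; rewrite big1 ?subr0// => i _; rewrite scaler0.
  rewrite /Lp_norm; under eq_Lnorm do rewrite /= normr0.
  by rewrite Lnorm0// eqe pnatr_eq0.
split.
- split.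
  + by move=> a u v; rewrite /= scaler0 addr0.
  + by move=> x; exact: cvg_cst.
  + by exists (fun=> 0).
- move=> a S S' [lS cS [X sX]] [lS' cS' [X' sX']]; split.
  + move=> b u v; change (a *: S (b *: u + v) + S' (b *: u + v) =
      b *: (a *: S u + S' u) + (a *: S v + S' v)).
    by rewrite lS lS' !scalerDr !scalerA [a * b]mulrC addrACA.
  + move=> x; apply: cvgD; last exact: cS'.
    by apply: cvgZr; exact: cS.
  + by exists (fun w => a *: X w + X' w); exact: gaussian_series_lin.
- apply: EFin_inj; rewrite (gamma_normE gs0).
  rewrite /Lp_norm; under eq_Lnorm do rewrite /= normr0.
  by rewrite Lnorm0// eqe pnatr_eq0.
- by move=> S _; exact: gamma_norm_ge0.
- move=> a S S' [_ _ [X sX]] [_ _ [X' sX']]; rewrite -lee_fin EFinD EFinM.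
  rewrite (gamma_normE (gaussian_series_lin a sX sX')) (gamma_normE sX) (gamma_normE sX').
  by apply: (Lp_norm_lin sE le12); [case: sX|case: sX'].
Qed.

End gamma_space.

Section radonifying_operators.
Context {R : realType} {H E : normedModType R}.
Context {d : measure_display} {T : measurableType d}.
Variables (P : probability T R) (g : nat -> {RV P >-> R}).
Hypothesis gG : is_gaussian_sequence g.
Variables (ip : H -> H -> R) (I : pred nat) (e : nat -> H).
Hypothesis Hip : is_inner_product ip.
Hypothesis onb : is_orthonormal_basis ip I e.

Let sE := whole_space_seminormed E.
Let le12 : (1 : R) <= 2. Proof. by rewrite ler1n. Qed.

Let coef h n : R := if n \in I then ip (e n) h else 0.

(** The right side minus the left side is the squared distance from h to its partial expansion, by
    induction on the number of terms. *)
Lemma bessel h N : \sum_(n < N) coef h n ^+ 2 <= `|h| ^+ 2.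
Proof.
pose v N := \sum_(n < N) coef h n *: e n.
have v_orth n m : (n <= m)%N -> m \in I -> ip (v n) (e m) = 0.
  move=> nm Im; elim: n nm => [_|n IH nm]; first by rewrite /v big_ord0 ip0l.
  rewrite /v big_ord_recr/= (ipDl Hip) IH ?(ltnW nm)// add0r (ipZl Hip) /coef.
  by case: ifPn => [In|_]; rewrite ?mul0r// (onb_orthonormal onb)// (ltn_eqF nm) mulr0.
have dist n : `|h - v n| ^+ 2 = `|h| ^+ 2 - \sum_(k < n) coef h k ^+ 2.
  elim: n => [|n IH]; first by rewrite /v !big_ord0 !subr0.
  have -> : v n.+1 = v n + coef h n *: e n by rewrite /v big_ord_recr.
  rewrite big_ord_recr/= [in RHS]opprD [RHS]addrA -IH opprD addrA -!(ip_norm Hip).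
  have [In|nIn] := boolP (n \in I); last first.
    by rewrite /coef (negbTE nIn) scale0r subr0 expr0n/= subr0.
  have oe : ip (h - v n) (e n) = coef h n.
    by rewrite (ipBl Hip) v_orth// subr0 /coef In (ip_sym Hip).
  move: (h - v n) oe => w oe.
  rewrite (ipBl Hip) !(ipBr Hip) !(ipZl Hip) !(ipZr Hip) (ip_sym Hip (e n)) oe.
  by rewrite (onb_orthonormal onb)// eqxx/=; ring.
by rewrite -subr_ge0 -dist sqr_ge0.
Qed.

Lemma rank_one_radonifying h (x : E) : radonifying g I e (rank_one ip h x).
Proof.
split.
- by move=> a u v; rewrite /rank_one (ipDl Hip) (ipZl Hip) scalerDl scalerA.
- move=> u; apply: cvgZl; apply/cvgrPdist_le => r r0; near=> v.
  have h1 : 0 < `|h| + 1 by rewrite ltr_pwDr.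
  rewrite -(ipBl Hip); apply: le_trans (cauchy_schwarz Hip _ _) _.
  apply: (@le_trans _ _ (r / (`|h| + 1) * (`|h| + 1))); last by rewrite divfK ?gt_eqF.
  apply: ler_pM => //; last by rewrite lerDl.
  by near: v; apply: cvgr_dist_le => //; rewrite divr_gt0.
- pose b := coef h.
  pose S n w := \sum_(k < n) g k w * b k.
  pose s n := \sum_(k < n) b k ^+ 2.
  have ms n m : (n <= m)%N -> s n <= s m.
    move=> /subnK <-; elim: (m - n)%N => [//|k IH].
    by rewrite addSn /s big_ord_recr/= -[leLHS]addr0 lerD// sqr_ge0.
  have cs : cvgn s.
    apply: nondecreasing_is_cvgn; first exact: ms.
    by exists (`|h| ^+ 2) => _ [n _ <-]; exact: bessel.
  have mS n : measurable_fun setT (S n).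
    by apply: measurable_sum => k; apply: measurable_funM.
  have SS n m : (n <= m)%N -> rintegrable P (fun w => (S m w - S n w) ^+ 2) /\
      \int[P]_w (S m w - S n w) ^+ 2 <= limn s - s n.
    (* With the first n coefficients erased, a difference of partial sums is again a sum from 0, of
       mean square s m - s n. The whole series is scalar times x, so completeness of scalar L^2
       provides its sum. *)
    move=> nm; pose c k := if (k < n)%N then 0 else b k.
    have cE (u : nat -> R) : \sum_(k < m) u k * c k = \sum_(k < m) u k * b k - \sum_(k < n) u k * b k.
      rewrite -(subnK nm); elim: (m - n)%N => [|k IH].
        by rewrite subrr big1// => k _; rewrite /c ltn_ord mulr0.
      by rewrite addSn !(big_ord_recr (k + n)%N)/= IH /c ltnNge leq_addl/= addrAC.
    have [i2 e2] := gaussian_square_sum gG c m.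
    rewrite (_ : (fun w => (S m w - S n w) ^+ 2) = (fun w => (\sum_(k < m) g k w * c k) ^+ 2)).
      split=> //; rewrite e2 (_ : \sum_(k < m) _ = s m - s n).
        by rewrite lerD2r; apply: nondecreasing_cvgn_le.
      transitivity (\sum_(k < m) b k * c k); last exact: cE.
      by apply: eq_bigr => k _; rewrite /c; case: ifP => _; rewrite ?expr0n ?mulr0// expr2.
    by apply/funext => w; rewrite (cE (fun k => g k w)).
  have r0 : limn s - s n @[n --> \oo] --> (0 : R).
    by rewrite -(subrr (limn s)); apply: cvgB => //; exact: cvg_cst.
  have [Y [mY hY]] := L2_complete mS SS r0.
  exists (fun w => Y w *: x).
  have iY : in_Lp P 2 (whole_space E) (fun w => Y w *: x).
    apply: (in_Lp_scale sE le12) => //; have [i2 _] := hY 0%N.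
    rewrite (_ : Y = (fun w => Y w - S 0%N w)); last first.
      by apply/funext => w; rewrite /S big_ord0 subr0.
    by rewrite Lnorm2E// ltry.
  split=> //.
  have c0 : (`|x|%:E * (Num.sqrt (limn s - s n))%:E)%E @[n --> \oo] --> 0%E.
    rewrite -[0%E](mule0 `|x|%:E); apply: cvgeZl => //.
    apply: cvg_EFin; first exact: nearW.
    rewrite -[0 in X in _ --> X]sqrtr0.
    exact: (continuous_cvg _ (@sqrt_continuous R 0) r0).
  apply: (squeeze_cvge _ (cvg_cst 0%E) c0); apply: nearW => n.
  rewrite Lp_norm_ge0/= (_ : (fun w => _ - _) = (fun w => (S n w - Y w) *: x)); last first.
    apply/funext => w; rewrite scalerBl; congr (_ - _).
    rewrite /gaussian_sum /S scaler_suml big_mkcond/=; apply: eq_bigr => k _.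
    by rewrite /b /coef /rank_one; case: ifP => _; rewrite ?mulr0 ?scale0r// scalerA.
  apply: le_trans (Lp_norm_scale P sE le12 _ _) _ => //.
    exact: measurable_funB.
  apply: lee_wpmul2l; first by rewrite lee_fin normr_ge0.
  have [i2 l2] := hY n.
  rewrite (_ : (fun w => S n w - Y w) = (fun w => - (Y w - S n w))); last first.
    by apply/funext => w; rewrite opprB.
  have e2 : (fun w => (- (Y w - S n w)) ^+ 2) = (fun w => (Y w - S n w) ^+ 2).
    by apply/funext => w; rewrite sqrrN.
  rewrite Lnorm2E e2// lee_fin ler_sqrt//; apply: le_trans l2.
  by apply: Rintegral_ge0 => w _; exact: sqr_ge0.
Unshelve. all: by end_near. Qed.

(* Only finitely many terms of the series are needed: the norm of a partial sum
   dominates the expectation of its square along a norming functional. *)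
Lemma norm_basis_le_gamma (S : H -> E) n : n \in I -> radonifying g I e S ->
  `|S (e n)| <= gamma_norm g I e S.
Proof.
move=> In [_ _ [X sX]].
have [phi [phi_lin phi_le <-]] := norming_functional (S (e n)).
rewrite -lee_fin (gamma_normE gG sX).
have phi0 : phi 0 = 0 by have := phi_lin 1 0 0; rewrite scaler0 addr0; lra.
have phi_sum N w : phi (gaussian_sum g I e S N w) =
    \sum_(k < N) g k w * (if (k : nat) \in I then phi (S (e k)) else 0).
  rewrite /gaussian_sum; elim: N => [|N IH]; first by rewrite !big_ord0.
  rewrite big_mkcond big_ord_recr/= -big_mkcond [RHS]big_ord_recr/= -IH.
  case: ifP => _; last by rewrite mulr0 !addr0.
  by rewrite addrC phi_lin addrC.
have [iX cX] := sX; have iS := gaussian_sum_in_Lp gG I e S.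
have le N : (n < N)%N -> ((phi (S (e n)))%:E <= Lp_norm P 2 (whole_space E) (gaussian_sum g I e S N))%E.
  move=> nN.
  have [i2 e2] := gaussian_square_sum gG (fun k => if (k : nat) \in I then phi (S (e k)) else 0) N.
  apply: (@le_trans _ _ ('N[P]_2[EFin \o (fun w => phi (gaussian_sum g I e S N w))])%E).
    under [X in 'N[_]_2[X]%E]eq_fun do rewrite /= phi_sum.
    rewrite (Lnorm2E i2) lee_fin e2; apply: le_trans (ler_norm _) _; rewrite -sqrtr_sqr ler_sqrt.
      by rewrite (bigD1 (Ordinal nN))//= In lerDl sumr_ge0// => i _; exact: sqr_ge0.
    by apply: sumr_ge0 => i _; exact: sqr_ge0.
  rewrite -Lnorm_abse; apply: (@Lnorm_mono _ _ _ P 2 (fun w => `|phi (gaussian_sum g I e S N w)|)) => // w.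
have c : (Lp_norm P 2 (whole_space E) X +
  Lp_norm P 2 (whole_space E) (fun w => gaussian_sum g I e S N w - X w)%R @[N --> \oo] -->
  Lp_norm P 2 (whole_space E) X)%E.
  rewrite -[X in _ --> X]adde0; apply: cvgeD => //; last exact: cvg_cst.
  by rewrite fin_num_adde_defl.
rewrite -(cvg_lim _ c)//; apply: lime_ge; first by apply/cvg_ex; eexists; exact: c.
exists n.+1 => // N /= nN; apply: le_trans (le N nN) _.
have := Lp_norm_lin sE le12 1 (in_LpB sE le12 (iS N) iX) iX.
under eq_fun do rewrite scale1r subrK.
by rewrite normr1 mul1e addeC.
Qed.

End radonifying_operators.

(** * Closability of the Malliavin derivative *)

Section malliavin_derivative.
Context {R : realType}.
Context {d : measure_display} {Omega : measurableType d} {P : probability Omega R}.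
Context {H E : normedModType R} {ip : H -> H -> R}.
Hypothesis Hip : is_inner_product ip.
Context {W : H -> {RV P >-> R}}.
Hypothesis HW : is_isonormal ip W.
Context {d' : measure_display} {Omega' : measurableType d'} {P' : probability Omega' R}.
Context {g : nat -> {RV P' >-> R}}.
Hypothesis gG : is_gaussian_sequence g.
Context {I : pred nat} {e : nat -> H}.
Hypothesis onb : is_orthonormal_basis ip I e.
Variable p : R.
Hypothesis p1 : 1 <= p.

Let sE := whole_space_seminormed E.
Let sG : is_seminormed (gamma_space g I e : normed_space (H -> E : lmodType R)) :=
  gamma_space_seminormed gG I e.

(** Both are finite sums of a bounded measurable coefficient times a fixed vector; boundedness
    places them in L^p for every p at once. *)
Lemma malliavin_bounded (F : Omega -> E) (DF : Omega -> H -> E) : malliavin ip W F DF ->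
  bounded_strongly_measurable (whole_space E) F /\
  bounded_strongly_measurable (gamma_space g I e) DF.
Proof.
elim=> [n f h x Cf|F1 DF1 F2 DF2 _ [bF1 bDF1] _ [bF2 bDF2]]; last first.
  by split; exact: bounded_strongly_measurableD.
have mcoef (u : 'rV[R]_n.+1 -> R) : Cb_infty u ->
    measurable_fun setT (fun w => u (isonormal_vector W h w)).
  by move=> Cu; exact: (cylinder_isonormal_measurable (W := W) (cylinder_Cb_infty h Cu)).
split.
  have [_ [M fM]] := Cf [::].
  exact: (bounded_strongly_measurable_scale sE (M := M) _ (mcoef _ Cf)).
apply: (bounded_strongly_measurable_sum sG _
  (F := fun j w => partial j f (isonormal_vector W h w) *: rank_one ip (h j) x)) => j.
have Cj := Cb_infty_partial j Cf; have [_ [M fM]] := Cj [::].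
apply: (bounded_strongly_measurable_scale sG (M := M) _ (mcoef _ Cj)).
  exact: rank_one_radonifying.
by move=> w; exact: fM.
Qed.

Lemma malliavin_operator_into_Lp :
  operator_into_Lp P p (whole_space E) (gamma_space g I e) (malliavin ip W).
Proof. by move=> F DF /malliavin_bounded[bF bDF]; split; exact: in_Lp_bounded. Qed.

Section evaluation.
Variables (n : nat) (phi : E -> R).
Hypothesis In : n \in I.
Hypothesis phi_lin : forall (a : R) y z, phi (a *: y + z) = a * phi y + phi z.
Hypothesis phi_le : forall y, `|phi y| <= `|y|.

Let phiB y z : phi (y - z) = phi y - phi z.
Proof. by rewrite -scaleN1r addrC phi_lin mulN1r addrC. Qed.

Lemma evaluation_le (S S' : H -> E) : radonifying g I e S -> radonifying g I e S' ->
  `|phi (S (e n)) - phi (S' (e n))| <= norm (gamma_space g I e) (S - S').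
Proof.
move=> rS rS'; rewrite -phiB; apply: le_trans (phi_le _) _.
have rSS' := carrierB sG rS rS'.
exact: (@norm_basis_le_gamma _ _ _ _ _ _ _ gG _ _ (S - S') _ In rSS').
Qed.

Lemma evaluation_integrable (G : Omega -> H -> E) : in_Lp P p (gamma_space g I e) G ->
  rintegrable P (fun w => phi (G w (e n))).
Proof.
move=> [cG mG fG]; have [s ss sG'] := mG.
have phi0 : phi 0 = 0 by rewrite -(subrr 0) phiB subrr.
apply: (@le_rintegrable _ _ _ _ _ (fun w => norm (gamma_space g I e) (G w))).
- apply: (measurable_fun_cvg (h := fun k w => phi (s k w (e n)))).
    move=> k; have [_ fs ms] := ss k; apply: finitely_valued_measurable.
    exact: (finitely_valued_comp (fun S : H -> E => phi (S (e n))) (conj fs ms)).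
  move=> w _; apply/cvgrPdist_le => r r0; near=> k.
  have [cs _ _] := ss k.
  rewrite distrC; apply: le_trans (evaluation_le (cs w) (cG w)) _.
  apply: le_trans (ler_norm _) _; rewrite -[X in `|X|]subr0 distrC.
  by near: k; move: r r0; apply/cvgrPdist_le; exact: sG'.
- have mnG := strongly_measurable_norm sG cG mG.
  apply/integrableP; split; first exact/measurable_EFinP.
  rewrite -Lnorm1; apply: le_lt_trans fG.
  exact: Lnorm1_le.
- move=> w; have := evaluation_le (cG w) (seminormed_carrier0 sG).
  rewrite [phi (0 _)](_ : _ = 0)// !subr0.
Unshelve. all: by end_near. Qed.

(** Applying phi, and evaluation at the unit vector [e n] followed by phi, do not increase
    distances, so the two L^p limits become L^1 limits of scalar cylinder functions and of their
    derivatives along [e n]. *)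
Lemma malliavin_evaluation_closable (Fn : nat -> Omega -> E) (Gn : nat -> Omega -> H -> E)
    (G : Omega -> H -> E) :
  (forall k, malliavin ip W (Fn k) (Gn k)) ->
  cvg_Lp P p (whole_space E) Fn (fun=> 0) ->
  in_Lp P p (gamma_space g I e) G -> cvg_Lp P p (gamma_space g I e) Gn G ->
  {ae P, forall w, phi (G w (e n)) = 0}.
Proof.
move=> A cF iG cG.
have /choice[t ht] : forall k, exists t : ((H -> R) -> R) * ((H -> R) -> R) * ((H -> R) -> R),
    [/\ cylinder_derivative ip (e n) t.1.1 t.1.2, cylinder_derivative ip (e n) t.1.2 t.2,
    forall w, phi (Fn k w) = t.1.1 (fun h => W h w) &
    forall w, phi (Gn k w (e n)) = t.1.2 (fun h => W h w)].
  move=> k; have [u [u' [u'' h]]] := malliavin_cylinder (e n) Hip phi_lin (A k).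
  by exists (u, u', u'').
have iE k : in_Lp P p (gamma_space g I e) (Gn k) by have [] := malliavin_operator_into_Lp (A k).
have iX := evaluation_integrable iG.
apply: (@cylinder_derivative_closable _ _ _ _ _ _ Hip _ HW (e n) _
  (fun k => (t k).1.1) (fun k => (t k).1.2) (fun k => (t k).2)) => //.
- by rewrite (onb_orthonormal onb)// eqxx.
- by move=> k; case: (ht k).
- by move=> k; case: (ht k).
- rewrite (_ : (fun k => _) = (fun k => \int[P]_w `|(t k).1.1 (fun h => W h w) - 0|)); last first.
    by apply/funext => k; apply: eq_Rintegral => w _; rewrite subr0.
  apply: (cvg_Lp_rint (f := fun=> 0) p1 cF) => [k||k w]; last 1 first.
  + by have [_ _ <- _] := ht k; rewrite !subr0; exact: phi_le.
  + by apply: cylinder_isonormal_integrable; case: (ht k) => -[].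
  + exact: rintegrable_cst.
- apply: (cvg_Lp_rint p1 cG) => [k||k w]; last 1 first.
  + have [_ _ _ <-] := ht k; have [rGk _ _] := iE k; have [rG _ _] := iG.
    exact: (evaluation_le (rGk w) (rG w)).
  + by apply: cylinder_isonormal_integrable; case: (ht k) => -[].
  + exact: iX.
Qed.

End evaluation.

Lemma malliavin_closable :
  closable_in_Lp P p (whole_space E) (gamma_space g I e) (malliavin ip W).
Proof.
move=> Fn Gn G A cF iG cG.
have [phi hphi] := choice (@norming_functional R E).
have [rG [s ss sG'] _] := iG.
have key k n : n \in I -> {ae P, forall w, phi (s k w (e n)) (G w (e n)) = 0}.
  move=> In; have [_ fs ms] := ss k.
  have [] := finitely_valued_comp (fun S : H -> E => S (e n)) (conj fs ms).
  move=> /finite_seqP[r rE] _.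
  (* The functional attached to [s k w (e n)] varies with w, but only through finitely many values,
     so finitely many null sets are discarded. *)
  have : {ae P, forall w, forall y, y \in r -> phi y (G w (e n)) = 0}.
    elim: r {rE} => [|y r IH]; first by apply: aeW.
    have [ly ley _] := hphi y.
    have := malliavin_evaluation_closable In ly ley A cF iG cG.
    apply: filterS2 IH => w IH y0 y'; rewrite inE => /predU1P[->//|]; exact: IH.
  apply: filterS => w; apply.
  have : [set` r] (s k w (e n)) by rewrite -rE; exists w.
  by [].
have : {ae P, forall w, forall n k, n \in I -> phi (s k w (e n)) (G w (e n)) = 0}.
  apply/ae_foralln => n; apply/ae_foralln => k.
  have [In|nIn] := boolP (n \in I); first by apply: filterS (key k n In).
  by apply: aeW.
apply: filterS => w hw.
have Ge n : n \in I -> G w (e n) = 0.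
  move=> In; apply/eqP; rewrite -normr_le0.
  (* One copy bounds the distance from [s k w (e n)] to [G w (e n)]. The other bounds the norm of
     [s k w (e n)] itself: its norming functional vanishes at [G w (e n)]. *)
  have c : 2 * norm (gamma_space g I e) (s k w - G w) @[k --> \oo] --> (0 : R).
    by rewrite -[0](mulr0 2); apply: cvgMr; exact: sG'.
  rewrite -(cvg_lim _ c)//; apply: limr_ge; first by apply/cvg_ex; exists 0.
  apply: nearW => k; have [cs _ _] := ss k.
  have [lS leS eS] := hphi (s k w (e n)).
  have h1 := evaluation_le In lS leS (cs w) (rG w).
  rewrite (hw n k)// subr0 eS normr_id in h1.
  have h2 := norm_basis_le_gamma gG In (carrierB sG (cs w) (rG w)).
  have h3 := ler_distD (s k w (e n)) 0 (G w (e n)).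
  rewrite !sub0r !normrN in h3.
  apply: le_trans h3 _; rewrite mulr2n mulrDl mul1r; exact: lerD.
have [lG ctG _] := rG w.
have closedG : closed (G w @^-1` [set 0]).
  apply: preimage_closed => [x _|]; first exact: ctG.
  by apply: accessible_closed_set1; apply: hausdorff_accessible; exact: norm_hausdorff.
have lin0 : G w 0 = 0.
  have := lG 1 0 0; rewrite scaler0 addr0 scale1r => /(congr1 (fun y => y - G w 0)).
  by rewrite subrr addrK.
apply/funext => v; have : closure (G w @^-1` [set 0]) v.
  have : [set: H] v by [].
  rewrite -(onb_total onb); apply: closureS => _ [N [c ->]] /=.
  elim: N => [|N IH]; first by rewrite big_ord0 lin0.
  rewrite big_mkcond big_ord_recr/= -big_mkcond addrC.
  by case: ifP => In; rewrite ?add0r// lG IH Ge// scaler0 addr0.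
by move/closedG.
Qed.

End malliavin_derivative.

Unset Implicit Arguments.
Set Strict Implicit.

Theorem proposition3p3 (R : realType)
  (d : measure_display) (Omega : measurableType d) (P : probability Omega R)
  (P_complete : measure_is_complete P)
  (E : completeNormedModType R)
  (H : completeNormedModType R) (ip : H -> H -> R)
  (H_hilbert : is_inner_product ip) (H_separable : separable H)
  (W : H -> {RV P >-> R}) (W_isonormal : is_isonormal ip W)
  (d' : measure_display) (Omega' : measurableType d') (P' : probability Omega' R)
  (g : nat -> {RV P' >-> R}) (g_gaussian : is_gaussian_sequence g)
  (I : pred nat) (e : nat -> H) (e_basis : is_orthonormal_basis ip I e)
  (p : R) (p_ge1 : 1 <= p) :
  let D : (Omega -> E) -> (Omega -> H -> E) -> Prop := malliavin ip W in
  operator_into_Lp P p (whole_space E) (gamma_space g I e) D /\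
  closable_in_Lp P p (whole_space E) (gamma_space g I e) D.
Proof.
move=> D; split; first exact: malliavin_operator_into_Lp.
exact: malliavin_closable.
Qed.
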